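(* Let $f$ be a transcendental entire function of order zero and let $R_1>0$ be such that the sequence $(R_n)$ defined by $R_{n+1}=M(R_n)$, $n\in\mathbb N$, tends to $\infty$ and the sequence $(\epsilon_n)$ defined by \[ \epsilon_n=\max_{R_n\le r\le R_{n+1}}\frac{\log\log M(r)}{\log r} \] is positive. If \[ \sum_{n\in\mathbb N}\sqrt{\epsilon_n}<\infty, \] then $F(f)$ has no unbounded components.
   Context: For a transcendental entire function $f$ and $r>0$, $M(r)=\max_{|z|=r}|f(z)|$. The order of $f$ is $\rho=\limsup_{r\to\infty}\frac{\log\log M(r)}{\log r}$. $f^n$ denotes the $n$th iterate of $f$. The Fatou set $F(f)$ is the set of points $z\in\mathbb C$ such that $(f^n)_{n\in\mathbb N}$ forms a normal family in some neighbourhood of $z$. ''Components'' of $F(f)$ are its connected components. $\mathbb N=\{1,2,\dots\}$. *)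

(* Defs.v *)
From mathcomp Require Import all_boot all_order all_algebra complex.
From mathcomp Require Import all_classical all_reals all_analysis.

Set Implicit Arguments.
Unset Strict Implicit.
Unset Printing Implicit Defensive.

Import Order.TTheory GRing.Theory Num.Theory.
Import numFieldNormedType.Exports.

Local Open Scope classical_set_scope.
Local Open Scope ring_scope.

(* The library topologizes the field [R[i]] through its regular module. *)
Notation Cplx R := ((complex R)^o).

(* [`|z|] is an element of [R[i]]; this is the modulus as a real number. *)
Definition modulus (R : realType) (z : Cplx R) : R := complex.Re `|z|.

(* The scalar field of [Cplx R] is [R[i]], so [derivable f z 1] is complex
   differentiability. *)
Definition entire (R : realType) (f : Cplx R -> Cplx R) : Prop :=
  forall z, derivable f z 1.

Definition transcendental_entire (R : realType) (f : Cplx R -> Cplx R) : Prop :=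
  entire f /\ ~ exists p : {poly complex R}, forall z, f z = p.[z].

(* For continuous [f] and [r >= 0] the supremum is attained. *)
Definition maxmod (R : realType) (f : Cplx R -> Cplx R) (r : R) : R :=
  sup [set modulus (f z) | z in [set z | modulus z = r]].

(* [ln x = 0] for [x <= 0] and [x / 0 = 0]. *)
Definition loglog_ratio (R : realType) (f : Cplx R -> Cplx R) (r : R) : R :=
  ln (ln (maxmod f r)) / ln r.

Definition order_of_growth (R : realType) (f : Cplx R -> Cplx R) : \bar R :=
  limf_esup (fun r : R => (loglog_ratio f r)%:E) (pinfty_nbhs R).

(* Indices start at 0: [max_iter f R1 n] is R_(n+1), and [max_ratio f R1 n] is
   epsilon_(n+1). *)
Definition max_iter (R : realType) (f : Cplx R -> Cplx R) (R1 : R) (n : nat) : R :=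
  iter n (maxmod f) R1.

(* The supremum is a maximum as soon as the quotient is continuous on the
   interval, in particular when [1 < r] and [1 < maxmod f r] there. *)
Definition max_ratio (R : realType) (f : Cplx R -> Cplx R) (R1 : R) (n : nat) : R :=
  sup [set loglog_ratio f r |
        r in [set r | max_iter f R1 n <= r <= max_iter f R1 n.+1]].

(* Normality in the sense of Montel, for entire functions and an open set [U]:
   every sequence in [G] has a subsequence which, uniformly on compact subsets
   of [U], tends either to a finite limit function or to infinity. *)
Definition normal_family (R : realType) (U : set (Cplx R))
    (G : set (Cplx R -> Cplx R)) : Prop :=
  forall g : nat -> Cplx R -> Cplx R, (forall k, G (g k)) ->
  exists2 s : nat -> nat, {homo s : m n / (m < n)%N} &
    (exists h : Cplx R -> Cplx R,
       forall K, compact K -> K `<=` U -> {uniform K, (g \o s) @ \oo --> h})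
    \/
    (forall K, compact K -> K `<=` U ->
       forall B : R, \forall k \near \oo,
         forall z, K z -> B < modulus (g (s k) z)).

Definition iterates (R : realType) (f : Cplx R -> Cplx R) :
    set (Cplx R -> Cplx R) :=
  [set iter n f | n in [set n | (0 < n)%N]].

Definition fatou_set (R : realType) (f : Cplx R -> Cplx R) : set (Cplx R) :=
  [set z | exists2 U, open_nbhs z U & normal_family U (iterates f)].

Definition is_component_of (R : realType) (A D : set (Cplx R)) : Prop :=
  exists2 z, A z & D = connected_component A z.

(* Main.v *)
Require Import Defs.
From mathcomp Require Import all_boot all_order all_algebra complex.
From mathcomp Require Import all_classical all_reals all_analysis.
From mathcomp Require Import ring lra.

(** Write [R_n] for the iterated maximum moduli [max_iter f R1 n], and [eps_n] for
    [max_ratio f R1 n]. The proof plays an expansion property of connected sets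
    against the distortion of the iterates of [f] near an unbounded subset of the
    Fatou set.

    Expansion. On [[R_n, R_(n+1)]] the logarithm of the maximum modulus is at most the
    power [eps_n] of the radius, so [f] has few zeros there, and for all large [n] and
    all [k] between [3/2] and [2], [min_modulus] finds in [[R_n, R_n ^ k]] a radius
    [rho] such that [|f z| >= R_(n+1) ^ (k (1 - 352 sqrt eps_n))] for
    [|z| = rho]. To see this, rotate all zeros to the negative axis: the logarithm
    [psi] of the maximum modulus of the resulting product, as a function of the
    logarithm of the radius, satisfies [psi' <= 7 sqrt eps_n * psi] somewhere
    ([psi_slow_point]). At such a point [psi'] bounds, up to a constant, the number of
    zeros in a disc of four times the radius and the influence of the others, hence the
    loss in passing from the maximum to the minimum modulus ([zeros_product_lower]);
    and the three circles theorem ([hadamard]) bounds [psi] from below. As the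
    [sqrt eps_n] have a finite sum, exponents [k_n >= 3/2] can be chosen for all large
    [n] such that the circle found for [k_n] is mapped outside the disc of radius
    [R_(n+1) ^ k_(n+1)] ([growth_sequence]). If now a connected set contains a point of modulus at most
    [R_n] and one of modulus at least [R_n ^ k_n], then its image under [f] has the
    same property with [n + 1] in place of [n], and so on for all iterates
    ([connected_iter_far]).

    Let [X] be an unbounded connected subset of the Fatou set. By the expansion
    property no subsequence of the iterates can stay bounded along a large connected
    piece of [X], so normality makes the iterates tend to infinity uniformly near each
    point of [X] ([unbounded_fatou_escapes]). Call [V] the open set of all points near
    which this happens. There are two cases.

    If all large circles meet the complement of [V], then near a point of [V] each
    branch of the logarithm of a high iterate omits a value within distance [4] of each
    of its values, because iterates map [V] into itself. By Bloch's theorem its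
    derivative is bounded, so [|f^j x| <= C |f^j y|] near each point of [X], and along
    chains of discs also for all [x], [y] in a large connected piece of [X]. But the
    expansion property provides [|f^j x| >= R ^ (3/2)] and [|f^j y| <= R] with [R]
    arbitrarily large ([comparable_contra]).

    Otherwise there are circles of arbitrarily large radius in [V]. Harnack's
    inequality for the iterates, which have no zeros near a point of [V], gives
    [ln |f^j x| <= C ln |f^j y|] along each such circle and along [X]. As [X] and its
    image [f X] meet a common circle of this kind, on a given circle [|f^(j+1)|] is at
    most a fixed power of a lower bound [s] of [|f^j|], where [s] tends to infinity with
    [j]. But [f] has a fixed point ([fixed_point_exists]), and if it lies inside the
    circle then the image of the disc under [f^j] covers a disc of radius about [s / 4],
    where [|f|] is therefore at most a fixed power of [s]. Only polynomials have this
    property ([log_comparable_contra]).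

    The function theory involved (Cauchy's formula, the maximum principle, the
    inequalities of Schwarz, Harnack and Bloch, the three circles theorem) is derived
    from Goursat's lemma on rectangles. *)

Import Order.TTheory GRing.Theory Num.Theory.
Import numFieldNormedType.Exports.

Local Open Scope classical_set_scope.
Local Open Scope ring_scope.

Set Implicit Arguments.
Unset Strict Implicit.
Unset Printing Implicit Defensive.

Local Notation Re := complex.Re.
Local Notation Im := complex.Im.
Local Open Scope complex_scope.
Local Open Scope ring_scope.

(** * The modulus of a complex number *)

Section Modulus.
Context {R : realType}.
Implicit Types (z w : R[i]).

(** The norm of [R[i]] takes its values in [R[i]]; this is its real version. *)
Definition md z : R := Num.sqrt (Re z ^+ 2 + Im z ^+ 2).

Lemma md_normc z : md z = Normc.normc z.
Proof. by case: z. Qed.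

Lemma md_ge0 z : 0 <= md z.
Proof. exact: sqrtr_ge0. Qed.

Lemma mdM z w : md (z * w) = md z * md w.
Proof. by rewrite !md_normc; exact: Normc.normcM. Qed.

Lemma mdD z w : md (z + w) <= md z + md w.
Proof. by rewrite !md_normc; exact: le_normcD. Qed.

Lemma md0 : md (0 : R[i]) = 0.
Proof. by rewrite md_normc; exact: Normc.normc0. Qed.

Lemma md1 : md (1 : R[i]) = 1.
Proof. by rewrite md_normc; exact: Normc.normc1. Qed.

Lemma md_eq0 z : (md z == 0) = (z == 0).
Proof.
apply/eqP/eqP => [|->]; last exact: md0.
by rewrite md_normc; exact: Normc.eq0_normc.
Qed.

Lemma md_gt0 z : (0 < md z) = (z != 0).
Proof. by rewrite lt0r md_ge0 andbT md_eq0. Qed.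

Lemma mdN z : md (- z) = md z.
Proof. by case: z => a b; rewrite /md /= !sqrrN. Qed.

Lemma mdC z w : md (z - w) = md (w - z).
Proof. by rewrite -mdN opprB. Qed.

Lemma mdV z : md z^-1 = (md z)^-1.
Proof. by rewrite !md_normc; exact: Normc.normcV. Qed.

Lemma mdX z n : md (z ^+ n) = md z ^+ n.
Proof. by elim: n => [|n IH]; rewrite ?expr0 ?md1 // !exprS mdM IH. Qed.

Lemma md_real (x : R) : md x%:C = `|x|.
Proof. by rewrite /md /= expr0n /= addr0 sqrtr_sqr. Qed.

Lemma md_Re z : `|Re z| <= md z.
Proof.
rewrite /md -sqrtr_sqr ler_wsqrtr // lerDl; exact: sqr_ge0.
Qed.

Lemma md_Im z : `|Im z| <= md z.
Proof.
rewrite /md -sqrtr_sqr ler_wsqrtr // lerDr; exact: sqr_ge0.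
Qed.

Lemma mdE z : md z ^+ 2 = Re z ^+ 2 + Im z ^+ 2.
Proof. by rewrite sqr_sqrtr // addr_ge0 // sqr_ge0. Qed.

Lemma md_le z : md z <= `|Re z| + `|Im z|.
Proof.
rewrite -(@ler_pXn2r _ 2) // ?nnegrE ?md_ge0 ?addr_ge0 // mdE sqrrD !real_normK ?num_real //.
by rewrite -addrA lerD2l lerDr mulrn_wge0 // mulr_ge0.
Qed.

Lemma mdB z w : md (z - w) <= md z + md w.
Proof. by rewrite -(mdN w) mdD. Qed.

Lemma md_dist z w : md z - md w <= md (z - w).
Proof. by rewrite lerBlDr -{1}(subrK w z) mdD. Qed.

Lemma md_prod (I : Type) (s : seq I) (P : pred I) (F : I -> R[i]) :
  md (\prod_(i <- s | P i) F i) = \prod_(i <- s | P i) md (F i).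
Proof. by elim/big_rec2: _ => [|i x y _ <-]; rewrite ?md1 ?mdM. Qed.

Lemma md_conj z : z * conjc z = (md z ^+ 2)%:C.
Proof.
by rewrite mdE; case: z => a b /=; congr Complex; simpc; ring.
Qed.

Lemma md_conjc z : md (conjc z) = md z.
Proof. by case: z => a b; rewrite /md /= sqrrN. Qed.

Lemma modulusE z : modulus (z : Cplx R) = md z.
Proof. by rewrite /modulus normc_def; case: z. Qed.

End Modulus.

(** * Continuity and complex derivatives along an embedding *)

(** [T] is [R] or [R[i]], embedded in the complex plane by [i]: functions of a
    real variable and of a complex variable share one differential calculus. *)
Section Calculus.
Context {R : realType} {T : Type} (i : T -> R[i]).
Implicit Types (f g : T -> R[i]) (t s : T).

Definition ccont f t :=
  forall e : R, 0 < e -> exists2 d : R, 0 < d &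
    forall s, md (i s - i t) < d -> md (f s - f t) < e.

(** Caratheodory's form of the derivative: the calculus rules become rules on
    continuous functions. *)
Definition cder f t (d : R[i]) :=
  exists phi : T -> R[i], [/\ ccont phi t, phi t = d &
    forall s, f s - f t = phi s * (i s - i t)].

Lemma ccont_cst c t : ccont (fun=> c) t.
Proof. by move=> e e0; exists 1 => // s _; rewrite subrr md0. Qed.

Lemma ccont_id t : ccont i t.
Proof. by move=> e e0; exists e. Qed.

Lemma ccont_near f g t (d : R) : 0 < d ->
  (forall s, md (i s - i t) < d -> f s = g s) -> ccont f t -> ccont g t.
Proof.
move=> d0 fg cf e e0; have [d1 d10 H] := cf e e0.
exists (Num.min d d1); first by rewrite lt_min d0.
move=> s; rewrite lt_min => /andP[sd sd1].
by rewrite -!fg ?subrr ?md0 ?H.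
Qed.

Lemma ccontD f g t : ccont f t -> ccont g t -> ccont (fun s => f s + g s) t.
Proof.
move=> cf cg e e0; have e20 : 0 < e / 2 by rewrite divr_gt0.
have [d d0 Hd] := cf _ e20; have [d' d'0 Hd'] := cg _ e20.
exists (Num.min d d'); first by rewrite lt_min d0.
move=> s; rewrite lt_min => /andP[/Hd fs /Hd' gs].
rewrite (_ : _ - _ = (f s - f t) + (g s - g t)); last by ring.
by apply: le_lt_trans (mdD _ _) _; rewrite (splitr e) ltrD.
Qed.

Lemma ccontM f g t : ccont f t -> ccont g t -> ccont (fun s => f s * g s) t.
Proof.
move=> cf cg e e0.
set A := md (f t) + 1; set B := md (g t) + 1.
have A0 : 0 < A by rewrite ltr_wpDl // md_ge0.
have B0 : 0 < B by rewrite ltr_wpDl // md_ge0.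
have e1 : 0 < e / 2 / A by rewrite !divr_gt0.
have e2 : 0 < Num.min 1 (e / 2 / B) by rewrite lt_min ltr01 !divr_gt0.
have [d d0 Hd] := cf _ e2; have [d' d'0 Hd'] := cg _ e1.
exists (Num.min d d'); first by rewrite lt_min d0.
move=> s; rewrite lt_min => /andP[/Hd + /Hd' gs]; rewrite lt_min => /andP[f1 f2].
rewrite (_ : _ - _ = f s * (g s - g t) + (f s - f t) * g t); last by ring.
apply: le_lt_trans (mdD _ _) _; rewrite !mdM (splitr e).
have fsA : md (f s) <= A.
  by rewrite -(subrK (f t) (f s)) (le_trans (mdD _ _)) // addrC lerD2l ltW.
apply: ltr_leD.
  apply: (@le_lt_trans _ _ (A * md (g s - g t))).
    by rewrite ler_wpM2r // md_ge0.
  by rewrite mulrC -ltr_pdivlMr.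
apply: (@le_trans _ _ (md (f s - f t) * B)).
  by rewrite ler_wpM2l ?md_ge0 // /B lerDl.
by rewrite -ler_pdivlMr // ltW.
Qed.

Lemma ccontN f t : ccont f t -> ccont (fun s => - f s) t.
Proof. by move=> cf e /cf[d d0 H]; exists d => // s /H; rewrite -opprD mdN. Qed.

Lemma ccontB f g t : ccont f t -> ccont g t -> ccont (fun s => f s - g s) t.
Proof. by move=> cf /ccontN; exact: ccontD. Qed.

Lemma ccontV f t : f t != 0 -> ccont f t -> ccont (fun s => (f s)^-1) t.
Proof.
move=> ft0 cf e e0; have m0 : 0 < md (f t) by rewrite md_gt0.
have e1 : 0 < Num.min (md (f t) / 2) (e * (md (f t) ^+ 2 / 2)).
  by rewrite lt_min divr_gt0 //= mulr_gt0 // divr_gt0 // exprn_gt0.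
have [d d0 Hd] := cf _ e1; exists d => // s /Hd; rewrite lt_min => /andP[h1 h2].
have ms : md (f t) / 2 < md (f s).
  have := md_dist (f t) (f s); rewrite mdC => h3.
  by lra.
have ms0 : 0 < md (f s) by apply: lt_trans ms; rewrite divr_gt0.
have fs0 : f s != 0 by rewrite -md_gt0.
rewrite (_ : _ - _ = (f t - f s) / (f s * f t)); last by field; rewrite fs0 ft0.
rewrite mdM mdV mdM mdC ltr_pdivrMr ?mulr_gt0 //.
apply: lt_le_trans h2 _; rewrite ler_wpM2l ?(ltW e0) //.
by rewrite expr2 mulrAC ler_wpM2r // ltW.
Qed.

Lemma ccont_comp f (g : R[i] -> R[i]) t :
  ccont f t ->
  (forall e : R, 0 < e -> exists2 d : R, 0 < d &
    forall w, md (w - f t) < d -> md (g w - g (f t)) < e) ->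
  ccont (fun s => g (f s)) t.
Proof.
move=> cf cg e /cg[d d0 H]; have [d1 d10 H1] := cf _ d0.
by exists d1 => // s /H1 /H.
Qed.

Lemma ccontX f t n : ccont f t -> ccont (fun s => f s ^+ n) t.
Proof.
move=> cf; elim: n => [|n IH].
  by rewrite (_ : (fun s => _) = fun=> 1); [exact: ccont_cst|apply/funext => s; rewrite expr0].
rewrite (_ : (fun s => _) = fun s => f s * f s ^+ n); first exact: ccontM.
by apply/funext => s; rewrite exprS.
Qed.

Lemma cderP f t d :
  cder f t d <-> (forall e : R, 0 < e -> exists2 r : R, 0 < r &
    forall s, md (i s - i t) < r ->
      md (f s - f t - d * (i s - i t)) <= e * md (i s - i t)).
Proof.
split=> [[phi [cphi <- H]] e e0|H].
  have [r r0 Hr] := cphi _ e0; exists r => // s /Hr h.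
  by rewrite H -mulrBl mdM ler_wpM2r ?md_ge0 // ltW.
have eqi s : i s = i t -> f s = f t.
  move=> st; have [r r0 /(_ s)] := H 1 ltr01.
  rewrite st subrr md0 mulr0 mulr0 subr0 => /(_ r0).
  by rewrite le_eqVlt ltNge md_ge0 orbF md_eq0 subr_eq0 => /eqP.
exists (fun s => if i s == i t then d else (f s - f t) / (i s - i t)); split.
- move=> e e0; have e20 : 0 < e / 2 by rewrite divr_gt0.
  have [r r0 Hr] := H _ e20; exists r => // s /Hr; rewrite eqxx.
  case: eqP => [->|/eqP st]; first by rewrite !subrr md0.
  move=> h; have m0 : 0 < md (i s - i t) by rewrite md_gt0 subr_eq0.
  rewrite -(ltr_pM2r m0) -mdM mulrBl divfK ?subr_eq0 //.
  by apply: le_lt_trans h _; rewrite ltr_pM2r // ltr_pdivrMr // ltr_pMr // ltr1n.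
- by rewrite eqxx.
- move=> s; case: eqP => [st|/eqP st]; first by rewrite st subrr mulr0 (eqi _ st) subrr.
  by rewrite divfK // subr_eq0.
Qed.

Lemma cder_near f g t d (e : R) : 0 < e ->
  (forall s, md (i s - i t) < e -> f s = g s) -> cder f t d -> cder g t d.
Proof.
move=> e0 fg /cderP H; apply/cderP => a /H[r r0 Hr].
exists (Num.min e r); first by rewrite lt_min e0.
move=> s; rewrite lt_min => /andP[se sr].
by rewrite -!fg ?subrr ?md0 //; exact: Hr.
Qed.

Lemma cder_cont f t d : cder f t d -> ccont f t.
Proof.
move=> [phi [cphi _ H]].
rewrite (_ : f = fun s => f t + phi s * (i s - i t)); last first.
  by apply/funext => s; rewrite -H addrC subrK.
apply: ccontD; first exact: ccont_cst.
apply: ccontM => //; apply: ccontB; [exact: ccont_id|exact: ccont_cst].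
Qed.

Lemma cder_cst c t : cder (fun=> c) t 0.
Proof. by exists (fun=> 0); split; [exact: ccont_cst| |move=> s; rewrite subrr mul0r]. Qed.

Lemma cder_id t : cder i t 1.
Proof. by exists (fun=> 1); split; [exact: ccont_cst| |move=> s; rewrite mul1r]. Qed.

Lemma cderD f g t a b : cder f t a -> cder g t b -> cder (fun s => f s + g s) t (a + b).
Proof.
move=> [p [cp <- Hp]] [q [cq <- Hq]]; exists (fun s => p s + q s); split => //.
- exact: ccontD.
- by move=> s; rewrite mulrDl -Hp -Hq; ring.
Qed.

Lemma cderN f t a : cder f t a -> cder (fun s => - f s) t (- a).
Proof.
move=> [p [cp <- Hp]]; exists (fun s => - p s); split => //.
- exact: ccontN.
- by move=> s; rewrite mulNr -Hp; ring.
Qed.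

Lemma cderB f g t a b : cder f t a -> cder g t b -> cder (fun s => f s - g s) t (a - b).
Proof. by move=> cf /cderN; exact: cderD. Qed.

Lemma cderM f g t a b : cder f t a -> cder g t b ->
  cder (fun s => f s * g s) t (a * g t + f t * b).
Proof.
move=> df dg; have := cder_cont df => cf.
case: df dg => [p [cp <- Hp]] [q [cq <- Hq]].
exists (fun s => p s * g t + f s * q s); split => //.
- by apply: ccontD; apply: ccontM => //; exact: ccont_cst.
- move=> s; rewrite mulrDl mulrAC -Hp -mulrA -Hq; ring.
Qed.

Lemma cderZ f t a c : cder f t a -> cder (fun s => c * f s) t (c * a).
Proof. by move=> df; have := cderM (cder_cst c t) df; rewrite mul0r add0r. Qed.

Lemma cderV f t a : f t != 0 -> cder f t a -> cder (fun s => (f s)^-1) t (- a / f t ^+ 2).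
Proof.
move=> ft0 df; have cf := cder_cont df; case: df => p [cp <- Hp].
have [d d0 Hd] : exists2 d : R, 0 < d & forall s, md (i s - i t) < d -> f s != 0.
  have m0 : 0 < md (f t) by rewrite md_gt0.
  have [d d0 Hd] := cf _ m0; exists d => // s /Hd.
  by apply: contraTneq => ->; rewrite sub0r mdN ltxx.
(* The value [0] of the inverse at the zeros of [f] needs its own quotient. *)
exists (fun s => if f s == 0 then p s / f t ^+ 2 else - p s * (f s)^-1 * (f t)^-1).
split.
- apply: (@ccont_near (fun s => - p s * (f s)^-1 * (f t)^-1) _ _ d) => //.
    by move=> s /Hd /negbTE ->.
  apply: ccontM; last exact: ccont_cst.
  by apply: ccontM; [exact: ccontN|exact: ccontV].
- by rewrite (negbTE ft0) expr2 invfM mulrA.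
- move=> s; case: eqP => [fs0|/eqP fs0].
    by rewrite mulrAC -Hp fs0 invr0; field.
  rewrite mulrAC (mulrAC (- p s)) mulNr -Hp; field.
  by rewrite ft0 fs0.
Qed.

Lemma cder_comp f (g : R[i] -> R[i]) t a (psi : R[i] -> R[i]) :
  cder f t a ->
  (forall e : R, 0 < e -> exists2 d : R, 0 < d &
    forall w, md (w - f t) < d -> md (psi w - psi (f t)) < e) ->
  (forall w, g w - g (f t) = psi w * (w - f t)) ->
  cder (fun s => g (f s)) t (psi (f t) * a).
Proof.
move=> df cpsi Hg; have cf := cder_cont df; case: df => [p [cp <- Hp]].
exists (fun s => psi (f s) * p s); split => //.
- by apply: ccontM => //; exact: ccont_comp.
- by move=> s; rewrite Hg Hp mulrA.
Qed.

End Calculus.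

Section ComplexVariable.
Context {R : realType}.
Local Notation C := R[i].
Implicit Types (f g h : C -> C) (z w : C).

Definition cc f z := ccont (fun w : C => w) f z.
Definition cd f z d := cder (fun w : C => w) f z d.
Definition hol f z := exists d, cd f z d.

Lemma hol_cont f z : hol f z -> cc f z.
Proof. by move=> [d]; exact: cder_cont. Qed.

Lemma cc_comp {T : Type} (i : T -> C) (u : T -> C) g t :
  ccont i u t -> cc g (u t) -> ccont i (fun s => g (u s)) t.
Proof. exact: ccont_comp. Qed.

Lemma cd_comp {T : Type} (i : T -> C) (u : T -> C) g t a b :
  cder i u t a -> cd g (u t) b -> cder i (fun s => g (u s)) t (b * a).
Proof.
by move=> du [psi [cpsi <- Hg]]; exact: cder_comp.
Qed.

Lemma hol_comp f g z : hol f z -> hol g (f z) -> hol (fun w => g (f w)) z.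
Proof. by move=> [a fa] [b gb]; exists (b * a); exact: cd_comp. Qed.

Lemma hol_cst c z : hol (fun=> c) z.
Proof. by exists 0; exact: cder_cst. Qed.

Lemma hol_id z : hol (fun w => w) z.
Proof. by exists 1; exact: cder_id. Qed.

Lemma holD f g z : hol f z -> hol g z -> hol (fun w => f w + g w) z.
Proof. by move=> [a fa] [b gb]; exists (a + b); exact: cderD. Qed.

Lemma holN f z : hol f z -> hol (fun w => - f w) z.
Proof. by move=> [a fa]; exists (- a); exact: cderN. Qed.

Lemma holB f g z : hol f z -> hol g z -> hol (fun w => f w - g w) z.
Proof. by move=> hf /holN; exact: holD. Qed.

Lemma holM f g z : hol f z -> hol g z -> hol (fun w => f w * g w) z.
Proof. by move=> [a fa] [b gb]; exists (a * g z + f z * b); exact: cderM. Qed.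

Lemma holV f z : f z != 0 -> hol f z -> hol (fun w => (f w)^-1) z.
Proof. by move=> fz [a fa]; exists (- a / f z ^+ 2); exact: cderV. Qed.

Lemma hol_div f g z : g z != 0 -> hol f z -> hol g z -> hol (fun w => f w / g w) z.
Proof. by move=> gz hf hg; apply: holM => //; exact: holV. Qed.

Lemma hol_near f g z (e : R) : 0 < e ->
  (forall w, md (w - z) < e -> f w = g w) -> hol f z -> hol g z.
Proof. by move=> e0 fg [d fd]; exists d; exact: (cder_near e0 fg fd). Qed.

End ComplexVariable.

(** * Primitives of continuous complex functions of a real variable *)

Section RealVariable.
Context {R : realType}.
Local Notation C := R[i].
Implicit Types (g G : R -> C) (t s : R).

Definition rcont g t := ccont (fun t : R => t%:C) g t.
Definition rder g t d := cder (fun t : R => t%:C) g t d.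

Lemma rdistE s t : md (s%:C - t%:C) = `|s - t|.
Proof. by rewrite -rmorphB md_real. Qed.

Lemma real_continuousP (u : R -> R) t :
  {for t, continuous u} <-> (forall e : R, 0 < e -> exists2 d : R, 0 < d &
    forall s, `|s - t| < d -> `|u s - u t| < e).
Proof.
split=> [ct e e0|H].
  move/cvgrPdist_lt: ct => /(_ e e0)/nbhs_ballP[d d0 Hd]; exists d => // s st.
  by rewrite distrC; apply: Hd; rewrite /ball /= distrC.
apply/cvgrPdist_lt => e /H[d d0 Hd]; apply/nbhs_ballP; exists d => //= s.
by rewrite /ball /= distrC => /Hd; rewrite distrC.
Qed.

Lemma ReB (z w : C) : Re (z - w) = Re z - Re w. Proof. by case: z; case: w. Qed.
Lemma ImB (z w : C) : Im (z - w) = Im z - Im w. Proof. by case: z; case: w. Qed.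
Lemma ReD (z w : C) : Re (z + w) = Re z + Re w. Proof. by case: z; case: w. Qed.
Lemma ImD (z w : C) : Im (z + w) = Im z + Im w. Proof. by case: z; case: w. Qed.
Lemma ReM (z w : C) : Re (z * w) = Re z * Re w - Im z * Im w.
Proof. by case: z; case: w. Qed.
Lemma ImM (z w : C) : Im (z * w) = Re z * Im w + Im z * Re w.
Proof. by case: z => a b; case: w => c d. Qed.
Lemma ReMr (z : C) t : Re (z * t%:C) = Re z * t.
Proof. by rewrite ReM /= mulr0 subr0. Qed.
Lemma ImMr (z : C) t : Im (z * t%:C) = Im z * t.
Proof. by rewrite ImM /= mulr0 add0r. Qed.

Lemma rcont_Re g t : rcont g t -> {for t, continuous (fun s => Re (g s))}.
Proof.
move=> cg; apply/real_continuousP => e /cg[d d0 H]; exists d => // s.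
rewrite -rdistE => /H; apply: le_lt_trans; rewrite -ReB; exact: md_Re.
Qed.

Lemma rcont_Im g t : rcont g t -> {for t, continuous (fun s => Im (g s))}.
Proof.
move=> cg; apply/real_continuousP => e /cg[d d0 H]; exists d => // s.
rewrite -rdistE => /H; apply: le_lt_trans; rewrite -ImB; exact: md_Im.
Qed.

Lemma rcont_pair (u v : R -> R) t : {for t, continuous u} ->
  {for t, continuous v} -> rcont (fun s => Complex (u s) (v s)) t.
Proof.
move=> /real_continuousP cu /real_continuousP cv e e0.
have e20 : 0 < e / 2 by rewrite divr_gt0.
have [d d0 Hd] := cu _ e20; have [d' d'0 Hd'] := cv _ e20.
exists (Num.min d d'); first by rewrite lt_min d0.
move=> s; rewrite rdistE lt_min => /andP[/Hd h /Hd' h'].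
apply: le_lt_trans (md_le _) _ => /=; lra.
Qed.

Lemma rder_Re g t d : rder g t d -> is_derive t 1 (fun s => Re (g s)) (Re d).
Proof.
move=> [p [cp <- H]]; apply/is_derive1_caratheodory.
exists (fun s => Re (p s)); split => //; last exact: rcont_Re.
by move=> s; rewrite -ReB H -rmorphB ReMr.
Qed.

Lemma rder_pair (u v : R -> R) t a b : is_derive t 1 u a ->
  is_derive t 1 v b -> rder (fun s => Complex (u s) (v s)) t (Complex a b).
Proof.
move=> /is_derive1_caratheodory[p [Hp cp <-]] /is_derive1_caratheodory[q [Hq cq <-]].
exists (fun s => Complex (p s) (q s)); split => //; first exact: rcont_pair.
move=> s; rewrite -rmorphB; apply/eqP; rewrite eq_complex; apply/andP; split; apply/eqP.
  by rewrite ReMr -Hp.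
by rewrite ImMr -Hq.
Qed.

Lemma is_derive_continuous (u : R -> R) t a : is_derive t 1 u a -> {for t, continuous u}.
Proof. by move=> [du _]; exact/differentiable_continuous/derivable1_diffP. Qed.

(** Rotating the increment to the positive axis reduces the complex mean value
    inequality to the real mean value theorem. *)
Lemma mean_value_ineq g G (a b M : R) : a <= b ->
  (forall t, a <= t <= b -> rder G t (g t)) ->
  (forall t, a <= t <= b -> md (g t) <= M) ->
  md (G b - G a) <= M * (b - a).
Proof.
move=> ab dG gM; have [w0|w0] := eqVneq (G b - G a) 0.
  rewrite w0 md0 mulr_ge0 ?subr_ge0 // (le_trans (md_ge0 (g a))) // gM //.
  by rewrite lexx.
set w := G b - G a in w0 *; have mw : 0 < md w by rewrite md_gt0.
pose u := conjc w / (md w)%:C.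
have u1 : md u = 1 by rewrite mdM mdV md_conjc md_real gtr0_norm // divff // gt_eqF.
have uw : u * w = (md w)%:C.
  rewrite /u mulrAC (mulrC _ w) md_conj expr2 rmorphM /= mulfK //.
  by rewrite -md_eq0 md_real normr_eq0 gt_eqF.
have dphi t : a <= t <= b -> is_derive t 1 (fun s => Re (u * G s)) (Re (u * g t)).
  by move=> tab; apply: rder_Re; apply: cderZ; exact: dG.
have /= := @MVT_segment _ (fun s => Re (u * G s)) (fun t => Re (u * g t)) a b ab.
case.
- by move=> x; rewrite in_itv /= => /andP[ax xb]; apply: dphi; rewrite !ltW.
- apply: continuous_in_subspaceT => x; rewrite inE /= in_itv /= => xab.
  exact: is_derive_continuous (dphi x xab).
move=> c; rewrite in_itv /= => cab.
rewrite -ReB -mulrBr uw /= => ->.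
rewrite ler_wpM2r ?subr_ge0 //.
apply: le_trans (ler_norm _) _; apply: le_trans (md_Re _) _.
by rewrite mdM u1 mul1r gM.
Qed.

Lemma rder_eq_cst G (a b : R) : a <= b ->
  (forall t, a <= t <= b -> rder G t 0) -> G b = G a.
Proof.
move=> ab dG; apply/eqP; rewrite -subr_eq0 -md_eq0 eq_le md_ge0 andbT.
have := @mean_value_ineq (fun=> 0) G a b 0 ab dG; rewrite mul0r; apply.
by move=> t _; rewrite md0.
Qed.

Lemma real_prim_exists (u : R -> R) (lo : R) : continuous u ->
  exists U : R -> R, forall t, lo < t -> is_derive t 1 U (u t).
Proof.
move=> cu; exists (fun x => \int[lebesgue_measure]_(t in `[lo, x]) u t)%R => t lot.
have iu : lebesgue_measure.-integrable `[lo, t + 1] (EFin \o u).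
  apply: continuous_compact_integrable; first exact: segment_compact.
  by apply: continuous_subspaceT => x; exact: cu.
have tt1 : t < t + 1 by rewrite ltrDl.
have [d1 d2] := continuous_FTC1_closed tt1 iu lot (cu t).
rewrite derive1E in d2; exact: DeriveDef d1 d2.
Qed.

Lemma prim_exists g (lo : R) : (forall t, rcont g t) ->
  exists G, forall t, lo < t -> rder G t (g t).
Proof.
move=> cg.
have [U HU] := @real_prim_exists (fun t => Re (g t)) lo (fun t => rcont_Re (cg t)).
have [V HV] := @real_prim_exists (fun t => Im (g t)) lo (fun t => rcont_Im (cg t)).
exists (fun t => Complex (U t) (V t)) => t lot.
rewrite (_ : g t = Complex (Re (g t)) (Im (g t))); last by case: (g t).
by apply: rder_pair; [exact: HU|exact: HV].
Qed.

End RealVariable.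

(** * Goursat's lemma and primitives *)

Section LineIntegral.
Context {R : realType}.
Local Notation C := R[i].
Implicit Types (g G : R -> C) (a b t s : R).

(** The increment of a primitive: by [cintE] the choice of the primitive does
    not matter, and additivity and linearity are inherited from primitives. *)
Definition cint g a b : C :=
  let G := xget (fun=> 0) [set G : R -> C |
    forall t, Num.min a b - 1 < t -> rder G t (g t)] in G b - G a.

Lemma rder_between_eq g G H a b :
  (forall t, Num.min a b <= t <= Num.max a b -> rder G t (g t)) ->
  (forall t, Num.min a b <= t <= Num.max a b -> rder H t (g t)) ->
  G b - G a = H b - H a.
Proof.
wlog ab : a b / a <= b => [W dG dH|].
  case: (leP a b) => [ab|/ltW ab]; first exact: W.
  rewrite minC maxC in dG dH; have := W b a ab dG dH.
  by move/(congr1 (fun x => - x)); rewrite !opprB.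
rewrite (min_idPl ab) (max_idPr ab) => dG dH.
have E : G b - H b = G a - H a.
  have := @rder_eq_cst _ (fun s => G s - H s) a b ab; apply=> t tab.
  by rewrite -(subrr (g t)); apply: cderB; [exact: dG|exact: dH].
by rewrite -(subrK (H b) (G b)) E; ring.
Qed.

Lemma cintE g G a b : (forall t, rcont g t) ->
  (forall t, Num.min a b <= t <= Num.max a b -> rder G t (g t)) ->
  cint g a b = G b - G a.
Proof.
move=> cg dG; rewrite /cint; case: xgetP => [H _ dH|nH].
  apply: (rder_between_eq _ dG) => t /andP[h _]; apply: dH.
  by apply: lt_le_trans h; rewrite ltrBlDr ltrDl.
by have [H HH] := prim_exists (Num.min a b - 1) cg; case: (nH H).
Qed.

Lemma cint_primE g a b lo : (forall t, rcont g t) -> lo < a -> lo < b ->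
  exists2 G, (forall t, lo < t -> rder G t (g t)) &
    cint g a b = G b - G a.
Proof.
move=> cg la lb; have [G HG] := prim_exists lo cg; exists G => //.
apply: cintE => // t /andP[h _]; apply: HG; apply: lt_le_trans h.
by rewrite lt_min la.
Qed.

Lemma cint_refl g a : cint g a a = 0.
Proof. by rewrite /cint subrr. Qed.

Lemma cint_split g a b c : (forall t, rcont g t) ->
  cint g a b + cint g b c = cint g a c.
Proof.
move=> cg; set lo := Num.min a (Num.min b c) - 1.
have loa : lo < a by rewrite ltrBlDr ltr_pwDr // ge_min lexx.
have lob : lo < b by rewrite ltrBlDr ltr_pwDr // !ge_min lexx orbT.
have loc : lo < c by rewrite ltrBlDr ltr_pwDr // !ge_min lexx !orbT.
have [G HG] := prim_exists lo cg.
have E x y : lo < x -> lo < y -> cint g x y = G y - G x.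
  move=> lx ly; apply: cintE => // t /andP[h _]; apply: HG.
  by apply: lt_le_trans h; rewrite lt_min lx.
by rewrite !E //; ring.
Qed.

Lemma cint_opp g a b : (forall t, rcont g t) -> cint g b a = - cint g a b.
Proof.
move=> cg; apply/eqP; rewrite -subr_eq0 opprK; apply/eqP.
by rewrite cint_split // cint_refl.
Qed.

Lemma cint_lin g h (c : C) a b : (forall t, rcont g t) -> (forall t, rcont h t) ->
  cint (fun t => c * g t + h t) a b = c * cint g a b + cint h a b.
Proof.
move=> cg ch; set lo := Num.min a b - 1.
have loa : lo < a by rewrite ltrBlDr ltr_pwDr // ge_min lexx.
have lob : lo < b by rewrite ltrBlDr ltr_pwDr // !ge_min lexx orbT.
have [G HG ->] := cint_primE cg loa lob; have [H HH ->] := cint_primE ch loa lob.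
rewrite (_ : _ + _ = (c * G b + H b) - (c * G a + H a)); last by ring.
apply: (@cintE _ (fun t => c * G t + H t)) => [t|t /andP[h1 _]].
  apply: ccontD; last exact: ch.
  by apply: ccontM; [exact: ccont_cst|exact: cg].
have lt : lo < t by apply: lt_le_trans h1; rewrite ltrBlDr ltrDl.
by apply: cderD; [apply: cderZ; exact: HG|exact: HH].
Qed.

Lemma cint_cst (c : C) a b : cint (fun=> c) a b = c * (b - a)%:C.
Proof.
rewrite rmorphB mulrBr.
apply: (@cintE _ (fun t => c * t%:C)) => t; first exact: ccont_cst.
by move=> _; have := cderZ c (cder_id (fun t : R => t%:C) t); rewrite mulr1.
Qed.

Lemma cint_le g a b M : (forall t, rcont g t) ->
  (forall t, Num.min a b <= t <= Num.max a b -> md (g t) <= M) ->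
  md (cint g a b) <= M * `|b - a|.
Proof.
move=> cg; wlog ab : a b / a <= b => [W H|].
  case: (leP a b) => [ab|/ltW ab]; first exact: W.
  by rewrite cint_opp // mdN distrC; apply: W => // t; rewrite minC maxC; exact: H.
rewrite (min_idPl ab) (max_idPr ab) => H.
have loa : a - 1 < a by rewrite ltrBlDr ltrDl.
have lob : a - 1 < b by exact: lt_le_trans ab.
have [G HG ->] := cint_primE cg loa lob.
rewrite ger0_norm ?subr_ge0 //; apply: (@mean_value_ineq _ g) => // t /andP[h _].
by apply: HG; exact: lt_le_trans h.
Qed.

End LineIntegral.

(** Otherwise successive quartering would give bad boxes that shrink to a point. *)
Lemma box_quadrisection {R : realType} (P : R -> R -> nat -> Prop) (x0 y0 A B : R) :
  0 <= A -> 0 <= B ->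
  (forall x y n, (forall b c : bool, P (x + (A / 2 ^+ n.+1) *+ b) (y + (B / 2 ^+ n.+1) *+ c) n.+1) ->
     P x y n) ->
  (forall xs ys, x0 <= xs <= x0 + A -> y0 <= ys <= y0 + B ->
     exists N, forall n x y, (N <= n)%N -> x <= xs <= x + A / 2 ^+ n ->
       y <= ys <= y + B / 2 ^+ n -> P x y n) ->
  P x0 y0 0%N.
Proof.
move=> A0 B0 Hs Hl; apply: contrapT => nP.
pose bad (p : R * R) n := ~ P p.1 p.2 n.
have step p n : bad p n -> exists bc : bool * bool,
    bad (p.1 + (A / 2 ^+ n.+1) *+ bc.1, p.2 + (B / 2 ^+ n.+1) *+ bc.2) n.+1.
  move=> bp; apply: contrapT => nE; apply: bp; apply: Hs => b c.
  by apply: contrapT => nb; apply: nE; exists (b, c).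
pose nxt (p : R * R) n : R * R :=
  let bc := xget (false, false) [set bc : bool * bool |
    bad (p.1 + (A / 2 ^+ n.+1) *+ bc.1, p.2 + (B / 2 ^+ n.+1) *+ bc.2) n.+1] in
  (p.1 + (A / 2 ^+ n.+1) *+ bc.1, p.2 + (B / 2 ^+ n.+1) *+ bc.2).
have nxtP p n : bad p n -> bad (nxt p n) n.+1.
  by move=> /step[bc Hbc]; rewrite /nxt; case: xgetP => [? ? //|/(_ bc)].
pose fix u n : R * R := if n is m.+1 then nxt (u m) m else (x0, y0).
have bu n : bad (u n) n by elim: n => [//|n IH] /=; exact: nxtP.
have mono (a : R) (A' : R) n (b : bool) : 0 <= A' ->
    a <= a + (A' / 2 ^+ n.+1) *+ b /\
    a + (A' / 2 ^+ n.+1) *+ b + A' / 2 ^+ n.+1 <= a + A' / 2 ^+ n.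
  move=> A'0; have h : 0 <= A' / 2 ^+ n.+1 by rewrite divr_ge0 // exprn_ge0.
  have -> : A' / 2 ^+ n = A' / 2 ^+ n.+1 + A' / 2 ^+ n.+1.
    by rewrite exprS; field; rewrite expf_neq0.
  by case: b; rewrite ?mulr1n ?mulr0n; split; lra.
have m1 n : (u n).1 <= (u n.+1).1 /\ (u n.+1).1 + A / 2 ^+ n.+1 <= (u n).1 + A / 2 ^+ n.
  exact: mono.
have m2 n : (u n).2 <= (u n.+1).2 /\ (u n.+1).2 + B / 2 ^+ n.+1 <= (u n).2 + B / 2 ^+ n.
  exact: mono.
have lim (v : nat -> R) (A' : R) : 0 <= A' ->
    (forall n, v n <= v n.+1 /\ v n.+1 + A' / 2 ^+ n.+1 <= v n + A' / 2 ^+ n) ->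
    exists s, forall n, v n <= s <= v n + A' / 2 ^+ n.
  move=> A'0 mv.
  have inc n k : v n <= v (n + k)%N.
    by elim: k => [|k IH]; rewrite ?addn0 // addnS (le_trans IH) // (mv _).1.
  have dec n k : v (n + k)%N + A' / 2 ^+ (n + k) <= v n + A' / 2 ^+ n.
    by elim: k => [|k IH]; rewrite ?addn0 // addnS (le_trans _ IH) // (mv _).2.
  have pos n : 0 <= A' / 2 ^+ n by rewrite divr_ge0 // exprn_ge0.
  have ub n m : v m <= v n + A' / 2 ^+ n.
    case: (leqP n m) => [/subnKC <-|/ltnW/subnKC <-].
      by apply: le_trans (dec n (m - n)%N); rewrite lerDl.
    by apply: le_trans (inc m (n - m)%N) _; rewrite lerDl.
  exists (sup (range v)) => n; apply/andP; split.
    apply: ub_le_sup; last by exists n.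
    by exists (v 0%N + A' / 2 ^+ 0) => _ [m _ <-]; exact: ub.
  apply: ge_sup; first by exists (v 0%N); exists 0%N.
  by move=> _ [m _ <-]; exact: ub.
have [xs Hx] := lim (fun n => (u n).1) A A0 m1.
have [ys Hy] := lim (fun n => (u n).2) B B0 m2.
have [||N HN] := Hl xs ys.
- by have := Hx 0%N; rewrite /= expr0 divr1.
- by have := Hy 0%N; rewrite /= expr0 divr1.
by apply: (bu N); apply: HN.
Qed.

Lemma exp2_small {R : realType} (A r : R) : 0 < r ->
  exists N, forall n, (N <= n)%N -> A / 2 ^+ n < r.
Proof.
move=> r0; exists (Num.bound (A / r)) => n Nn.
have h2n : 0 < (2 : R) ^+ n by rewrite exprn_gt0.
by rewrite ltr_pdivrMr // mulrC -ltr_pdivrMr // upper_nthrootP.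
Qed.

Section Goursat.
Context {R : realType}.
Local Notation C := R[i].
Implicit Types (f F : C -> C) (x y : R) (z w : C).

Definition hline f y x : C := f (Complex x y).
Definition vline f x y : C := f (Complex x y).

Lemma rcont_hline f y x : cc f (Complex x y) -> rcont (hline f y) x.
Proof.
move=> cf; apply: (cc_comp (g := f) (u := fun s : R => Complex s y)) => //.
move=> e e0; exists e => // s; rewrite (_ : Complex s y - Complex x y = s%:C - x%:C) //.
by apply/eqP; rewrite eq_complex /= subrr oppr0 addr0 !eqxx.
Qed.

Lemma rcont_vline f x y : cc f (Complex x y) -> rcont (vline f x) y.
Proof.
move=> cf; apply: (cc_comp (g := f) (u := fun s : R => Complex x s)) => //.
move=> e e0; exists e => // s; rewrite -rmorphB md_real => h.
apply: le_lt_trans (md_le _) _; rewrite ReB ImB /= subrr normr0 add0r.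
exact: h.
Qed.

Lemma rder_hline F y x d : cd F (Complex x y) d -> rder (hline F y) x d.
Proof.
move=> dF; have := @cd_comp _ _ (fun t : R => t%:C) (fun s : R => Complex s y) F x 1 d.
rewrite mulr1; apply=> //.
exists (fun=> 1); split => //; first exact: ccont_cst.
move=> s; rewrite mul1r; apply/eqP; rewrite eq_complex /=.
by rewrite subrr oppr0 addr0 !eqxx.
Qed.

Lemma rder_vline F x y d : cd F (Complex x y) d -> rder (vline F x) y (d * 'i).
Proof.
move=> dF; apply: (@cd_comp _ _ (fun t : R => t%:C) (fun s : R => Complex x s) F) => //.
exists (fun=> 'i); split => //; first exact: ccont_cst.
move=> s; apply/eqP; rewrite eq_complex ReB ImB ReM ImM ReB ImB /=.
by apply/andP; split; apply/eqP; ring.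
Qed.

(** The integral of [f] along the boundary of the rectangle with opposite
    corners [(x1, y1)] and [(x2, y2)]. *)
Definition rect f x1 x2 y1 y2 : C :=
  cint (hline f y1) x1 x2 - cint (hline f y2) x1 x2
  + 'i * (cint (vline f x2) y1 y2 - cint (vline f x1) y1 y2).

Section ContinuousIntegrand.
Variable f : C -> C.
Hypothesis cf : forall z, cc f z.

Let ch y t : rcont (hline f y) t. Proof. by apply: rcont_hline; exact: cf. Qed.
Let cv x t : rcont (vline f x) t. Proof. by apply: rcont_vline; exact: cf. Qed.

Lemma rect_splitx x1 x2 x3 y1 y2 :
  rect f x1 x3 y1 y2 = rect f x1 x2 y1 y2 + rect f x2 x3 y1 y2.
Proof.
rewrite /rect -(cint_split x1 x2 x3 (ch y1)) -(cint_split x1 x2 x3 (ch y2)).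
by ring.
Qed.

Lemma rect_splity x1 x2 y1 y2 y3 :
  rect f x1 x2 y1 y3 = rect f x1 x2 y1 y2 + rect f x1 x2 y2 y3.
Proof.
rewrite /rect -(cint_split y1 y2 y3 (cv x1)) -(cint_split y1 y2 y3 (cv x2)).
by ring.
Qed.

Lemma rect_opp_x x1 x2 y1 y2 : rect f x2 x1 y1 y2 = - rect f x1 x2 y1 y2.
Proof.
rewrite /rect (cint_opp x1 x2 (ch y1)) (cint_opp x1 x2 (ch y2)); ring.
Qed.

Lemma rect_opp_y x1 x2 y1 y2 : rect f x1 x2 y2 y1 = - rect f x1 x2 y1 y2.
Proof.
rewrite /rect (cint_opp y1 y2 (cv x1)) (cint_opp y1 y2 (cv x2)); ring.
Qed.

Lemma md_i : md ('i : C) = 1.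
Proof. by rewrite /md /= expr0n /= add0r expr1n sqrtr1. Qed.

Lemma rect_le x1 x2 y1 y2 M : (forall x y,
    Num.min x1 x2 <= x <= Num.max x1 x2 -> Num.min y1 y2 <= y <= Num.max y1 y2 ->
    md (f (Complex x y)) <= M) ->
  md (rect f x1 x2 y1 y2) <= 2 * M * (`|x2 - x1| + `|y2 - y1|).
Proof.
move=> H.
have bx b : b = y1 \/ b = y2 -> Num.min y1 y2 <= b <= Num.max y1 y2.
  by case=> ->; rewrite ge_min le_max lexx ?orbT.
have by_ b : b = x1 \/ b = x2 -> Num.min x1 x2 <= b <= Num.max x1 x2.
  by case=> ->; rewrite ge_min le_max lexx ?orbT.
have h b : b = y1 \/ b = y2 -> md (cint (hline f b) x1 x2) <= M * `|x2 - x1|.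
  by move=> /bx hb; apply: cint_le => [t|t tx]; [exact: ch|exact: H].
have v b : b = x1 \/ b = x2 -> md (cint (vline f b) y1 y2) <= M * `|y2 - y1|.
  by move=> /by_ hb; apply: cint_le => [t|t tx]; [exact: cv|exact: H].
rewrite /rect; apply: le_trans (mdD _ _) _; rewrite mdM md_i mul1r.
have := mdB (cint (hline f y1) x1 x2) (cint (hline f y2) x1 x2).
have := mdB (cint (vline f x2) y1 y2) (cint (vline f x1) y1 y2).
have := h y1 (or_introl erefl); have := h y2 (or_intror erefl).
have := v x1 (or_introl erefl); have := v x2 (or_intror erefl).
by lra.
Qed.

End ContinuousIntegrand.

Lemma rect_prim f F x1 x2 y1 y2 : (forall z, cc f z) ->
  (forall z, cd F z (f z)) -> rect f x1 x2 y1 y2 = 0.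
Proof.
move=> cf dF.
have h y : cint (hline f y) x1 x2 = F (Complex x2 y) - F (Complex x1 y).
  apply: (@cintE _ _ (hline F y)) => t; first exact: rcont_hline.
  by move=> _; exact: rder_hline.
have v x : 'i * cint (vline f x) y1 y2 = F (Complex x y2) - F (Complex x y1).
  rewrite (@cintE _ (vline f x) (fun t => - 'i * F (Complex x t))).
  - have i2 : 'i * 'i = -1 :> C by rewrite -expr2 sqr_i.
    by rewrite -mulrBr mulrA mulrN i2 opprK mul1r.
  - by move=> t; exact: rcont_vline.
  - move=> t _; have := cderZ (- 'i) (rder_vline (dF (Complex x t))).
    rewrite mulrCA mulNr -expr2 sqr_i opprK mulr1; exact.
by rewrite /rect mulrBr !v !h; ring.
Qed.

Lemma rect_affine a b x1 x2 y1 y2 : rect (fun w => a + b * w) x1 x2 y1 y2 = 0.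
Proof.
have ca z : cc (fun w => a + b * w) z.
  apply: ccontD; first exact: ccont_cst.
  by apply: ccontM; [exact: ccont_cst|exact: ccont_id].
apply: (@rect_prim _ (fun w => a * w + (b / 2) * (w * w))) => // z.
have -> : a + b * z = a * 1 + (b / 2) * (1 * z + z * 1) by field.
apply: cderD; apply: cderZ; first exact: cder_id.
by apply: cderM; exact: cder_id.
Qed.

Lemma rect_lin f g c x1 x2 y1 y2 : (forall z, cc f z) -> (forall z, cc g z) ->
  rect (fun w => c * f w + g w) x1 x2 y1 y2 =
  c * rect f x1 x2 y1 y2 + rect g x1 x2 y1 y2.
Proof.
move=> cf cg.
have h y : cint (hline (fun w => c * f w + g w) y) x1 x2 =
    c * cint (hline f y) x1 x2 + cint (hline g y) x1 x2.
  by apply: cint_lin => t; exact: rcont_hline.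
have v x : cint (vline (fun w => c * f w + g w) x) y1 y2 =
    c * cint (vline f x) y1 y2 + cint (vline g x) y1 y2.
  by apply: cint_lin => t; exact: rcont_vline.
by rewrite /rect !h !v; ring.
Qed.

(** The affine part of [f] at a point integrates to [0], so the integral over a
    small rectangle at that point is small compared with its area. *)
Lemma rect_local f z d e r x1 x2 y1 y2 L : (forall w, cc f w) -> 0 <= e ->
  (forall w, md (w - z) < r -> md (f w - f z - d * (w - z)) <= e * md (w - z)) ->
  x1 <= Re z <= x2 -> y1 <= Im z <= y2 ->
  x2 - x1 <= L -> y2 - y1 <= L -> 2 * L < r ->
  md (rect f x1 x2 y1 y2) <= 8 * e * L ^+ 2.
Proof.
move=> cf e0 H /andP[x1z zx2] /andP[y1z zy2] xL yL Lr.
pose g w := 1 * f w + ((d * z - f z) + (- d) * w).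
have ca w : cc (fun w => (d * z - f z) + (- d) * w) w.
  apply: ccontD; first exact: ccont_cst.
  by apply: ccontM; [exact: ccont_cst|exact: ccont_id].
have cg w : cc g w.
  apply: ccontD; last exact: ca.
  by apply: ccontM; [exact: ccont_cst|exact: cf].
have -> : rect f x1 x2 y1 y2 = rect g x1 x2 y1 y2.
  by rewrite /g rect_lin // rect_affine mul1r addr0.
have L0 : 0 <= L by lra.
apply: (@le_trans _ _ (2 * (e * (2 * L)) * (`|x2 - x1| + `|y2 - y1|))); last first.
  rewrite !ger0_norm ?subr_ge0 //; try lra.
  have : 0 <= e * L by rewrite mulr_ge0.
  by move=> eL; rewrite expr2; nra.
apply: rect_le => // x y.
rewrite (min_idPl _) ?(max_idPr _); try lra.
rewrite (min_idPl _) ?(max_idPr _); try lra.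
move=> /andP[hx1 hx2] /andP[hy1 hy2].
have hw : md (Complex x y - z) <= 2 * L.
  apply: le_trans (md_le _) _; rewrite ReB ImB /=.
  have h1 : `|x - Re z| <= L by rewrite ler_norml; lra.
  have h2 : `|y - Im z| <= L by rewrite ler_norml; lra.
  lra.
have -> : g (Complex x y) = f (Complex x y) - f z - d * (Complex x y - z).
  by rewrite /g; ring.
apply: le_trans (H _ (le_lt_trans hw Lr)) _.
by rewrite ler_wpM2l.
Qed.

(** The bound of [rect_local] is additive in the area, so quadrisection carries it
    from small rectangles to the whole one, for every [e]. *)
Lemma goursat f x1 x2 y1 y2 : (forall w, cc f w) -> x1 <= x2 -> y1 <= y2 ->
  (forall x y, x1 <= x <= x2 -> y1 <= y <= y2 -> hol f (Complex x y)) ->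
  rect f x1 x2 y1 y2 = 0.
Proof.
move=> cf x12 y12 hf.
set L := (x2 - x1) + (y2 - y1).
have L0 : 0 <= L by rewrite /L; lra.
have key e : 0 < e -> md (rect f x1 x2 y1 y2) <= 8 * e * L ^+ 2.
  move=> e0.
  pose P x y n := md (rect f x (x + (x2 - x1) / 2 ^+ n) y (y + (y2 - y1) / 2 ^+ n))
    <= 8 * e * (L / 2 ^+ n) ^+ 2.
  suff : P x1 y1 0%N.
    by rewrite /P expr0 !divr1 !(addrC x1) !(addrC y1) !subrK.
  apply: (@box_quadrisection _ P x1 y1 (x2 - x1) (y2 - y1)); rewrite ?subr_ge0 //.
  - move=> x y n; set a := (x2 - x1) / 2 ^+ n.+1; set b := (y2 - y1) / 2 ^+ n.+1.
    have Ea : (x2 - x1) / 2 ^+ n = a + a by rewrite /a exprS; field; rewrite expf_neq0.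
    have Eb : (y2 - y1) / 2 ^+ n = b + b by rewrite /b exprS; field; rewrite expf_neq0.
    have El : L / 2 ^+ n = 2 * (L / 2 ^+ n.+1) by rewrite exprS; field; rewrite expf_neq0.
    rewrite /P -/a -/b => H.
    have := H false false; have := H true false; have := H false true; have := H true true.
    rewrite !mulr1n !mulr0n !addr0 Ea Eb El !addrA.
    rewrite (rect_splitx cf x (x + a) (x + a + a)).
    rewrite (rect_splity cf x (x + a) y (y + b) (y + b + b)).
    rewrite (rect_splity cf (x + a) (x + a + a) y (y + b) (y + b + b)).
    set r1 := rect _ _ _ _ _; set r2 := rect _ _ _ _ _.
    set r3 := rect _ _ _ _ _; set r4 := rect _ _ _ _ _.
    have := mdD (r4 + r2) (r3 + r1); have := mdD r4 r2; have := mdD r3 r1.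
    rewrite (exprMn _ 2 (L / _)); set l2 := (L / _) ^+ 2.
    rewrite (_ : (2 : R) ^+ 2 = 4); last by rewrite expr2; ring.
    lra.
  - move=> xs ys; rewrite !(addrC x1) !(addrC y1) !subrK => hx hy.
    have [d /cderP/(_ e e0)[r r0 Hr]] := hf xs ys hx hy.
    have [N HN] := exp2_small (2 * L) r0.
    exists N => n x y Nn hxs hys.
    apply: (@rect_local _ (Complex xs ys) d e r) => //.
    + exact: ltW.
    + rewrite addrAC subrr add0r ler_wpM2r ?invr_ge0 ?exprn_ge0 //.
      by rewrite /L lerDl subr_ge0.
    + rewrite addrAC subrr add0r ler_wpM2r ?invr_ge0 ?exprn_ge0 //.
      by rewrite /L lerDr subr_ge0.
    + by rewrite mulrA; exact: HN.
apply/eqP; rewrite -md_eq0 eq_le md_ge0 andbT; apply/ler_addgt0Pr => e e0.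
rewrite add0r.
have c0 : 0 < 8 * (L ^+ 2 + 1) by rewrite mulr_gt0 // ltr_wpDl // sqr_ge0.
apply: le_trans (key _ (divr_gt0 e0 c0)) _.
have L1 : L ^+ 2 + 1 != 0 by rewrite gt_eqF // ltr_wpDl // sqr_ge0.
rewrite (_ : _ * _ * _ = e * (L ^+ 2 / (L ^+ 2 + 1))); last by field.
rewrite ger_pMr // ler_pdivrMr ?mul1r ?lerDl //.
by rewrite ltr_wpDl // sqr_ge0.
Qed.

End Goursat.

Section Primitive.
Context {R : realType}.
Local Notation C := R[i].
Implicit Types (f F : C -> C) (x y r : R) (z w p c : C).

Definition sq c r z := `|Re z - Re c| < r /\ `|Im z - Im c| < r.

Lemma goursat_oriented f x1 x2 y1 y2 : (forall w, cc f w) ->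
  (forall x y, Num.min x1 x2 <= x <= Num.max x1 x2 ->
     Num.min y1 y2 <= y <= Num.max y1 y2 -> hol f (Complex x y)) ->
  rect f x1 x2 y1 y2 = 0.
Proof.
move=> cf; wlog x12 : x1 x2 / x1 <= x2 => [W|].
  case/orP: (le_total x1 x2) => [h|h H]; first exact: W.
  by rewrite rect_opp_x // W ?oppr0 // minC maxC.
wlog y12 : y1 y2 / y1 <= y2 => [W|].
  case/orP: (le_total y1 y2) => [h|h H]; first exact: W.
  rewrite rect_opp_y // W ?oppr0 // => x y hx hy; apply: H => //.
  by rewrite minC maxC.
rewrite (min_idPl x12) (max_idPr x12) (min_idPl y12) (max_idPr y12).
exact: goursat.
Qed.

Lemma between_dist_lt (m r u v s : R) : `|u - m| < r -> `|v - m| < r ->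
  Num.min u v <= s <= Num.max u v -> `|s - m| < r.
Proof.
rewrite !ltr_norml => /andP[u1 u2] /andP[v1 v2] /andP[s1 s2]; apply/andP; split.
  by move: s1; rewrite ge_min => /orP[h|h]; lra.
by move: s2; rewrite le_max => /orP[h|h]; lra.
Qed.

Lemma between_dist_le (u v s : R) : Num.min u v <= s <= Num.max u v ->
  `|s - u| <= `|v - u|.
Proof.
case/orP: (le_total u v) => uv; rewrite ?(min_idPl uv) ?(max_idPr uv)
  ?(min_idPr uv) ?(max_idPl uv) => /andP[h1 h2].
  by rewrite !ger0_norm ?subr_ge0 // lerD2r.
by rewrite !ler0_norm ?subr_le0 // lerN2 lerD2r.
Qed.

Lemma sq_between c r x1 y1 x2 y2 x y :
  sq c r (Complex x1 y1) -> sq c r (Complex x2 y2) ->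
  Num.min x1 x2 <= x <= Num.max x1 x2 ->
  Num.min y1 y2 <= y <= Num.max y1 y2 -> sq c r (Complex x y).
Proof.
by move=> [/= a1 a2] [/= b1 b2] hx hy; split; [exact: between_dist_lt hx|exact: between_dist_lt hy].
Qed.

(** Differentiability may fail at one corner: the rectangle is cut so that the
    corner sits in a small piece of small perimeter. *)
Lemma goursat_corner f c r p z : (forall w, cc f w) -> sq c r p -> sq c r z ->
  (forall w, sq c r w -> w != p -> hol f w) ->
  rect f (Re p) (Re z) (Im p) (Im z) = 0.
Proof.
case: p => a b; case: z => x y cf pq zq hf /=.
have [->|xa] := eqVneq x a; first by rewrite /rect !cint_refl; ring.
have [->|yb] := eqVneq y b; first by rewrite /rect !cint_refl; ring.
have [d d0 Hd] := cf (Complex a b) 1 ltr01.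
set M := md (f (Complex a b)) + 1.
set l := `|x - a| + `|y - b|.
have l0 : 0 < l by rewrite ltr_wpDr // normr_gt0 subr_eq0.
have M0 : 0 < M by rewrite ltr_wpDl // md_ge0.
have key t : 0 < t -> t <= 1 -> t * l < d -> md (rect f a x b y) <= 2 * M * (t * l).
  move=> t0 t1 td; set x' := a + t * (x - a); set y' := b + t * (y - b).
  have btw (u v : R) : Num.min u v <= u + t * (v - u) <= Num.max u v.
    rewrite ge_min le_max; case: (leP u v) => uv.
      have : 0 <= t * (v - u) by rewrite mulr_ge0 ?subr_ge0 // ltW.
      have : t * (v - u) <= 1 * (v - u) by rewrite ler_wpM2r ?subr_ge0.
      by move=> h1 h2; apply/andP; split; apply/orP; [left|right]; lra.
    have : 0 <= t * (u - v) by rewrite mulr_ge0 ?subr_ge0 // ltW.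
    have : t * (u - v) <= 1 * (u - v) by rewrite ler_wpM2r ?subr_ge0 // ltW.
    by move=> h1 h2; apply/andP; split; apply/orP; [right|left]; lra.
  have bx := btw a x; have by_ := btw b y.
  have xx : Num.min a x <= x <= Num.max a x by rewrite ge_min le_max !lexx !orbT.
  have bb : Num.min b y <= b <= Num.max b y by rewrite ge_min le_max !lexx.
  have aa : Num.min a x <= a <= Num.max a x by rewrite ge_min le_max !lexx.
  have yy : Num.min b y <= y <= Num.max b y by rewrite ge_min le_max !lexx !orbT.
  have h1 : rect f x' x b y = 0.
    apply: goursat_oriented => // s u hs hu; apply: hf.
      by apply: (sq_between (sq_between pq zq bx bb) zq).
    apply/eqP => -[sa _]; move: hs; rewrite sa ge_min le_max /x'.
    case: (ltgtP x a) xa => // hx _.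
      have : 0 < t * (a - x) by rewrite mulr_gt0 // subr_gt0.
      by move=> h /andP[_ /orP[h1|h1]]; lra.
    have : 0 < t * (x - a) by rewrite mulr_gt0 // subr_gt0.
    by move=> h /andP[/orP[h1|h1] _]; lra.
  have h2 : rect f a x' y' y = 0.
    apply: goursat_oriented => // s u hs hu; apply: hf.
      apply: (sq_between (sq_between pq zq aa by_) (sq_between pq zq bx yy)) => //.
    apply/eqP => -[_ ub]; move: hu; rewrite ub ge_min le_max /y'.
    case: (ltgtP y b) yb => // hx _.
      have : 0 < t * (b - y) by rewrite mulr_gt0 // subr_gt0.
      by move=> h /andP[_ /orP[h3|h3]]; lra.
    have : 0 < t * (y - b) by rewrite mulr_gt0 // subr_gt0.
    by move=> h /andP[/orP[h3|h3] _]; lra.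
  rewrite (rect_splitx cf a x' x) h1 addr0 (rect_splity cf a x' b y' y) h2 addr0.
  have nx : `|x' - a| = t * `|x - a|.
    by rewrite /x' addrAC subrr add0r normrM (gtr0_norm t0).
  have ny : `|y' - b| = t * `|y - b|.
    by rewrite /y' addrAC subrr add0r normrM (gtr0_norm t0).
  have El : t * l = `|x' - a| + `|y' - b| by rewrite /l mulrDr nx ny.
  rewrite El; apply: rect_le => // s u hs hu.
  have : md (f (Complex s u) - f (Complex a b)) < 1.
    apply: Hd; apply: le_lt_trans (md_le _) _; rewrite ReB ImB /=.
    apply: le_lt_trans td; rewrite El lerD //; exact: between_dist_le.
  move=> /ltW h; rewrite -(subrK (f (Complex a b)) (f (Complex s u))) addrC.
  by apply: le_trans (mdD _ _) _; rewrite lerD2l.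
apply/eqP; rewrite -md_eq0 eq_le md_ge0 andbT; apply/ler_addgt0Pr => e e0.
rewrite add0r; set t := Num.min 1 (Num.min (d / 2 / l) (e / (2 * M * l))).
have t0 : 0 < t.
  by rewrite !lt_min ltr01 !divr_gt0 // !mulr_gt0.
have t1 : t <= 1 by rewrite ge_min lexx.
have td : t <= d / 2 / l by rewrite !ge_min lexx !orbT.
have te : t <= e / (2 * M * l) by rewrite !ge_min lexx !orbT.
apply: le_trans (key t t0 t1 _) _.
  rewrite -ltr_pdivlMr //; apply: le_lt_trans td _.
  by rewrite ltr_pM2r ?invr_gt0 // ltr_pdivrMr // ltr_pMr // ltr1n.
rewrite (_ : 2 * M * (t * l) = t * (2 * M * l)); last by ring.
by rewrite -ler_pdivlMr // !mulr_gt0.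
Qed.

(** The primitive is the integral along the two L-shaped paths from [p], which
    agree by [goursat_corner]; each of them computes one partial derivative. *)
Lemma primitive_of_continuous f c r p : (forall w, cc f w) -> sq c r p ->
  (forall w, sq c r w -> w != p -> hol f w) ->
  exists F, forall z, sq c r z -> cd F z (f z).
Proof.
case: p => a b cf pq hf.
pose F (z : C) : C := cint (hline f b) a (Re z) + 'i * cint (vline f (Re z)) b (Im z).
pose G (z : C) : C := cint (hline f (Im z)) a (Re z) + 'i * cint (vline f a) b (Im z).
have FG z : sq c r z -> F z = G z.
  move=> zq; have := goursat_corner cf pq zq hf; rewrite /rect /= => E.
  by apply/eqP; rewrite -subr_eq0 -E /F /G; apply/eqP; ring.
have ch y t : rcont (hline f y) t by apply: rcont_hline; exact: cf.
have cv x t : rcont (vline f x) t by apply: rcont_vline; exact: cf.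
exists F => z zq; apply/cderP => e e0.
have e20 : 0 < e / 2 by rewrite divr_gt0.
have [d d0 Hd] := cf z _ e20.
have [d1 d10 Hd1] : exists2 d1 : R, 0 < d1 & forall w, md (w - z) < d1 -> sq c r w.
  case: (zq) => z1 z2; exists (Num.min (r - `|Re z - Re c|) (r - `|Im z - Im c|)).
    by rewrite lt_min !subr_gt0 z1.
  move=> w; rewrite lt_min => /andP[h1 h2].
  have := md_Re (w - z); have := md_Im (w - z); rewrite ReB ImB => i1 i2.
  split.
    rewrite -(subrK (Re z) (Re w)) -addrA (le_lt_trans (ler_normD _ _)) //.
    by rewrite -ltrBrDr (le_lt_trans i2).
  rewrite -(subrK (Im z) (Im w)) -addrA (le_lt_trans (ler_normD _ _)) //.
  by rewrite -ltrBrDr (le_lt_trans i1).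
exists (Num.min (d / 2) d1); first by rewrite lt_min d10 divr_gt0.
move=> w; rewrite lt_min => /andP[wd wd1].
have wq := Hd1 _ wd1.
case: z w => [x y] [x' y'] in zq Hd Hd1 wd wd1 wq *.
have hx : `|x' - x| <= md (Complex x' y' - Complex x y).
  by have := md_Re (Complex x' y' - Complex x y); rewrite ReB.
have hy : `|y' - y| <= md (Complex x' y' - Complex x y).
  by have := md_Im (Complex x' y' - Complex x y); rewrite ImB.
have mq : sq c r (Complex x' y) by case: wq zq => /= ? ? [/= ? ?].
set zz := f (Complex x y).
have near s u : `|s - x| <= `|x' - x| -> `|u - y| <= `|y' - y| ->
    md (f (Complex s u) - zz) <= e / 2.
  move=> hs hu; apply/ltW/Hd; apply: le_lt_trans (md_le _) _; rewrite ReB ImB /=.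
  by lra.
have E1 : F (Complex x' y') - F (Complex x' y) = 'i * cint (vline f x') y y'.
  by rewrite /F /= -(cint_split b y y' (cv x')); ring.
have E2 : F (Complex x' y) - F (Complex x y) = cint (hline f y) x x'.
  by rewrite (FG _ mq) (FG _ zq) /G /= -(cint_split a x x' (ch y)); ring.
have cst (u : R) (t : R) : rcont (fun=> - zz) t by exact: ccont_cst.
have I1 : md (cint (vline f x') y y' - zz * (y' - y)%:C) <= e / 2 * `|y' - y|.
  rewrite -mulNr -cint_cst -[cint (vline f x') y y']mul1r -cint_lin //; last exact: cst.
  apply: cint_le => [t|t ht].
    apply: ccontD; last exact: ccont_cst.
    by apply: ccontM; [exact: ccont_cst|exact: cv].
  by rewrite mul1r; apply: near => //; exact: between_dist_le.
have I2 : md (cint (hline f y) x x' - zz * (x' - x)%:C) <= e / 2 * `|x' - x|.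
  rewrite -mulNr -cint_cst -[cint (hline f y) x x']mul1r -cint_lin //; last exact: cst.
  apply: cint_le => [t|t ht].
    apply: ccontD; last exact: ccont_cst.
    by apply: ccontM; [exact: ccont_cst|exact: ch].
  by rewrite mul1r; apply: near; rewrite ?subrr ?normr0 //; exact: between_dist_le.
have -> : F (Complex x' y') - F (Complex x y) - zz * (Complex x' y' - Complex x y) =
    'i * (cint (vline f x') y y' - zz * (y' - y)%:C) +
    (cint (hline f y) x x' - zz * (x' - x)%:C).
  have -> : Complex x' y' - Complex x y = (x' - x)%:C + 'i * (y' - y)%:C.
    apply/eqP; rewrite eq_complex ReB ImB ReD ImD ReM ImM /=.
    by apply/andP; split; apply/eqP; ring.
  rewrite (_ : F (Complex x' y') - F (Complex x y) = 'i * cint (vline f x') y y'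
    + cint (hline f y) x x'); first by ring.
  by rewrite -E1 -E2; ring.
apply: le_trans (mdD _ _) _; rewrite mdM md_i mul1r.
apply: le_trans (lerD I1 I2) _; rewrite -mulrDr.
by rewrite mulrAC ler_pdivrMr // -mulrA ler_wpM2l ?(ltW e0) //; lra.
Qed.

(** Composing with the retraction onto a smaller closed square makes a function
    continuous everywhere without changing it on the smaller square. *)
Lemma primitive_on_square f c r r' p : 0 < r' -> r' < r -> sq c r' p ->
  (forall w, sq c r w -> w != p -> hol f w) -> cc f p ->
  exists F, forall z, sq c r' z -> cd F z (f z).
Proof.
move=> r'0 r'r pq hf cp.
pose k (m t : R) := Num.max (m - r') (Num.min (m + r') t).
have kin m t : `|k m t - m| <= r'.
  rewrite ler_norml /k; case: (leP (m + r') t) => h1.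
    by rewrite (max_idPr _); lra.
  by case: (leP (m - r') t) => h2; lra.
have kid m t : `|t - m| < r' -> k m t = t.
  rewrite ltr_norml => /andP[h1 h2]; rewrite /k (min_idPr _) ?(max_idPr _) //; lra.
have klip m t s : `|k m t - k m s| <= `|t - s|.
  have mx (a u v : R) : `|Num.max a u - Num.max a v| <= `|u - v|.
    have := ler_norm (u - v); have := ler_norm (v - u); rewrite distrC.
    by case: (leP a u) => h1; case: (leP a v) => h2 i1 i2; rewrite ler_norml; lra.
  have mn (a u v : R) : `|Num.min a u - Num.min a v| <= `|u - v|.
    have := ler_norm (u - v); have := ler_norm (v - u); rewrite distrC.
    by case: (leP a u) => h1; case: (leP a v) => h2 i1 i2; rewrite ler_norml; lra.
  exact: le_trans (mx _ _ _) (mn _ _ _).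
pose K (z : C) : C := Complex (k (Re c) (Re z)) (k (Im c) (Im z)).
have Kq z : sq c r (K z) by split; apply: le_lt_trans r'r; exact: kin.
have Kid z : sq c r' z -> K z = z.
  by case: z => x y [/= h1 h2]; rewrite /K /= !kid.
have Kc z : cc K z.
  move=> e e0; exists (e / 2) => [|w wz]; first by rewrite divr_gt0.
  apply: le_lt_trans (md_le _) _; rewrite ReB ImB /=.
  have := klip (Re c) (Re w) (Re z); have := klip (Im c) (Im w) (Im z).
  have := md_Re (w - z); have := md_Im (w - z); rewrite ReB ImB; lra.
pose g z := f (K z).
have fc z : sq c r z -> cc f z.
  by move=> zq; have [->//|zp] := eqVneq z p; apply/hol_cont/hf.
have gc z : cc g z by apply: cc_comp; [exact: Kc|exact/fc/Kq].
have near z : sq c r' z -> exists2 d, 0 < d & forall w, md (w - z) < d -> f w = g w.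
  case=> h1 h2; exists (Num.min (r' - `|Re z - Re c|) (r' - `|Im z - Im c|)).
    by rewrite lt_min !subr_gt0 h1.
  move=> w; rewrite lt_min => /andP[i1 i2].
  have := md_Re (w - z); have := md_Im (w - z); rewrite ReB ImB => j1 j2.
  rewrite /g Kid //; split.
    by rewrite (_ : Re w - Re c = (Re w - Re z) + (Re z - Re c)) ?(le_lt_trans (ler_normD _ _)) //; [lra|ring].
  by rewrite (_ : Im w - Im c = (Im w - Im z) + (Im z - Im c)) ?(le_lt_trans (ler_normD _ _)) //; [lra|ring].
have r'sub z : sq c r' z -> sq c r z by case=> h1 h2; split; exact: lt_trans r'r.
have [|F HF] := primitive_of_continuous gc pq.
  move=> w wq wp; have [d d0 Hd] := near w wq.
  by apply: (hol_near d0 Hd); apply: hf => //; exact: r'sub.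
exists F => z zq; have := HF z zq; by rewrite /g Kid.
Qed.

End Primitive.

(** * The complex exponential *)

Section Exponential.
Context {R : realType}.
Local Notation C := R[i].
Implicit Types (z w : C) (x y t : R).

Definition cexp z : C := Complex (expR (Re z) * cos (Im z)) (expR (Re z) * sin (Im z)).

Lemma cexpD z w : cexp (z + w) = cexp z * cexp w.
Proof.
apply/eqP; rewrite eq_complex ReM ImM /= ReD ImD expRD cosD sinD.
by apply/andP; split; apply/eqP; ring.
Qed.

Lemma cexp0 : cexp 0 = 1.
Proof. by rewrite /cexp /= expR0 cos0 sin0 mulr1 mulr0. Qed.

Lemma md_cexp z : md (cexp z) = expR (Re z).
Proof. by rewrite /md /= !exprMn -mulrDr cos2Dsin2 mulr1 sqrtr_sqr ger0_norm. Qed.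

Lemma cexp_neq0 z : cexp z != 0.
Proof. by rewrite -md_gt0 md_cexp expR_gt0. Qed.

Lemma derive_eps (u : R -> R) x d : is_derive x 1 u d -> forall e : R, 0 < e ->
  exists2 r : R, 0 < r & forall s, `|s - x| < r ->
    `|u s - u x - d * (s - x)| <= e * `|s - x|.
Proof.
move=> /is_derive1_caratheodory[p [Hp /real_continuousP cp <-]] e /cp[r r0 H].
exists r => // s /H /ltW h; rewrite Hp -mulrBl normrM.
by rewrite ler_wpM2r.
Qed.

(** The only point where the derivative has to be computed: elsewhere it follows from
    the functional equation. *)
Lemma cd_cexp0 : cd cexp 0 1.
Proof.
apply/cderP => e e0.
set a := Num.min 1 (e / 8).
have a0 : 0 < a by rewrite lt_min ltr01 divr_gt0.
have a1 : a <= 1 by rewrite ge_min lexx.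
have ae : a <= e / 8 by rewrite ge_min lexx orbT.
have [r1 r10 H1] := derive_eps (is_derive_expR (0 : R)) a0.
have [r2 r20 H2] := derive_eps (is_derive_sin (0 : R)) a0.
have [r3 r30 H3] := derive_eps (is_derive_cos (0 : R)) a0.
exists (Num.min (Num.min (a / 2) r1) (Num.min r2 r3)).
  by rewrite !lt_min r10 r20 r30 divr_gt0.
case=> x y; rewrite !subr0 !lt_min => /andP[/andP[h0 h1] /andP[h2 h3]].
set m := md _ in h0 h1 h2 h3 *.
have mx : `|x| <= m by exact: (md_Re (Complex x y)).
have my : `|y| <= m by exact: (md_Im (Complex x y)).
have := H1 x; rewrite subr0 expR0 mul1r => /(_ (le_lt_trans mx h1)) {}H1.
have := H2 y; rewrite subr0 sin0 cos0 mul1r subr0 => /(_ (le_lt_trans my h2)) {}H2.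
have := H3 y; rewrite subr0 cos0 sin0 oppr0 mul0r subr0 => /(_ (le_lt_trans my h3)) {}H3.
have m0 : 0 <= m by exact: md_ge0.
have am : 0 <= a * m by rewrite mulr_ge0 // ltW.
have i1 : `|expR x - 1 - x| <= a * m by apply: le_trans H1 _; rewrite ler_wpM2l // ltW.
have i2 : `|sin y - y| <= a * m by apply: le_trans H2 _; rewrite ler_wpM2l // ltW.
have i3 : `|cos y - 1| <= a * m by apply: le_trans H3 _; rewrite ler_wpM2l // ltW.
have ax : `|expR x - 1| <= a.
  have -> : expR x - 1 = (expR x - 1 - x) + x by ring.
  apply: le_trans (ler_normD _ _) _.
  have : a * m <= 1 * m by rewrite ler_wpM2r.
  lra.
have x1 : `|1 + x| <= 2.
  by apply: le_trans (ler_normD _ _) _; rewrite normr1; lra.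
rewrite cexp0 mul1r; apply: le_trans (md_le _) _; rewrite !ReB !ImB /= subr0.
have j1 : `|expR x * cos y - 1 - x| <= 3 * (a * m).
  have -> : expR x * cos y - 1 - x = (expR x - 1 - x) * cos y + (1 + x) * (cos y - 1) by ring.
  apply: le_trans (ler_normD _ _) _; rewrite !normrM.
  have : `|expR x - 1 - x| * `|cos y| <= a * m * 1 by rewrite ler_pM // cos_max.
  have : `|1 + x| * `|cos y - 1| <= 2 * (a * m) by rewrite ler_pM.
  lra.
have sy : `|sin y| <= 2 * m.
  have -> : sin y = (sin y - y) + y by ring.
  apply: le_trans (ler_normD _ _) _.
  have : a * m <= 1 * m by rewrite ler_wpM2r.
  lra.
have j2 : `|expR x * sin y - y| <= 3 * (a * m).
  have -> : expR x * sin y - y = (expR x - 1) * sin y + (sin y - y) by ring.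
  apply: le_trans (ler_normD _ _) _; rewrite normrM.
  have : `|expR x - 1| * `|sin y| <= a * (2 * m) by rewrite ler_pM.
  lra.
have : a * m <= e / 8 * m by rewrite ler_wpM2r.
have : 0 <= e * m by rewrite mulr_ge0 // ltW.
lra.
Qed.

Lemma cd_cexp z : cd cexp z (cexp z).
Proof.
have [p [cp p1 Hp]] := cd_cexp0.
exists (fun w => cexp z * p (w - z)); split.
- apply: ccontM; first exact: ccont_cst.
  apply: (cc_comp (g := p) (u := fun w => w - z)); last by rewrite subrr.
  by apply: ccontB; [exact: ccont_id|exact: ccont_cst].
- by rewrite subrr p1 mulr1.
- move=> w; rewrite -mulrA -[X in p _ * X]subr0 -Hp mulrBr -cexpD cexp0 mulr1.
  by rewrite (addrC z) subrK.
Qed.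

Lemma unit_circle_angle x y : x ^+ 2 + y ^+ 2 = 1 ->
  exists2 t : R, `|t| <= pi & cos t = x /\ sin t = y.
Proof.
move=> xy1.
have x1 : -1 <= x <= 1.
  rewrite -ler_norml -(@ler_pXn2r _ 2) ?nnegrE // expr1n real_normK ?num_real //.
  by rewrite -xy1 lerDl sqr_ge0.
have sE : sin (acos x) = `|y|.
  by rewrite sin_acos // -sqrtr_sqr; congr Num.sqrt; rewrite -xy1; ring.
have api : `|acos x| <= pi by rewrite ger0_norm ?acos_ge0 ?acos_lepi.
case: (lerP 0 y) => y0.
  by exists (acos x) => //; rewrite acosK ?in_itv // sE ger0_norm.
exists (- acos x); first by rewrite normrN.
by rewrite cosN sinN acosK ?in_itv // sE ltr0_norm // opprK.
Qed.

(** The bound on the imaginary part keeps logarithms of points on one circle within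
    distance [pi] of a given one. *)
Lemma cexp_surj w : w != 0 -> exists2 z, cexp z = w & `|Im z| <= pi.
Proof.
move=> w0; have m0 : 0 < md w by rewrite md_gt0.
have [|t tpi [ct st]] := @unit_circle_angle (Re w / md w) (Im w / md w).
  rewrite !exprMn -mulrDl -mdE exprVn divff //.
  by rewrite expf_neq0 // gt_eqF.
exists (Complex (ln (md w)) t) => //; rewrite /cexp /= lnK ?posrE // ct st.
by rewrite !(mulrC (md w)) !divfK ?gt_eqF //; case: (w).
Qed.

Lemma cexp_2pi : cexp ('i * (2 * pi)%:C) = 1.
Proof.
by rewrite /cexp ReM ImM /= !mul0r !mulr0 subrr expR0 !mul1r add0r mulr_natl cos2pi sin2pi.
Qed.

End Exponential.

(** * The topology of the plane *)

Section Topology.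
Context {R : realType}.
Local Notation C := R[i].
Implicit Types (z w c d : C) (r s t : R) (K : set (Cplx R)).

Lemma normE (z : C) : `|z| = (md z)%:C.
Proof. by rewrite normc_def. Qed.

Lemma nbhs_md z (A : set (Cplx R)) :
  nbhs (z : Cplx R) A <-> exists2 e : R, 0 < e & forall w, md (w - z) < e -> A w.
Proof.
split.
  move/nbhs_normP => [e /= e0 H]; case: e e0 H => a b; rewrite ltcE /=.
  move=> /andP[/eqP -> a0] H; exists a => // w wz; apply: H => /=.
  by rewrite /ball_ /= normE ltcR mdC.
move=> [e e0 H]; apply: (iffRL (nbhs_normP (z : Cplx R) A)); exists (e%:C) => /=.
  by rewrite ltcR.
by move=> w /=; rewrite /ball_ /= normE ltcR mdC; exact: H.
Qed.

Lemma continuous_md_real (u : Cplx R -> R) z :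
  (forall e : R, 0 < e -> exists2 d : R, 0 < d &
    forall w, md (w - z) < d -> `|u w - u z| < e) ->
  {for z, continuous u}.
Proof.
move=> H A /nbhs_ballP[e /= e0 He]; have [d d0 Hd] := H e e0.
by apply/nbhs_md; exists d => // w /Hd; rewrite distrC => h; exact: He.
Qed.

Lemma ler_md_dist z w : `|md z - md w| <= md (z - w).
Proof. by rewrite ler_norml md_dist andbT lerNl opprB mdC md_dist. Qed.

Lemma continuous_md_comp (f : Cplx R -> Cplx R) z : cc f z ->
  {for z, continuous (fun w : Cplx R => md (f w) : R)}.
Proof.
move=> cf; apply: continuous_md_real => e /cf[d d0 H]; exists d => // w /H.
exact: le_lt_trans (ler_md_dist _ _).
Qed.

Lemma continuous_local (u v : Cplx R -> R) z (d : R) : 0 < d ->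
  (forall w : Cplx R, md (w - z) < d -> u w = v w) ->
  {for (z : Cplx R), continuous u} -> {for (z : Cplx R), continuous v}.
Proof.
move=> d0 uv cu A; rewrite -uv ?subrr ?md0 // => /cu/nbhs_md[e e0 H].
apply/nbhs_md; exists (Num.min d e); first by rewrite lt_min d0.
by move=> w; rewrite lt_min => /andP[wd we]; rewrite /= -uv //; exact: H.
Qed.

Lemma hol_of_derivable (f : Cplx R -> Cplx R) (z : Cplx R) : derivable f z 1 -> hol f z.
Proof.
move/cvg_ex => [d Hd]; exists d; apply/cderP => e e0.
have /Hd : nbhs (d : Cplx R) [set w | md (w - d) < e] by apply/nbhs_md; exists e.
move=> /nbhs_md[r r0 H]; exists r => // w wz.
have [->|wz0] := eqVneq w z; first by rewrite !subrr mulr0 subrr md0 mulr0.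
have := H (w - z); rewrite subr0 => /(_ wz).
have h0 : w - z != 0 by rewrite subr_eq0.
move=> /(_ h0) /=; rewrite [_ *: (1 : Cplx R)]mulr1 subrK.
rewrite /GRing.scale /= => /ltW h.
rewrite (_ : _ - _ = (w - z) * ((w - z)^-1 * (f w - f z) - d)); last by field.
by rewrite mdM mulrC ler_wpM2r ?md_ge0.
Qed.

Lemma compact_rectangle a b x y :
  compact [set z : Cplx R | a <= Re z <= b /\ x <= Im z <= y].
Proof.
pose h (p : R * R) : Cplx R := Complex p.1 p.2.
have ch : continuous h.
  move=> p A /nbhs_md[e e0 H].
  apply/nbhs_ballP; exists (e / 2) => /=; first by rewrite divr_gt0.
  move=> q [q1 q2]; apply: H; apply: le_lt_trans (md_le _) _; rewrite ReB ImB /= (splitr e).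
  by rewrite distrC (distrC q.2); exact: ltrD.
have := compact_setX (@segment_compact R a b) (@segment_compact R x y).
move=> /(continuous_compact (continuous_subspaceT ch)); congr compact.
rewrite eqEsubset; split => [_ [[u v] [/= h1 h2] <-]|].
  by move: h1 h2; rewrite /= !in_itv.
by move=> [u v] /= [h1 h2]; exists (u, v) => //; split; rewrite /= in_itv.
Qed.

Lemma continuous_md_sub c : continuous (fun z : Cplx R => md (z - c) : R).
Proof.
move=> z; apply: (@continuous_md_comp (fun z => z - c)).
by apply: ccontB; [exact: ccont_id|exact: ccont_cst].
Qed.

Lemma compact_closed_ball c r : compact [set z : Cplx R | md (z - c) <= r].
Proof.
have cl : closed [set z : Cplx R | md (z - c) <= r].
  apply: (@preimage_closed _ _ (fun z : Cplx R => md (z - c) : R) [set t | t <= r]).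
    by move=> z _; exact: continuous_md_sub.
  exact: closed_le.
apply: (subclosed_compact cl (@compact_rectangle (Re c - r) (Re c + r) (Im c - r) (Im c + r))).
move=> z /= zr; have := md_Re (z - c); have := md_Im (z - c); rewrite ReB ImB.
by rewrite !ler_norml; lra.
Qed.

Lemma compact_closed_annulus c s r :
  compact [set z : Cplx R | s <= md (z - c) <= r].
Proof.
have cl : closed [set z : Cplx R | s <= md (z - c) <= r].
  apply: (@preimage_closed _ _ (fun z : Cplx R => md (z - c) : R) [set t | s <= t <= r]).
    by move=> z _; exact: continuous_md_sub.
  rewrite (_ : [set _ | _] = `[s, r]%classic); first exact: itv_closed.
  by rewrite eqEsubset; split => t; rewrite /= in_itv.
by apply: (subclosed_compact cl (@compact_closed_ball c r)) => z /= /andP[].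
Qed.

Lemma compact_circle c r : compact [set z : Cplx R | md (z - c) = r].
Proof.
have := @compact_closed_annulus c r r; congr compact; rewrite eqEsubset.
by split=> z /= => [/le_anti//|->]; rewrite lexx.
Qed.

Lemma compact_md_max (f : C -> C) K : K !=set0 -> compact K ->
  (forall z, K z -> cc f z) ->
  exists2 c, K c & forall z, K z -> md (f z) <= md (f c).
Proof.
move=> K0 cK cf; have [|c cKc H] := @compact_EVT_max _ _ (fun z : Cplx R => md (f z) : R) K K0 cK.
  by apply: continuous_in_subspaceT => z; rewrite inE => /cf; exact: continuous_md_comp.
exists c; first by rewrite inE in cKc.
by move=> z Kz; apply: H; rewrite inE.
Qed.

End Topology.

(** * Cauchy's integral formula *)

Section Cauchy.
Context {R : realType}.
Local Notation C := R[i].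
Implicit Types (f F phi : C -> C) (z w c d : C) (r t : R).

Definition cis t : C := cexp ('i * t%:C).

Lemma rder_cis t : rder cis t ('i * cis t).
Proof.
have h : cder (fun t : R => t%:C) (fun t : R => 'i * t%:C) t ('i * 1).
  by apply: cderZ; exact: cder_id.
by have := cd_comp h (cd_cexp ('i * t%:C)); rewrite mulr1 mulrC.
Qed.

Lemma md_cis t : md (cis t) = 1.
Proof. by rewrite md_cexp ReM /= mul0r mulr0 subrr expR0. Qed.

Lemma cis_2pi : cis (2 * pi) = 1. Proof. exact: cexp_2pi. Qed.

Lemma cis0 : cis 0 = 1.
Proof. by rewrite /cis mulr0 cexp0. Qed.

Lemma pi2_ge0 : 0 <= 2 * pi :> R.
Proof. by rewrite mulr_ge0 // pi_ge0. Qed.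

Definition circle c r t : C := c + r%:C * cis t.

Lemma rder_circle c r t : rder (circle c r) t ('i * (r%:C * cis t)).
Proof.
rewrite (_ : 'i * _ = 0 + r%:C * ('i * cis t)); last by ring.
by apply: cderD; [exact: cder_cst|apply: cderZ; exact: rder_cis].
Qed.

Lemma circleB c r t : circle c r t - c = r%:C * cis t.
Proof. by rewrite /circle addrAC subrr add0r. Qed.

Lemma md_circle c r t : 0 <= r -> md (circle c r t - c) = r.
Proof. by move=> r0; rewrite circleB mdM md_cis mulr1 md_real ger0_norm. Qed.

Definition on_circle c r w := md (w - c) = r.

Definition circ c r phi : C :=
  cint (fun t => phi (circle c r t) * ('i * (r%:C * cis t))) 0 (2 * pi).

Lemma rcont_circ c r phi t : 0 <= r -> (forall w, on_circle c r w -> cc phi w) ->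
  rcont (fun t => phi (circle c r t) * ('i * (r%:C * cis t))) t.
Proof.
move=> r0 cphi; apply: ccontM.
  apply: cc_comp; first exact: cder_cont (rder_circle c r t).
  by apply: cphi; exact: md_circle.
apply: ccontM; first exact: ccont_cst.
apply: ccontM; first exact: ccont_cst.
exact: cder_cont (rder_cis t).
Qed.

Lemma circ_prim c r phi F : 0 <= r -> (forall w, on_circle c r w -> cc phi w) ->
  (forall w, on_circle c r w -> cd F w (phi w)) -> circ c r phi = 0.
Proof.
move=> r0 cphi dF; rewrite /circ (@cintE _ _ (fun t => F (circle c r t))).
- by rewrite /circle cis_2pi cis0 subrr.
- by move=> t; exact: rcont_circ.
- move=> t _; apply: cd_comp; first exact: rder_circle.
  by apply: dF; exact: md_circle.
Qed.

Lemma circ_ext c r phi psi : 0 <= r -> (forall w, on_circle c r w -> phi w = psi w) ->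
  circ c r phi = circ c r psi.
Proof.
move=> r0 H; rewrite /circ; congr cint; apply/funext => t.
by rewrite H //; exact: md_circle.
Qed.

Lemma circ_lin c r phi psi (a : C) : 0 <= r ->
  (forall w, on_circle c r w -> cc phi w) ->
  (forall w, on_circle c r w -> cc psi w) ->
  circ c r (fun w => a * phi w + psi w) = a * circ c r phi + circ c r psi.
Proof.
move=> r0 cphi cpsi; rewrite /circ -cint_lin; try by move=> t; exact: rcont_circ.
by congr cint; apply/funext => t; ring.
Qed.

Lemma circ_le c r phi M : 0 <= r -> (forall w, on_circle c r w -> cc phi w) ->
  (forall w, on_circle c r w -> md (phi w) <= M) ->
  md (circ c r phi) <= M * r * (2 * pi).
Proof.
move=> r0 cphi H; rewrite /circ.
rewrite -[X in _ <= _ * X](ger0_norm pi2_ge0) -[X in `|X|]subr0.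
apply: cint_le => [t|t _]; first exact: rcont_circ.
rewrite !mdM md_i mul1r md_cis mulr1 md_real ger0_norm // ler_wpM2r //.
by apply: H; exact: md_circle.
Qed.

Lemma circ_bounded c r phi : 0 <= r -> (forall w, on_circle c r w -> cc phi w) ->
  exists M, forall w, on_circle c r w -> md (phi w) <= M.
Proof.
move=> r0 cphi; have [|z _ H] := @compact_md_max _ phi _ _ (@compact_circle _ c r) cphi.
  by exists (circle c r 0); exact: md_circle.
by exists (md (phi z)).
Qed.

(** Differentiation under the integral sign, for a kernel whose second order
    remainder is uniform on the circle. *)
Lemma circ_cd c r phi (k : C -> C -> C) (k1 : C -> C) z M (e : R) : 0 <= r -> 0 < e ->
  (forall w, on_circle c r w -> cc phi w) ->
  (forall z', md (z' - z) < e -> forall w, on_circle c r w -> cc (k z') w) ->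
  (forall w, on_circle c r w -> cc k1 w) ->
  (forall z', md (z' - z) < e -> forall w, on_circle c r w ->
     md (k z' w - k z w - (z' - z) * k1 w) <= M * md (z' - z) ^+ 2) ->
  cd (fun z => circ c r (fun w => phi w * k z w)) z (circ c r (fun w => phi w * k1 w)).
Proof.
move=> r0 e0 cphi ck ck1 H; have [B HB] := circ_bounded r0 cphi.
set B' := `|B| + 1; set M' := `|M| + 1.
have B'0 : 0 < B' by rewrite ltr_wpDl.
have M'0 : 0 < M' by rewrite ltr_wpDl.
set K := B' * M' * r * (2 * pi).
have K0 : 0 <= K by rewrite /K !mulr_ge0 ?pi_ge0 // ltW.
apply/cderP => a a0; exists (Num.min e (a / (K + 1))).
  by rewrite lt_min e0 divr_gt0 // ltr_wpDl.
move=> z'; rewrite lt_min => /andP[h1 h2].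
have ckz w : on_circle c r w -> cc (fun w => phi w * k z w) w.
  move=> wr; apply: ccontM; first exact: cphi.
  by apply: ck => //; rewrite subrr md0.
have ckz' w : on_circle c r w -> cc (fun w => phi w * k z' w) w.
  by move=> wr; apply: ccontM; [exact: cphi|exact: ck].
have ckk w : on_circle c r w -> cc (fun w => phi w * k1 w) w.
  by move=> wr; apply: ccontM; [exact: cphi|exact: ck1].
have E : circ c r (fun w => phi w * k z' w) - circ c r (fun w => phi w * k z w)
    - circ c r (fun w => phi w * k1 w) * (z' - z) =
    circ c r (fun w => (-1) * (phi w * k z w) +
      ((- (z' - z)) * (phi w * k1 w) + phi w * k z' w)).
  rewrite circ_lin //; last first.
    move=> w wr; apply: ccontD; last exact: ckz'.
    by apply: ccontM; [exact: ccont_cst|exact: ckk].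
  by rewrite circ_lin //; ring.
rewrite E; apply: (@le_trans _ _ (B' * (M' * md (z' - z) ^+ 2) * r * (2 * pi))).
  apply: circ_le => // [w wr|w wr].
    apply: ccontD; first by apply: ccontM; [exact: ccont_cst|exact: ckz].
    apply: ccontD; last exact: ckz'.
    by apply: ccontM; [exact: ccont_cst|exact: ckk].
  rewrite (_ : _ + _ = phi w * (k z' w - k z w - (z' - z) * k1 w)); last by ring.
  rewrite mdM ler_pM ?md_ge0 //.
    by apply: le_trans (HB w wr) _; rewrite (le_trans (ler_norm _)) // lerDl.
  apply: le_trans (H z' h1 w wr) _; rewrite ler_wpM2r ?exprn_ge0 ?md_ge0 //.
  by rewrite (le_trans (ler_norm _)) // lerDl.
rewrite (_ : _ * _ * _ * _ = K * md (z' - z) * md (z' - z)); last by rewrite /K; ring.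
rewrite ler_wpM2r ?md_ge0 //.
apply: (@le_trans _ _ ((K + 1) * md (z' - z))).
  by rewrite ler_wpM2r ?md_ge0 // lerDl.
by rewrite mulrC -ler_pdivlMr ?ltr_wpDl // ltW.
Qed.

Lemma circle_gap c r z z' w : md (z - c) < r -> md (z' - z) < (r - md (z - c)) / 2 ->
  on_circle c r w -> (r - md (z - c)) / 2 < md (w - z').
Proof.
rewrite /on_circle => zc zz' wr.
have := mdD (w - z') (z' - z + (z - c)).
rewrite (_ : _ + _ = w - c) ?wr; last by ring.
have := mdD (z' - z) (z - c); lra.
Qed.

Lemma cc_sub_inv z w : w != z -> cc (fun w => (w - z)^-1) w.
Proof.
move=> wz; apply: ccontV; first by rewrite subr_eq0.
by apply: ccontB; [exact: ccont_id|exact: ccont_cst].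
Qed.

Section Kernel.
Variables (c : C) (r : R) (phi : C -> C).
Hypothesis (cphi : forall w, on_circle c r w -> cc phi w).

Let gap z z' w : md (z - c) < r -> md (z' - z) < (r - md (z - c)) / 2 ->
  on_circle c r w -> w != z' /\ md ((w - z')^-1) <= 2 / (r - md (z - c)).
Proof.
move=> zc zz' wr; have g := circle_gap zc zz' wr.
have g0 : 0 < (r - md (z - c)) / 2 by rewrite divr_gt0 // subr_gt0.
have m0 : 0 < md (w - z') by exact: lt_trans g.
split; first by rewrite -subr_eq0 -md_gt0.
rewrite mdV -[2 / _]invrK invf_div lef_pV2 ?posrE //; exact: ltW.
Qed.

Lemma cd_cauchy1 z : md (z - c) < r ->
  cd (fun z => circ c r (fun w => phi w * (w - z)^-1)) z
     (circ c r (fun w => phi w * (w - z)^-1 ^+ 2)).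
Proof.
move=> zc; have r0 : 0 <= r by exact: le_trans (md_ge0 _) (ltW zc).
set e := (r - md (z - c)) / 2; have e0 : 0 < e by rewrite divr_gt0 // subr_gt0.
have zz : md (z - z) < e by rewrite subrr md0.
apply: (@circ_cd c r phi (fun z w => (w - z)^-1) _ z ((2 / (r - md (z - c))) ^+ 3) e) => //.
- by move=> z' zz' w wr; apply: cc_sub_inv; have [] := gap zc zz' wr.
- by move=> w wr; apply: ccontX; apply: cc_sub_inv; have [] := gap zc zz wr.
- move=> z' zz' w wr; have [wz' v] := gap zc zz' wr; have [wz u] := gap zc zz wr.
  rewrite (_ : _ - _ = (z' - z) ^+ 2 * ((w - z)^-1 * ((w - z)^-1 * (w - z')^-1))).
    rewrite mdM mdX mulrC ler_wpM2r ?exprn_ge0 ?md_ge0 // !mdM !exprS expr0 mulr1.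
    by rewrite !ler_pM ?mulr_ge0 ?md_ge0.
  by field; rewrite !subr_eq0 wz wz'.
Qed.

Lemma cd_cauchy2 z : md (z - c) < r ->
  cd (fun z => circ c r (fun w => phi w * (w - z)^-1 ^+ 2)) z
     (circ c r (fun w => phi w * (2 * (w - z)^-1 ^+ 3))).
Proof.
move=> zc; have r0 : 0 <= r by exact: le_trans (md_ge0 _) (ltW zc).
set e := (r - md (z - c)) / 2; have e0 : 0 < e by rewrite divr_gt0 // subr_gt0.
have zz : md (z - z) < e by rewrite subrr md0.
apply: (@circ_cd c r phi (fun z w => (w - z)^-1 ^+ 2) _ z
  (3 * (2 / (r - md (z - c))) ^+ 4) e) => //.
- by move=> z' zz' w wr; apply: ccontX; apply: cc_sub_inv; have [] := gap zc zz' wr.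
- move=> w wr; apply: ccontM; first exact: ccont_cst.
  by apply: ccontX; apply: cc_sub_inv; have [] := gap zc zz wr.
- move=> z' zz' w wr; have [wz' v] := gap zc zz' wr; have [wz u] := gap zc zz wr.
  set a := 2 / (r - md (z - c)) in u v *.
  rewrite (_ : _ - _ = (z' - z) ^+ 2 * ((w - z)^-1 * ((w - z)^-1 * ((w - z')^-1 *
    ((w - z)^-1 + (w - z)^-1 + (w - z')^-1))))).
    rewrite mdM mdX mulrC ler_wpM2r ?exprn_ge0 ?md_ge0 // !mdM.
    rewrite (_ : 3 * a ^+ 4 = a * (a * (a * (a + a + a)))); last by ring.
    rewrite !ler_pM ?mulr_ge0 ?md_ge0 //.
    apply: le_trans (mdD _ _) _; apply: lerD => //.
    by apply: le_trans (mdD _ _) _; apply: lerD.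
  by field; rewrite !subr_eq0 wz wz'.
Qed.

End Kernel.

(** The derivative of the left side with respect to [z] integrates an exact
    differential, so it suffices to take [z] at the centre. *)
Lemma circ_kernel c r z : md (z - c) < r -> circ c r (fun w => (w - z)^-1) = 'i * (2 * pi)%:C.
Proof.
move=> zc; have r0 : 0 < r by exact: le_lt_trans (md_ge0 _) zc.
pose J z := circ c r (fun w => 1 * (w - z)^-1).
have JE u : circ c r (fun w => (w - u)^-1) = J u.
  by apply: circ_ext => [|w _]; [exact: ltW|rewrite mul1r].
have dJ u : md (u - c) < r -> cd J u 0.
  move=> uc.
  have -> : 0 = circ c r (fun w => 1 * (w - u)^-1 ^+ 2).
    have ne w : on_circle c r w -> w != u.
      by rewrite /on_circle => wr; apply: contraTneq uc => <-; rewrite wr ltxx.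
    symmetry; apply: (@circ_prim c r _ (fun w => - (w - u)^-1)); first exact: ltW.
      move=> w /ne wu; apply: ccontM; first exact: ccont_cst.
      by apply: ccontX; exact: cc_sub_inv.
    move=> w /ne wu.
    rewrite (_ : 1 * _ = - (- (1 - 0) / (w - u) ^+ 2)); last first.
      by rewrite subr0 mul1r mulNr opprK mul1r exprVn.
    apply: cderN; apply: (cderV (f := fun w => w - u)); first by rewrite subr_eq0.
    by apply: cderB; [exact: cder_id|exact: cder_cst].
  by apply: cd_cauchy1 => // w _; exact: ccont_cst.
rewrite JE; have -> : J z = J c.
  pose G s := J (c + s%:C * (z - c)).
  have : G 1 = G 0.
    apply: rder_eq_cst => // s /andP[s0 s1].
    have h : cder (fun t : R => t%:C) (fun s : R => c + s%:C * (z - c)) s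
       (0 + (1 * (z - c) + s%:C * 0)).
      apply: cderD; first exact: cder_cst.
      by apply: cderM; [exact: cder_id|exact: cder_cst].
    have := cd_comp h (dJ _ _); rewrite mul0r; apply.
    rewrite addrAC subrr add0r mdM md_real ger0_norm //.
    by apply: le_lt_trans zc; rewrite ler_piMl // md_ge0.
  by rewrite /G mul1r mul0r addr0 addrC subrK.
transitivity (cint (fun=> 'i : C) 0 (2 * pi)); last by rewrite cint_cst subr0.
rewrite -JE /circ; congr cint; apply/funext => t.
rewrite circleB mulrCA mulVf ?mulr1 // mulf_neq0 ?cexp_neq0 //.
by rewrite -md_eq0 md_real normr_eq0 gt_eqF.
Qed.

Lemma sq_circle c r rho w : r < rho -> md (w - c) <= r -> sq c rho w.
Proof.
move=> rr wr; have := md_Re (w - c); have := md_Im (w - c); rewrite ReB ImB => h1 h2.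
by split; apply: le_lt_trans rr; [exact: le_trans wr|exact: le_trans wr].
Qed.

(** The divided difference of [f] at [z] is continuous at [z], so it has a primitive
    and its integral along the circle vanishes. *)
Lemma cauchy_formula f c r rho z : r < rho -> (forall w, sq c rho w -> hol f w) ->
  md (z - c) < r -> circ c r (fun w => f w * (w - z)^-1) = f z * ('i * (2 * pi)%:C).
Proof.
move=> rr hf zc; have r0 : 0 < r by exact: le_lt_trans (md_ge0 _) zc.
set rho' := (r + rho) / 2.
have h1 : r < rho' by rewrite /rho'; lra.
have h2 : rho' < rho by rewrite /rho'; lra.
have [_ [p [cp _ Hp]]] : hol f z by apply: hf; apply: sq_circle rr (ltW zc).
have pE w : w != z -> p w = (f w - f z) * (w - z)^-1.
  by move=> wz; rewrite Hp mulfK // subr_eq0.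
have hp w : sq c rho w -> w != z -> hol p w.
  move=> wq wz; have m0 : 0 < md (w - z) by rewrite md_gt0 subr_eq0.
  apply: (hol_near m0 (f := fun w => (f w - f z) / (w - z))).
    move=> v vw; rewrite pE //; apply: contraTneq vw => ->.
    by rewrite mdC ltxx.
  apply: hol_div; first by rewrite subr_eq0.
    by apply: holB; [exact: hf|exact: hol_cst].
  by apply: holB; [exact: hol_id|exact: hol_cst].
have [||||F HF] := @primitive_on_square _ p c rho rho' z _ h2.
- exact: lt_trans h1.
- by apply: sq_circle h1 (ltW zc).
- exact: hp.
- exact: cp.
have ne w : on_circle c r w -> w != z.
  by rewrite /on_circle => wr; apply: contraTneq zc => <-; rewrite wr ltxx.
have cir w : on_circle c r w -> sq c rho' w.
  by rewrite /on_circle => wr; apply: sq_circle h1 _; rewrite wr.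
have cpc w : on_circle c r w -> cc p w.
  move=> wr; apply: hol_cont; apply: hp; last exact: ne.
  by apply: sq_circle rr _; rewrite wr.
have p0 : circ c r p = 0.
  by apply: (@circ_prim c r p F) => // [|w /cir]; [exact: ltW|exact: HF].
rewrite (@circ_ext c r _ (fun w => f z * (w - z)^-1 + p w)); first last.
- by move=> w /ne wz; rewrite pE //; ring.
- exact: ltW.
rewrite circ_lin ?circ_kernel ?p0 ?addr0 //; first exact: ltW.
by move=> w /ne wz; exact: cc_sub_inv.
Qed.

Lemma cd_unique f z a b : cd f z a -> cd f z b -> a = b.
Proof.
move=> /cderP Ha /cderP Hb; apply/eqP; rewrite -subr_eq0 -md_eq0 eq_le md_ge0 andbT.
apply/ler_addgt0Pr => e e0; rewrite add0r.
have e20 : 0 < e / 2 by rewrite divr_gt0.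
have [r r0 Hr] := Ha _ e20; have [s s0 Hs] := Hb _ e20.
set m := Num.min r s / 2; have mm : 0 < Num.min r s by rewrite lt_min r0.
have m0 : 0 < m by rewrite divr_gt0.
have mE : md (z + m%:C - z) = m by rewrite addrAC subrr add0r md_real gtr0_norm.
have mrs : m < Num.min r s by rewrite /m ltr_pdivrMr // ltr_pMr // ltr1n.
move: mrs; rewrite lt_min => /andP[mr ms].
have := Hr (z + m%:C); rewrite mE => /(_ mr) h1.
have := Hs (z + m%:C); rewrite mE => /(_ ms) h2.
rewrite -(ler_pM2r m0) -{1}mE -mdM.
set fw := f _ - f z in h1 h2; set w := _ - z in h1 h2 *.
rewrite (_ : (a - b) * w = (fw - b * w) - (fw - a * w)); last by ring.
apply: le_trans (mdB _ _) _; lra.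
Qed.

Definition dv f z : C := xget 0 [set d | cd f z d].

Lemma dvP f z : hol f z -> cd f z (dv f z).
Proof. by move=> [d fd]; rewrite /dv; case: xgetP => // /(_ d). Qed.

Lemma dvE f z d : cd f z d -> dv f z = d.
Proof. by move=> fd; apply: (cd_unique (f := f) (z := z)) => //; apply: dvP; exists d. Qed.

Definition hol_nbh f z := exists2 e : R, 0 < e & forall w, md (w - z) < e -> hol f w.

(** Cauchy's formula exhibits a holomorphic function as an integral that can be
    differentiated twice. *)
Lemma hol_dv f z : hol_nbh f z -> hol (dv f) z.
Proof.
move=> [e e0 hf]; set rho := e / 2; set r := rho / 2.
have rho0 : 0 < rho by rewrite divr_gt0.
have r0 : 0 < r by rewrite divr_gt0.
have rr : r < rho by rewrite /r ltr_pdivrMr // ltr_pMr // ltr1n.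
have hq w : sq z rho w -> hol f w.
  move=> [h1 h2]; apply: hf; apply: le_lt_trans (md_le _) _.
  rewrite ReB ImB (splitr e); exact: ltrD.
have cf w : on_circle z r w -> cc f w.
  by move=> wr; apply/hol_cont/hq; apply: (sq_circle rr); rewrite wr.
pose K : C := ('i * (2 * pi)%:C)^-1.
have K0 : 'i * (2 * pi)%:C != 0 :> C.
  by rewrite -md_eq0 mdM md_i mul1r md_real normr_eq0 mulf_neq0 // gt_eqF // pi_gt0.
have fE w : md (w - z) < r -> K * circ z r (fun v => f v * (v - w)^-1) = f w.
  by move=> wr; rewrite (cauchy_formula rr hq wr) mulrC mulfK.
have gap w : md (w - z) < r -> exists2 d : R, 0 < d & forall v, md (v - w) < d -> md (v - z) < r.
  move=> wr; exists (r - md (w - z)); first by rewrite subr_gt0.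
  move=> v; rewrite ltrBrDr; apply: le_lt_trans; rewrite (_ : v - z = (v - w) + (w - z)).
    exact: mdD.
  by ring.
have df w : md (w - z) < r -> dv f w = K * circ z r (fun v => f v * (v - w)^-1 ^+ 2).
  move=> wr; apply: dvE; have [d d0 Hd] := gap w wr.
  apply: (cder_near d0 (f := fun w => K * circ z r (fun v => f v * (v - w)^-1))).
    by move=> v vw; apply: fE; exact: Hd.
  by apply: cderZ; exact: cd_cauchy1.
have zr : md (z - z) < r by rewrite subrr md0.
apply: (hol_near r0 (f := fun w => K * circ z r (fun v => f v * (v - w)^-1 ^+ 2))).
  by move=> w wr; rewrite df.
eexists; apply: cderZ; exact: cd_cauchy2.
Qed.

(** The value at the centre is a mean of the values on the circle. *)
Lemma center_le_circle f c r rho M : 0 < r -> r < rho ->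
  (forall w, sq c rho w -> hol f w) ->
  (forall w, on_circle c r w -> md (f w) <= M) -> md (f c) <= M.
Proof.
move=> r0 rr hf H; have cr : md (c - c) < r by rewrite subrr md0.
have ne w : on_circle c r w -> w != c.
  by rewrite /on_circle => wr; apply: contraTneq r0 => wc; rewrite -wr wc subrr md0 ltxx.
have := @circ_le c r (fun w => f w * (w - c)^-1) (M / r) (ltW r0).
rewrite (cauchy_formula rr hf cr) !mdM md_i mul1r md_real ger0_norm ?pi2_ge0 //.
rewrite divfK ?gt_eqF // ler_pM2r ?mulr_gt0 ?pi_gt0 //; apply=> w wr.
  apply: ccontM; last exact/cc_sub_inv/ne.
  by apply/hol_cont/hf/(sq_circle rr); rewrite wr.
by rewrite mdM mdV wr ler_wpM2r ?invr_ge0 ?(ltW r0) //; exact: H.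
Qed.

End Cauchy.

(** * The maximum principle *)

Section MaximumPrinciple.
Context {R : realType}.
Local Notation C := R[i].
Implicit Types (z w c d : C) (r s t : R) (K : set (Cplx R)).

(** Multiplying by [expR (e * |w| ^+ 2)] makes a function that is locally the modulus
    of a holomorphic function strictly subharmonic, so that it has no interior
    maximum. The factor is harmless for small [e]. *)
Lemma max_principle (v : Cplx R -> R) K (E : set C) (M : R) : compact K ->
  (forall z, K z -> {for z, continuous v}) ->
  (forall z, K z -> ~ E z -> exists (d : R) g, 0 < d /\
     forall w : Cplx R, md (w - z) < d -> [/\ K w, hol g w & md (g w) = v w]) ->
  0 <= M -> (forall z, K z -> E z -> v z <= M) ->
  forall z, K z -> v z <= M.
Proof.
move=> cK cv int M0 HE z Kz; rewrite leNgt; apply/negP => Mv.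
have [b _ Hb] : exists2 b, K b & forall w, K w -> md w <= md b.
  by apply: (@compact_md_max R id) => //; [exists z|move=> w _; exact: ccont_id].
have [s Ms sv] : exists2 s : R, M < s & s < v z by exists ((M + v z) / 2); lra.
have s0 : 0 < s by exact: le_lt_trans Ms.
have v0 : 0 < v z by exact: lt_trans sv.
have q1 : 1 < v z / s by rewrite ltr_pdivlMr // mul1r.
have b0 : 0 < md b ^+ 2 + 1 by rewrite ltr_wpDl ?sqr_ge0.
pose e := ln (v z / s) / (md b ^+ 2 + 1); have e0 : 0 < e by rewrite divr_gt0 ?ln_gt0.
have eb : M * expR (e * md b ^+ 2) < v z.
  apply: (@le_lt_trans _ _ (M * (v z / s))).
    apply: ler_wpM2l => //; rewrite -[X in _ <= X]lnK ?posrE ?divr_gt0 //.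
    rewrite ler_expR /e mulrAC.
    by rewrite ler_pdivrMr // ler_wpM2l ?ln_ge0 ?(ltW q1) // lerDl.
  by rewrite mulrCA gtr_pMr // ltr_pdivrMr // mul1r.
pose u (w : Cplx R) : R := v w * expR (e * md w ^+ 2).
have cu w : K w -> {for w, continuous u}.
  move=> /cv cvw; apply: (@continuousM _ _ v) => //.
  apply: continuous_comp; last exact: continuous_expR.
  apply: (@continuousM _ _ (fun=> e)); first exact: cst_continuous.
  have cm : {for w, continuous (fun w : Cplx R => md w : R)}.
    exact: (@continuous_md_comp R id) (ccont_id _ _).
  exact: (@continuousM R (Cplx R) md md w cm cm).
have [|x Kx Hx] := @compact_EVT_max _ _ u K (ex_intro _ z Kz) cK.
  by apply: continuous_in_subspaceT => w; rewrite inE => /cu.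
rewrite inE in Kx; have {}Hx w : K w -> u w <= u x by move=> Kw; apply: Hx; rewrite inE.
have uz : v z <= u x.
  apply: le_trans (Hx z Kz); rewrite ler_peMr ?(ltW v0) // -expR0 ler_expR.
  by rewrite mulr_ge0 ?sqr_ge0 ?ltW.
have vx : 0 < v x by have := lt_le_trans v0 uz; rewrite /u pmulr_lgt0 ?expR_gt0.
have [Ex|nE] := pselect (E x).
  have : u x <= M * expR (e * md b ^+ 2).
    apply: ler_pM; [exact: ltW|exact: expR_ge0|exact: HE|].
    by rewrite ler_expR ler_wpM2l ?(ltW e0) // lerXn2r ?nnegrE ?md_ge0 ?Hb.
  by rewrite leNgt (lt_le_trans eb uz).
have [d [g [d0 Hd]]] := int x Kx nE.
pose r := d / 4; have r0 : 0 < r by rewrite divr_gt0.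
pose G w := g w * cexp ((2 * e)%:C * conjc x * (w - x)).
have sqd w : sq x (d / 2) w -> md (w - x) < d.
  by move=> [h1 h2]; apply: le_lt_trans (md_le _) _; rewrite ReB ImB; lra.
have : md (G x) <= v x * expR (- (e * r ^+ 2)).
  apply: (@center_le_circle _ G x r (d / 2)) => //; first by rewrite /r; lra.
    move=> w /sqd/Hd[_ hg _]; apply: holM => //.
    apply: (hol_comp (g := cexp)); last by exists (cexp ((2 * e)%:C * conjc x * (w - x))); exact: cd_cexp.
    apply: holM; first exact: hol_cst.
    by apply: holB; [exact: hol_id|exact: hol_cst].
  move=> w wr; have [|Kw _ gw] := Hd w; first by rewrite wr /r; lra.
  have := Hx w Kw; rewrite /u => h.
  rewrite mdM gw md_cexp.
  have -> : Re ((2 * e)%:C * conjc x * (w - x)) = e * md w ^+ 2 - e * md x ^+ 2 - e * r ^+ 2.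
    rewrite -wr !mdE !ReM !ImM !ReB !ImB; case: (x) => x1 x2; case: (w) => w1 w2 /=; ring.
  rewrite !expRD !expRN mulrA ler_pM2r ?invr_gt0 ?expR_gt0 //.
  by rewrite (mulrA (v w)) ler_pdivrMr ?expR_gt0.
have [|_ _ gx] := Hd x; first by rewrite subrr md0.
rewrite /G subrr mulr0 cexp0 mulr1 gx.
rewrite ler_pMr // -[X in X <= _]expR0 ler_expR oppr_ge0 leNgt.
by rewrite mulr_gt0 ?exprn_gt0.
Qed.

Lemma max_disc_le (f : C -> C) c r M : (forall w, md (w - c) <= r -> hol f w) ->
  (forall w, md (w - c) = r -> md (f w) <= M) ->
  forall z, md (z - c) <= r -> md (f z) <= M.
Proof.
move=> hf H z zr; have r0 : 0 <= r := le_trans (md_ge0 _) zr.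
apply: (@max_principle (fun w => md (f w)) _ (fun w => md (w - c) = r) M
  (@compact_closed_ball R c r)) => //.
- by move=> w wr; exact/continuous_md_comp/hol_cont/hf.
- move=> w wr nE; have h : md (w - c) < r by rewrite lt_neqAle wr andbT; apply/eqP.
  exists (r - md (w - c)), f; split=> [|v vw]; first by rewrite subr_gt0.
  suff hv : md (v - c) <= r by split=> //; exact: hf.
  rewrite -(subrK w v) -addrA; apply: le_trans (mdD _ _) _.
  by rewrite -lerBrDr ltW.
- by apply: le_trans (md_ge0 _) (H (circle c r 0) _); exact: md_circle.
- by move=> w _; exact: H.
Qed.

End MaximumPrinciple.

(** * Local function theory *)

Section LocalTheory.
Context {R : realType}.
Local Notation C := R[i].
Implicit Types (f g h : C -> C) (z w c a : C) (r s t M : R).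

Lemma ball_nbh (P : C -> Prop) c r z : md (z - c) < r ->
  (forall w, md (w - c) < r -> P w) ->
  exists2 e : R, 0 < e & forall w, md (w - z) < e -> P w.
Proof.
move=> zr H; exists (r - md (z - c)); first by rewrite subr_gt0.
move=> w wz; apply: H; rewrite (_ : w - c = (w - z) + (z - c)); last by ring.
by apply: le_lt_trans (mdD _ _) _; rewrite -ltrBrDr.
Qed.

Lemma half_sq_ball c r w : sq c (r / 2) w -> md (w - c) < r.
Proof.
move=> [h1 h2]; apply: le_lt_trans (md_le _) _; rewrite ReB ImB (splitr r).
exact: ltrD.
Qed.

Lemma ball_sq c r w : md (w - c) < r -> sq c r w.
Proof.
move=> h; have := md_Re (w - c); have := md_Im (w - c); rewrite ReB ImB => h1 h2.
by split; apply: le_lt_trans h.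
Qed.

(** The divided difference is continuous, so it has a primitive near [a]; being
    the derivative of a holomorphic function, it is holomorphic. *)
Lemma divided_difference f a : hol_nbh f a -> exists q : C -> C,
  [/\ forall w, f w - f a = q w * (w - a), hol q a &
      forall w, hol f w -> hol q w].
Proof.
move=> [e e0 hf]; have ha : hol f a by apply: hf; rewrite subrr md0.
have [_ [q [cq _ Hq]]] := ha.
have hq w : w != a -> hol f w -> hol q w.
  move=> wa hw; have m0 : 0 < md (w - a) by rewrite md_gt0 subr_eq0.
  apply: (hol_near m0 (f := fun w => (f w - f a) / (w - a))).
    move=> v vw; rewrite Hq mulfK // subr_eq0; apply: contraTneq vw => ->.
    by rewrite mdC ltxx.
  apply: hol_div; first by rewrite subr_eq0.
    by apply: holB => //; exact: hol_cst.
  by apply: holB; [exact: hol_id|exact: hol_cst].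
have e2 : 0 < e / 2 by rewrite divr_gt0.
have e4 : 0 < e / 4 by rewrite divr_gt0.
have aq : hol q a.
  have [|||||F HF] := @primitive_on_square _ q a (e / 2) (e / 4) a.
  - exact: e4.
  - lra.
  - by apply: ball_sq; rewrite subrr md0.
  - by move=> w /half_sq_ball /hf hw wa; exact: hq.
  - exact: cq.
  apply: (hol_near e4 (f := dv F)).
    by move=> w /ball_sq /HF; exact: dvE.
  by apply: hol_dv; exists (e / 4) => // w /ball_sq /HF Fw; exists (q w).
exists q; split => // w hw; have [->|wa] := eqVneq w a; first exact: aq.
exact: hq.
Qed.

(** The maximum principle for the divided difference at the centre, on circles that
    tend to the boundary. *)
Lemma schwarz f c r M z : (forall w, md (w - c) < r -> hol f w) -> f c = 0 ->
  (forall w, md (w - c) < r -> md (f w) <= M) ->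
  md (z - c) < r -> md (f z) <= M * (md (z - c) / r).
Proof.
move=> hf fc fM zr; have r0 : 0 < r by exact: le_lt_trans (md_ge0 _) zr.
have M0 : 0 <= M by apply: le_trans (md_ge0 (f z)) (fM z zr).
have [q [Hq qc hq]] : exists q : C -> C, [/\ forall w, f w - f c = q w * (w - c), hol q c &
      forall w, hol f w -> hol q w].
  by apply: divided_difference; exists r.
have key s : md (z - c) < s -> s < r -> md (f z) * s <= M * md (z - c).
  move=> zs sr; have s0 : 0 < s by exact: le_lt_trans (md_ge0 _) zs.
  have qz : md (q z) <= M / s.
    apply: (@max_disc_le _ q c s) => [w ws|w ws|]; last exact: ltW.
      by apply/hq/hf; exact: le_lt_trans sr.
    rewrite ler_pdivlMr // -ws -mdM -Hq fc subr0.
    by apply: fM; rewrite ws.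
  move: (Hq z); rewrite fc subr0 => ->; rewrite mdM.
  rewrite mulrAC ler_wpM2r ?md_ge0 //.
  by rewrite -ler_pdivlMr.
rewrite mulrA ler_pdivlMr //; apply/ler_addgt0Pr => e e0.
have fz1 : 0 < md (f z) + 1 by rewrite ltr_wpDl // md_ge0.
set s := Num.max ((md (z - c) + r) / 2) (r - e / (md (f z) + 1)).
have sr : s < r.
  rewrite gt_max; apply/andP; split; first by lra.
  by rewrite ltrBlDr ltrDl divr_gt0.
have zs : md (z - c) < s by rewrite lt_max; apply/orP; left; lra.
have es : r - e / (md (f z) + 1) <= s by rewrite le_max lexx orbT.
apply: (@le_trans _ _ (md (f z) * s + e)); last by rewrite lerD2r; exact: key.
have h1 : md (f z) * (r - e / (md (f z) + 1)) <= md (f z) * s by rewrite ler_wpM2l ?md_ge0.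
have h2 : md (f z) * (e / (md (f z) + 1)) <= e.
  rewrite mulrCA ger_pMr // ler_pdivrMr // mul1r lerDl //.
move: h1; rewrite mulrBr; lra.
Qed.

Lemma segment_cd f g c z : (forall t, 0 <= t <= 1 -> cd f (c + t%:C * (z - c)) (g (c + t%:C * (z - c)))) ->
  forall t, 0 <= t <= 1 ->
  rder (fun t : R => f (c + t%:C * (z - c))) t (g (c + t%:C * (z - c)) * (z - c)).
Proof.
move=> H t t01.
have h : cder (fun t : R => t%:C) (fun s : R => c + s%:C * (z - c)) t
   (0 + (1 * (z - c) + t%:C * 0)).
  apply: cderD; first exact: cder_cst.
  by apply: cderM; [exact: cder_id|exact: cder_cst].
by have := cd_comp h (H t t01); rewrite add0r mulr0 addr0 mul1r.
Qed.

Lemma segment_md c z t : 0 <= t <= 1 -> md (c + t%:C * (z - c) - c) <= md (z - c).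
Proof.
move=> /andP[t0 t1]; rewrite addrAC subrr add0r mdM md_real ger0_norm //.
by rewrite ler_piMl // md_ge0.
Qed.

Lemma lipschitz_of_cd f g c z M :
  (forall w, md (w - c) <= md (z - c) -> cd f w (g w)) ->
  (forall w, md (w - c) <= md (z - c) -> md (g w) <= M) ->
  md (f z - f c) <= M * md (z - c).
Proof.
move=> df gM.
have := @mean_value_ineq _ (fun t : R => g (c + t%:C * (z - c)) * (z - c))
  (fun t : R => f (c + t%:C * (z - c))) 0 1 (M * md (z - c)) ler01.
rewrite mul1r mul0r addr0 (addrC c) subrK subr0 mulr1; apply.
- by move=> t t01; apply: segment_cd => // s s01; apply: df; exact: segment_md.
- by move=> t t01; rewrite mdM ler_wpM2r ?md_ge0 //; apply: gM; exact: segment_md.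
Qed.

(** A primitive of the logarithmic derivative, up to a constant. Primitives live on
    squares, which costs a factor of the radius. *)
Lemma log_exists g c r : 0 < r -> (forall w, md (w - c) < r -> hol g w /\ g w != 0) ->
  exists h, forall w, md (w - c) < r / 4 -> hol h w /\ cexp (h w) = g w.
Proof.
move=> r0 hg; have r4 : 0 < r / 4 by rewrite divr_gt0.
have hphi w : md (w - c) < r -> hol (fun w => dv g w / g w) w.
  move=> wr; have [hw gw] := hg w wr; apply: hol_div => //.
  by apply: hol_dv; apply: ball_nbh wr _ => v /hg[].
have [|||||F HF] := @primitive_on_square _ (fun w => dv g w / g w) c (r / 2) (r / 4) c.
- exact: r4.
- lra.
- by apply: ball_sq; rewrite subrr md0.
- by move=> w /half_sq_ball wr _; exact: hphi.
- by apply/hol_cont/hphi; rewrite subrr md0.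
pose k w := g w * cexp (- F w).
have dk w : md (w - c) < r / 4 -> cd k w 0.
  move=> wr; have wr' : md (w - c) < r by lra.
  have [hw gw] := hg w wr'.
  have dF := HF w (ball_sq wr).
  have dE : cd (fun w => cexp (- F w)) w (cexp (- F w) * - (dv g w / g w)).
    by apply: (cd_comp (cderN dF)); exact: cd_cexp.
  have := cderM (dvP hw) dE.
  by rewrite (_ : _ + _ = 0) //; field.
have kE w : md (w - c) < r / 4 -> k w = k c.
  move=> wr; apply/eqP; rewrite -subr_eq0 -md_eq0 eq_le md_ge0 andbT.
  have := @lipschitz_of_cd k (fun=> 0) c w 0; rewrite mul0r; apply=> v vw.
    by apply: dk; exact: le_lt_trans wr.
  by rewrite md0.
have kc0 : k c != 0.
  by rewrite mulf_neq0 ?cexp_neq0 //; apply: (hg c _).2; rewrite subrr md0.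
have [b bE _] := cexp_surj kc0.
exists (fun w => F w + b) => w wr; split.
  by apply: holD; [exists (dv g w / g w); exact/HF/ball_sq|exact: hol_cst].
by rewrite cexpD bE -(kE w wr) /k mulrCA -cexpD subrr cexp0 mulr1.
Qed.

(** The Cayley transform of the right half plane reduces this to [schwarz]. *)
Lemma half_plane_schwarz h c r z : (forall w, md (w - c) < r -> hol h w /\ 0 < Re (h w)) ->
  md (z - c) < r ->
  md (h z - h c) * (1 - md (z - c) / r) <= 2 * Re (h c) * (md (z - c) / r).
Proof.
move=> hh zr; have r0 : 0 < r by exact: le_lt_trans (md_ge0 _) zr.
have cr : md (c - c) < r by rewrite subrr md0.
have h0 := (hh c cr).2.
set b := conjc (h c).
have Rb : Re b = Re (h c) by rewrite /b; case: (h c).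
have Ib : Im b = - Im (h c) by rewrite /b; case: (h c).
have den w : md (w - c) < r -> h w + b != 0.
  move=> /hh[_ hw]; apply/eqP => /(congr1 (@Re R)); rewrite ReD Rb /=; lra.
pose q w := (h w - h c) / (h w + b).
have qz : md (q z) <= 1 * (md (z - c) / r).
  apply: (@schwarz q c r) => // [w wr||w wr].
  - apply: hol_div; first exact: den.
      by apply: holB; [exact: (hh w wr).1|exact: hol_cst].
    by apply: holD; [exact: (hh w wr).1|exact: hol_cst].
  - by rewrite /q subrr mul0r.
  - rewrite /q mdM mdV ler_pdivrMr ?md_gt0 ?den // mul1r.
    rewrite -(@ler_pXn2r _ 2) ?nnegrE ?md_ge0 // !mdE ReB ImB ReD ImD Rb Ib.
    have := (hh w wr).2; nra.
rewrite mul1r in qz; set t := md (z - c) / r in qz *.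
have t0 : 0 <= t by rewrite divr_ge0 ?md_ge0 // ltW.
have E : h z - h c = q z * (h z + b) by rewrite /q divfK // den.
have : md (h z - h c) <= t * md (h z + b).
  by rewrite E mdM ler_wpM2r // md_ge0.
have : md (h z + b) <= md (h z - h c) + 2 * Re (h c).
  rewrite (_ : h z + b = (h z - h c) + (2 * Re (h c))%:C).
    by apply: le_trans (mdD _ _) _; rewrite md_real ger0_norm // mulr_ge0 // ltW.
  rewrite /b; case: (h z) => x y; case: (h c) => x' y'.
  by apply/eqP; rewrite eq_complex /=; apply/andP; split; apply/eqP; ring.
move=> h1 h2; rewrite mulrBr mulr1.
have : t * md (h z + b) <= t * (md (h z - h c) + 2 * Re (h c)) by rewrite ler_wpM2l.
by move=> h3; lra.
Qed.

(** Harnack's inequality for the positive harmonic function [b - ln |g|]. *)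
Lemma zero_free_harnack g c r b z :
  (forall w, md (w - c) < r -> [/\ hol g w, g w != 0 & md (g w) < expR b]) ->
  md (z - c) < r / 4 ->
  `|ln (md (g z)) - ln (md (g c))| * (1 - 4 * md (z - c) / r)
    <= 2 * (b - ln (md (g c))) * (4 * md (z - c) / r).
Proof.
move=> hg zr; have r0 : 0 < r by have := md_ge0 (z - c); lra.
have [|h Hh] := @log_exists g c r r0; first by move=> w /hg[].
have lnE w : md (w - c) < r / 4 -> ln (md (g w)) = Re (h w).
  by move=> /Hh[_ <-]; rewrite md_cexp expRK.
have cr : md (c - c) < r / 4 by rewrite subrr md0 divr_gt0.
have HP w : md (w - c) < r / 4 -> hol (fun w => b%:C - h w) w /\ 0 < Re (b%:C - h w).
  move=> wr; have [hw E] := Hh w wr; split.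
    by apply: holB => //; exact: hol_cst.
  have [|_ gw gb] := hg w; first lra.
  rewrite ReB /= subr_gt0 -lnE // -[b]expRK ltr_ln ?posrE ?expR_gt0 //.
  by rewrite md_gt0.
have := half_plane_schwarz HP zr.
rewrite ReB /= -lnE //.
rewrite (_ : md (z - c) / (r / 4) = 4 * md (z - c) / r); last by field; rewrite gt_eqF.
set t := 4 * _ / r; move=> H.
have t1 : 0 <= 1 - t.
  by rewrite subr_ge0 /t ler_pdivrMr // mul1r; lra.
apply: le_trans H; rewrite ler_wpM2r //.
rewrite (lnE z zr) (lnE c cr) -ReB.
rewrite (_ : b%:C - h z - (b%:C - h c) = - (h z - h c)); last by ring.
by rewrite mdN; exact: md_Re.
Qed.

End LocalTheory.

Section Covering.
Context {R : realType}.
Local Notation C := R[i].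
Implicit Types (f g h : C -> C) (z w c a : C) (r s t m l M : R).

(** Otherwise [1 / (f - w)] would violate the maximum principle. *)
Lemma value_taken f c r z0 w m : (forall z, md (z - c) <= r -> hol f z) ->
  md (z0 - c) <= r -> (forall z, md (z - c) = r -> m <= md (f z - w)) ->
  md (f z0 - w) < m -> exists2 z, md (z - c) <= r & f z = w.
Proof.
move=> hf z0r fm f0m; apply: contrapT => nE.
have m0 : 0 < m by exact: le_lt_trans (md_ge0 _) f0m.
have ne z : md (z - c) <= r -> f z - w != 0.
  by move=> zr; rewrite subr_eq0; apply/eqP => E; apply: nE; exists z.
have : md ((f z0 - w)^-1) <= m^-1.
  apply: (@max_disc_le _ (fun z => (f z - w)^-1) c r) => // z zr.
    apply: holV; first exact: ne.
    by apply: holB; [exact: hf|exact: hol_cst].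
  have g0 : f z - w != 0 by apply: ne; rewrite zr.
  by rewrite mdV lef_pV2 ?posrE ?md_gt0 // fm.
rewrite mdV lef_pV2 ?posrE ?md_gt0 //; last exact: ne.
by rewrite leNgt f0m.
Qed.

(** Landau's proof of Bloch's theorem. At a maximum of [(r / 2 - |z - c|) |h' z|]
    the derivative at most doubles on a disc of proportional size, which makes [h]
    cover a disc of radius proportional to the maximum. *)
Lemma bloch h c r l : 0 < r -> (forall z, md (z - c) < r -> hol h z) ->
  (forall z, md (z - c) < r -> exists2 w, md (w - h z) < l &
     forall z', md (z' - c) < r -> h z' != w) ->
  md (dv h c) * r <= 96 * l.
Proof.
move=> r0 hh omit.
have l0 : 0 <= l.
  have [|w wl _] := omit c; first by rewrite subrr md0.
  by apply: le_trans (ltW wl); exact: md_ge0.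
set r' := r / 2; have r'0 : 0 < r' by rewrite divr_gt0.
have r'r : r' < r by rewrite /r'; lra.
pose f z := (r'%:C - (md (z - c))%:C) * dv h z.
have hdv z : md (z - c) < r -> hol (dv h) z.
  by move=> zr; apply: hol_dv; exact: ball_nbh zr hh.
have cf z : md (z - c) <= r' -> cc f z.
  move=> zr; apply: ccontM; last by apply/hol_cont/hdv; exact: le_lt_trans r'r.
  apply: ccontB; first exact: ccont_cst.
  move=> e e0; exists e => // w wz; rewrite -rmorphB md_real.
  apply: le_lt_trans wz; apply: le_trans (ler_md_dist _ _) _.
  by rewrite (_ : w - c - (z - c) = w - z) //; ring.
have fE z : md (z - c) <= r' -> md (f z) = (r' - md (z - c)) * md (dv h z).
  by move=> zr; rewrite mdM -rmorphB md_real ger0_norm // subr_ge0.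
have [x /= xr Hx] : exists2 x, [set z : Cplx R | md (z - c) <= r'] x &
    forall z, md (z - c) <= r' -> md (f z) <= md (f x).
  apply: (@compact_md_max _ f); last by move=> z; exact: cf.
    by exists c; rewrite /= subrr md0 ltW.
  exact: compact_closed_ball.
have cr' : md (c - c) <= r' by rewrite subrr md0 ltW.
have := Hx c cr'; rewrite (fE c cr') (fE x xr) subrr md0 subr0 => mu.
set a := md (dv h x) in mu; set t := (r' - md (x - c)) / 2.
have a0 : 0 <= a by exact: md_ge0.
have t0 : 0 <= t by rewrite divr_ge0 // subr_ge0.
suff : a * t <= 24 * l.
  have -> : r = 2 * r' by rewrite /r'; field.
  have : (r' - md (x - c)) * a = 2 * (a * t) by rewrite /t; field.
  by move: mu; lra.
have [a00|an0] := eqVneq a 0; first by rewrite a00 mul0r mulr_ge0.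
have [t00|tn0] := eqVneq t 0; first by rewrite t00 mulr0 mulr_ge0.
have {}a0 : 0 < a by rewrite lt_neqAle eq_sym an0.
have {}t0 : 0 < t by rewrite lt_neqAle eq_sym tn0.
have inb z : md (z - x) <= t -> md (z - c) <= r' - t.
  move=> zx; rewrite (_ : z - c = (z - x) + (x - c)); last by ring.
  by apply: le_trans (mdD _ _) _; rewrite /t in zx *; lra.
have inr z : md (z - x) <= t -> md (z - c) < r by move=> /inb h1; lra.
have d2 z : md (z - x) <= t -> md (dv h z) <= 2 * a.
  move=> zx; have h1 := inb z zx; have h2 : md (z - c) <= r' by lra.
  have := Hx z h2; rewrite (fE z h2) (fE x xr) -/a.
  have -> : r' - md (x - c) = 2 * t by rewrite /t; field.
  have h3 : t * md (dv h z) <= (r' - md (z - c)) * md (dv h z).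
    by rewrite ler_wpM2r ?md_ge0 //; lra.
  move=> h4; rewrite -(ler_pM2l t0); lra.
have d3 z : md (z - x) < t -> md (dv h z - dv h x) <= 3 * a * (md (z - x) / t).
  apply: (@schwarz _ (fun z => dv h z - dv h x)) => [w wx||w wx].
  - by apply: holB; [apply/hdv/inr/ltW|exact: hol_cst].
  - by rewrite subrr.
  - by apply: le_trans (mdB _ _) _; have := d2 w (ltW wx); rewrite -/a; lra.
set s := t / 6; have s0 : 0 < s by rewrite divr_gt0.
have st : s < t by rewrite /s; lra.
have circle_far z : md (z - x) = s -> a * t / 12 <= md (h z - h x).
  move=> zs.
  have H : md ((h z - dv h x * z) - (h x - dv h x * x)) <= a / 2 * md (z - x).
    apply: (@lipschitz_of_cd _ (fun z => h z - dv h x * z) (fun z => dv h z - dv h x)).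
      move=> w; rewrite zs => ws; have wr : md (w - c) < r by apply: inr; lra.
      apply: cderB; first exact/dvP/hh.
      by have := cderZ (dv h x) (cder_id (fun z : C => z) w); rewrite mulr1.
    move=> w; rewrite zs => ws; apply: le_trans (d3 w (le_lt_trans ws st)) _.
    have : md (w - x) / t <= 1 / 6.
      by rewrite ler_pdivrMr // (le_trans ws) // /s; lra.
    by move=> h1; have := ler_wpM2l (ltW a0) h1; lra.
  rewrite (_ : _ - _ = (h z - h x) - dv h x * (z - x)) in H; last by ring.
  have := md_dist (dv h x * (z - x)) ((dv h x * (z - x)) - (h z - h x)).
  rewrite subKr.
  rewrite (mdC _ (h z - h x)) mdM zs -/a => h1; rewrite zs in H.
  have : a * s = a * t / 6 by rewrite /s; field.
  by lra.
rewrite leNgt; apply/negP => lat.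
have xc : md (x - c) < r by exact: le_lt_trans r'r.
have [w wl nw] := omit x xc.
have [||||z zs zw] := @value_taken h x s x w (a * t / 24).
- by move=> z zs; apply/hh/inr; lra.
- by rewrite subrr md0 ltW.
- move=> z /circle_far h1.
  have := md_dist (h z - h x) (w - h x).
  rewrite (_ : h z - h x - (w - h x) = h z - w); last by ring.
  lra.
- by rewrite mdC; lra.
have := nw z; rewrite zw eqxx => h1; suff : false by [].
by apply: h1; apply: inr; lra.
Qed.

End Covering.

(** * Entire functions *)

Section Entire.
Context {R : realType}.
Local Notation C := R[i].
Local Notation E := (Cplx R).
Implicit Types (f g : C -> C) (z w c a : C) (r s t M : R).

Lemma md_real_ge0 r : 0 <= r -> md (r%:C) = r.
Proof. by move=> r0; rewrite md_real ger0_norm. Qed.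

Lemma maxmodE f r : maxmod (f : E -> E) r =
  sup [set md (f z) | z in [set z | md z = r]].
Proof.
rewrite /maxmod; congr sup; rewrite eqEsubset; split => _ [z /= zr <-].
  by exists z; rewrite /= -modulusE.
by exists z; rewrite /= modulusE.
Qed.

Lemma maxmod_attained f r : 0 <= r -> (forall z, hol f z) ->
  exists2 z, md z = r & md (f z) = maxmod (f : E -> E) r.
Proof.
move=> r0 hf; have [||z /= zr H] := @compact_md_max _ f _ _ (@compact_circle R 0 r).
- by exists r%:C; rewrite /= subr0 md_real_ge0.
- by move=> z _; exact/hol_cont/hf.
rewrite subr0 in zr; exists z => //; rewrite maxmodE; apply/eqP; rewrite eq_le.
apply/andP; split.
  apply: ub_le_sup; last by exists z.
  by exists (md (f z)) => _ [w /= wr <-]; apply: H; rewrite subr0.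
apply: ge_sup; first by exists (md (f z)); exists z.
by move=> _ [w /= wr <-]; apply: H; rewrite subr0.
Qed.

Lemma le_maxmod_disc f r z : (forall z, hol f z) -> md z <= r ->
  md (f z) <= maxmod (f : E -> E) r.
Proof.
move=> hf zr; have r0 : 0 <= r by exact: le_trans (md_ge0 z) zr.
apply: (@max_disc_le _ f 0 r) => [w _||]; rewrite ?subr0 //.
move=> w; rewrite subr0 => wr; rewrite maxmodE; apply: ub_le_sup; last by exists w.
have [M HM] := @circ_bounded _ 0 r f r0 (fun w _ => hol_cont (hf w)).
by exists M => _ [v /= vr <-]; apply: HM; rewrite /on_circle subr0.
Qed.

Lemma maxmod_le f r M : 0 <= r -> (forall z, hol f z) ->
  (forall z, md z = r -> md (f z) <= M) -> maxmod (f : E -> E) r <= M.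
Proof. by move=> r0 hf H; have [z zr <-] := maxmod_attained r0 hf; exact: H. Qed.

Lemma maxmod_mono f r s : 0 <= r -> r <= s -> (forall z, hol f z) ->
  maxmod (f : E -> E) r <= maxmod (f : E -> E) s.
Proof.
by move=> r0 rs hf; apply: maxmod_le => // z zr; apply: le_maxmod_disc; rewrite ?zr.
Qed.

Lemma maxmod_ge0 f r : 0 <= r -> (forall z, hol f z) ->
  0 <= maxmod (f : E -> E) r.
Proof. by move=> r0 hf; have [z _ <-] := maxmod_attained r0 hf; exact: md_ge0. Qed.

Lemma entire_divided_difference f a : (forall z, hol f z) ->
  exists2 q : C -> C, (forall z, hol q z) & forall w, f w - f a = q w * (w - a).
Proof.
move=> hf; have [|q [Hq _ hq]] := @divided_difference _ f a; first by exists 1.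
by exists q => // z; exact: hq.
Qed.

Lemma small_on_circles_eq0 f : (forall z, hol f z) ->
  (forall e X : R, 0 < e -> exists2 r, X <= r & forall z, md z = r -> md (f z) <= e) ->
  forall z, f z = 0.
Proof.
move=> hf H z; apply/eqP; rewrite -md_eq0 eq_le md_ge0 andbT.
apply/ler_addgt0Pr => e e0; rewrite add0r; have [r zr Hr] := H e (md z) e0.
by apply: (@max_disc_le _ f 0 r) => [w _|w|]; rewrite ?subr0 //; exact: Hr.
Qed.

(** Induction on [d]: the divided difference at [0] grows with exponent [d - 1]. *)
Lemma liouville f (A : R) (d : nat) : (forall z, hol f z) -> 0 <= A ->
  (forall X : R, exists2 r, X <= r & forall z, md z = r -> md (f z) <= A * r ^+ d) ->
  exists p : {poly C}, forall z, f z = p.[z].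
Proof.
elim: d f A => [|d IH] f A hf A0 H; have [q hq Hq] := entire_divided_difference 0 hf.
  have q0 : forall z, q z = 0.
    apply: small_on_circles_eq0 => // e X e0.
    have [r rX Hr] := H (Num.max X ((A + md (f 0)) / e + 1)).
    move: rX; rewrite ge_max => /andP[Xr er].
    have r0 : 0 < r.
      by apply: lt_le_trans er; rewrite ltr_wpDl // divr_ge0 ?addr_ge0 ?md_ge0 // ltW.
    exists r => // z zr; have := Hr z zr; rewrite expr0 mulr1 => fA.
    rewrite -(ler_pM2r r0) -{1}zr -mdM; move: (Hq z); rewrite subr0 => <-.
    apply: le_trans (mdB _ _) _; apply: (@le_trans _ _ (A + md (f 0))); first by rewrite lerD2r.
    by rewrite mulrC -ler_pdivrMr // (le_trans _ er) // lerDl.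
  exists ((f 0)%:P) => z; rewrite hornerC; have := Hq z; rewrite q0 mul0r.
  by move/eqP; rewrite subr_eq0 => /eqP.
have [|X|p Hp] := IH q (A + md (f 0)) hq.
- by rewrite addr_ge0 // md_ge0.
- have [r rX Hr] := H (Num.max X 1); move: rX; rewrite ge_max => /andP[Xr r1].
  have r0 : 0 < r by exact: lt_le_trans r1.
  exists r => // z zr; rewrite -(ler_pM2r r0) -{1}zr -mdM.
  move: (Hq z); rewrite subr0 => <-.
  apply: le_trans (mdB _ _) _; rewrite -mulrA -exprSr mulrDl; apply: lerD; first exact: Hr.
  by rewrite ler_peMr ?md_ge0 // exprn_ege1.
exists (p * 'X + (f 0)%:P) => z; rewrite hornerD hornerMX hornerC -Hp.
by have := Hq z; rewrite subr0 => <-; rewrite subrK.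
Qed.

Lemma transcendental_growth f (d : nat) : (forall z, hol f z) ->
  ~ (exists p : {poly C}, forall z, f z = p.[z]) ->
  exists2 X : R, 1 <= X & forall r, X <= r -> r ^+ d < maxmod (f : E -> E) r.
Proof.
move=> hf nf; apply: contrapT => H; apply: nf.
apply: (@liouville f 1 d) => // X; apply: contrapT => nr; apply: H.
exists (Num.max X 1) => [|r]; first by rewrite le_max lexx orbT.
rewrite ge_max => /andP[Xr r1]; have r0 : 0 <= r by lra.
rewrite ltNge; apply/negP => Mr; apply: nr; exists r => // z zr.
by rewrite mul1r; apply: le_trans Mr; apply: le_maxmod_disc; rewrite ?zr.
Qed.

(** The number of zeros that can be divided out is bounded, by comparing [f] with
    the product of the linear factors on a large circle. *)
Lemma factor_zeros f b S : (forall z, hol f z) -> f b != 0 -> 0 <= S ->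
  exists (l : seq C) (g : C -> C), [/\ forall z, hol g z,
    forall z, f z = \prod_(a <- l) (z - a) * g z,
    {in l, forall a, md a <= S} &
    forall z, md z <= S -> g z != 0].
Proof.
move=> hf fb S0.
pose ok (l : seq C) (g : C -> C) := [/\ forall z, hol g z,
    forall z, f z = \prod_(a <- l) (z - a) * g z & {in l, forall a, md a <= S}].
set T := 3 * (S + md b) + 1.
have T0 : 0 <= T by rewrite /T; have := md_ge0 b; lra.
set M := maxmod (f : E -> E) T.
have bound l g : ok l g -> (2 ^ size l)%:R * md (f b) <= M.
  move=> [hg fE lS].
  have far z : md z = T -> (2 ^ size l)%:R * md (\prod_(a <- l) (b - a)) <= md (\prod_(a <- l) (z - a)).
    move=> zT; rewrite !md_prod {hg fE}.
    elim: l lS => [|a l IH] lS; first by rewrite !big_nil mul1r.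
    rewrite !big_cons /= expnS natrM mulrACA ler_pM ?mulr_ge0 ?md_ge0 //.
    - by rewrite prodr_ge0 // => i _; exact: md_ge0.
    - have aS : md a <= S by apply: lS; rewrite mem_head.
      have := mdB b a; have := md_dist z a; rewrite zT /T; have := md_ge0 b; lra.
    - by apply: IH => x xl; apply: lS; rewrite in_cons xl orbT.
  have P0 : 0 < md (\prod_(a <- l) (b - a)).
    by rewrite md_gt0; apply: contra fb => /eqP P0; rewrite fE P0 mul0r.
  have gb : md (g b) <= M / ((2 ^ size l)%:R * md (\prod_(a <- l) (b - a))).
    have den0 : 0 < (2 ^ size l)%:R * md (\prod_(a <- l) (b - a)).
      by rewrite mulr_gt0 // ltr0n expn_gt0.
    apply: (@max_disc_le _ g 0 T) => [w _|w|]; rewrite ?subr0 //.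
      move=> wT; rewrite ler_pdivlMr //.
      apply: (@le_trans _ _ (md (g w) * md (\prod_(a <- l) (w - a)))).
        by rewrite ler_wpM2l ?md_ge0 // far.
      by rewrite mulrC -mdM -fE; apply: le_maxmod_disc; rewrite ?wT.
    by rewrite /T; have := md_ge0 b; lra.
  rewrite fE mdM mulrA mulrC -ler_pdivlMr //.
  by rewrite mulr_gt0 // ltr0n expn_gt0.
set N := Num.bound (M / md (f b)).
have sN l g : ok l g -> (size l <= N)%N.
  move=> /bound; rewrite -ler_pdivlMr ?md_gt0 // => h.
  have : ((2 ^ size l)%:R : R) < (N)%:R.
    apply: le_lt_trans h _; apply: archi_boundP.
    by rewrite divr_ge0 ?md_ge0 // maxmod_ge0.
  rewrite ltr_nat => /ltnW; apply: leq_trans.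
  by apply: ltnW; exact: ltn_expl.
suff H n l g : ok l g -> (N < size l + n)%N -> exists l g, ok l g /\ forall z, md z <= S -> g z != 0.
  have ok0 : ok [::] f by split => // z; rewrite big_nil mul1r.
  have [l [g [[h1 h2 h3] h4]]] := H N.+1 [::] f ok0 (ltnSn N).
  by exists l, g.
elim: n l g => [|n IH] l g okl; first by rewrite addn0 ltnNge (sN _ _ okl).
move=> Nl; have [z0|nz] := pselect (exists2 z, md z <= S & g z = 0); last first.
  exists l, g; split=> // z zS; apply/eqP => gz; apply: nz; by exists z.
case: z0 okl Nl => a aS ga [hg fE lS] Nl.
have [q hq Hq] := entire_divided_difference a hg.
apply: (IH (a :: l) q); last by rewrite /= addSnnS.
split=> // [z|x].
  by rewrite big_cons fE -[g z]subr0 -ga Hq; ring.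
by rewrite in_cons => /orP[/eqP ->|/lS].
Qed.

Lemma split_zero_at_origin f b : (forall z, hol f z) -> f b != 0 ->
  exists (m : nat) (F : C -> C), [/\ forall z, hol F z, F 0 != 0 &
    forall z, f z = z ^+ m * F z].
Proof.
move=> hf fb; have [l [g [hg fE lS g0]]] := factor_zeros hf fb (lexx 0).
exists (size l), g; split=> // [|z]; first by apply: g0; rewrite md0.
rewrite fE; congr (_ * _).
elim: l lS {fE} => [|a l IH] lS; first by rewrite big_nil expr0.
have -> : a = 0.
  by apply/eqP; rewrite -md_eq0 eq_le md_ge0 andbT; apply: lS; rewrite mem_head.
by rewrite big_cons subr0 exprS IH // => x xl; apply: lS; rewrite in_cons xl orbT.
Qed.

Lemma zero_free_near0 (F : C -> C) : hol F 0 -> F 0 != 0 ->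
  exists2 t : R, 0 < t & forall a, F a = 0 -> t <= md a.
Proof.
move=> /hol_cont cF F0; have m0 : 0 < md (F 0) by rewrite md_gt0.
have [t t0 Ht] := cF _ m0; exists t => // a Fa; rewrite leNgt; apply/negP => at_.
by have := Ht a; rewrite subr0 => /(_ at_); rewrite Fa sub0r mdN ltxx.
Qed.

(** [value_taken] on a small circle where [f] omits the value [f z0], which exists
    because the zeros of [f - f z0] are isolated. *)
Lemma open_mapping f z0 b s : (forall z, hol f z) -> f b != f z0 -> 0 < s ->
  exists2 m : R, 0 < m & forall w, md (w - f z0) < m ->
    exists2 z, md (z - z0) < s & f z = w.
Proof.
move=> hf fb s0; pose F z := f (z + z0) - f z0.
have hF z : hol F z.
  apply: holB; last exact: hol_cst.
  by apply: (hol_comp (g := f)) => //; apply: holD; [exact: hol_id|exact: hol_cst].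
have Fb : F (b - z0) != 0 by rewrite /F subrK subr_eq0.
have [n [G [hG G0 FE]]] := split_zero_at_origin hF Fb.
have [t' t'0 Ht] := zero_free_near0 (hG 0) G0.
pose t := Num.min s t' / 2; have st0 : 0 < Num.min s t' by rewrite lt_min s0.
have t0 : 0 < t by rewrite divr_gt0.
have : t < Num.min s t' by rewrite ltr_pdivrMr // ltr_pMr // ltr1n.
rewrite lt_min => /andP[ts tt'].
have Ft z : on_circle 0 t z -> F z != 0.
  rewrite /on_circle subr0 => zt; rewrite FE mulf_neq0 ?expf_neq0 -?md_eq0 ?zt ?gt_eqF //.
  by rewrite md_gt0; apply/eqP => /Ht; rewrite zt leNgt tt'.
have [M HM] := @circ_bounded _ 0 t (fun z => (F z)^-1) (ltW t0)
  (fun z zt => ccontV (Ft z zt) (hol_cont (hF z))).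
set m := (`|M| + 1)^-1; have m0 : 0 < m by rewrite invr_gt0 ltr_wpDl.
have Fm z : on_circle 0 t z -> m <= md (F z).
  move=> zt; rewrite -[X in _ <= X]invrK lef_pV2 ?posrE ?ltr_wpDl //; last first.
    by rewrite invr_gt0 md_gt0 Ft.
  rewrite -mdV; apply: le_trans (HM z zt) _.
  by apply: le_trans (ler_norm _) _; rewrite lerDl.
exists (m / 2) => [|w wm]; first by rewrite divr_gt0.
have [||||z zt zw] := @value_taken _ F 0 t 0 (w - f z0) (m / 2).
- by move=> z _; exact: hF.
- by rewrite subrr md0 ltW.
- by move=> z /Fm; have := md_dist (F z) (w - f z0); lra.
- by rewrite /F add0r subrr sub0r mdN.
exists (z + z0); first by rewrite addrK -[z]subr0; exact: le_lt_trans ts.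
by move: zw; rewrite /F => /eqP; rewrite (inj_eq (addIr _)) => /eqP.
Qed.

End Entire.

(** * Hadamard's three circles theorem *)

Section Hadamard.
Context {R : realType}.
Local Notation C := R[i].
Variable f : C -> C.
Hypothesis hf : forall z, hol f z.
Local Notation M := (maxmod (f : Cplx R -> Cplx R)).

(** The maximum principle for [|f w| * |w| `^ (- a)], which is locally the modulus
    of a branch of [f w * w `^ (- a)]; the exponent [a] equalizes the bounds on the
    two boundary circles. *)
Lemma hadamard (s k : R) : 0 < M 1 -> 0 < s -> 1 <= k ->
  k * ln (M (expR s)) - (k - 1) * ln (M 1) <= ln (M (expR (k * s))).
Proof.
move=> M1 s0 k1; set t := k * s.
have k0 : 0 < k by exact: lt_le_trans k1.
have t0 : 0 < t by rewrite mulr_gt0.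
have et : 1 <= expR t by rewrite -expR0 ler_expR ltW.
have Mt : 0 < M (expR t) by apply: lt_le_trans M1 _; apply: maxmod_mono.
have Ms : 0 < M (expR s).
  by apply: lt_le_trans M1 _; apply: maxmod_mono => //; rewrite -expR0 ler_expR ltW.
pose a := (ln (M (expR t)) - ln (M 1)) / t.
pose v (w : Cplx R) : R := md (f w) * expR (- a * ln (md w)).
have loc z : 1 <= md z -> exists g, forall w, md (w - z) < md z / 4 ->
    hol g w /\ md (g w) = v w.
  move=> z1; have z0 : 0 < md z by exact: lt_le_trans z1.
  have [|h Hh] := @log_exists _ id z (md z) z0.
    move=> w wz; split; first exact: hol_id.
    by apply: contraTneq wz => ->; rewrite sub0r mdN ltxx.
  exists (fun w => f w * cexp (- a%:C * h w)) => w /Hh[hw Ew]; split.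
    apply: holM => //; apply: (hol_comp (g := cexp)).
      by apply: holM; [exact: hol_cst|exact: hw].
    by exists (cexp (- a%:C * h w)); exact: cd_cexp.
  have lw : ln (md w) = Re (h w) by rewrite -[in LHS]Ew md_cexp expRK.
  by rewrite mdM md_cexp /v lw ReM /= oppr0 mul0r subr0.
have [z zs zM] := maxmod_attained (expR_ge0 s) hf.
have : v z <= M 1.
  apply: (@max_principle _ v _ (fun w => md w = 1 \/ md w = expR t) _
    (@compact_closed_annulus _ 0 1 (expR t))); rewrite ?ltW //.
  - move=> w /=; rewrite subr0 => /andP[w1 _]; have [g Hg] := loc w w1.
    have w4 : 0 < md w / 4 by rewrite divr_gt0 // (lt_le_trans _ w1).
    apply: (@continuous_local _ (fun w => md (g w)) v w _ w4) => [x /Hg[]//|].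
    by apply/continuous_md_comp/hol_cont; apply: (Hg w _).1; rewrite subrr md0.
  - move=> w /=; rewrite subr0 => /andP[w1 wt] nE; have [g Hg] := loc w w1.
    have lt1 : 1 < md w by rewrite lt_neqAle w1 andbT; apply/eqP => h; apply: nE; left.
    have ltt : md w < expR t by rewrite lt_neqAle wt andbT; apply/eqP => h; apply: nE; right.
    exists (Num.min (md w / 4) (Num.min (md w - 1) (expR t - md w))), g; split.
      by rewrite !lt_min !subr_gt0 lt1 ltt divr_gt0 // (lt_trans _ lt1).
    move=> x; rewrite !lt_min => /andP[/Hg[hg vE] /andP[h1 h2]]; split=> //.
    by rewrite /= subr0; have := md_dist w x; have := md_dist x w; rewrite (mdC w x); lra.
  - move=> w _ [wE|wE]; rewrite /v wE.
      by rewrite ln1 mulr0 expR0 mulr1; apply: le_maxmod_disc; rewrite ?wE.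
    rewrite expRK mulNr /a divfK ?gt_eqF // opprB expRB !lnK ?posrE //.
    rewrite mulrCA ger_pMr // ler_pdivrMr // mul1r.
    by apply: le_maxmod_disc; rewrite ?wE.
  - by rewrite /= subr0 zs -expR0 !ler_expR (ltW s0) ler_peMl // ltW.
rewrite /v zM zs expRK -[X in X * _]lnK ?posrE // -expRD -[X in _ <= X]lnK ?posrE //.
rewrite ler_expR => H.
have : k * (ln (M (expR s)) + - a * s) <= k * ln (M 1) by rewrite ler_wpM2l ?(ltW k0).
rewrite mulrDr mulNr mulrN (_ : k * (a * s) = ln (M (expR t)) - ln (M 1)); first lra.
by rewrite /a /t; field; rewrite !gt_eqF.
Qed.

End Hadamard.

(** * Lower bounds for products of linear factors *)

Section FiniteDifferences.
Context {R : realType}.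
Implicit Types (p q : {poly R}) (h a B : R).

Lemma difference_coef h n p : (forall i, (n < i)%N -> p`_i = 0) ->
  (forall i, (n <= i)%N -> (p \Po ('X + h%:P) - p)`_i = 0) /\
  ((0 < n)%N -> (p \Po ('X + h%:P) - p)`_n.-1 = n%:R * h * p`_n).
Proof.
elim: n p => [|n IH] p pn.
  have -> : p = (p`_0)%:P.
    by apply/polyP => -[|i]; rewrite coefC //= pn.
  by split => // i _; rewrite comp_polyC subrr coef0.
elim/poly_ind: p pn => [|p c _] pn.
  by split=> [i _|_]; rewrite comp_poly0 subrr !coef0 ?mulr0.
have pE i : (p * 'X + c%:P)`_i.+1 = p`_i by rewrite coefD coefMX coefC /= addr0.
have qn i : (n < i)%N -> p`_i = 0 by move=> ni; rewrite -pE pn.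
have [IH1 IH2] := IH p qn.
set D := p \Po _ - p in IH1 IH2.
have -> : (p * 'X + c%:P) \Po ('X + h%:P) - (p * 'X + c%:P) = D * ('X + h%:P) + h%:P * p.
  rewrite comp_polyD comp_polyM comp_polyX comp_polyC /D; ring.
split=> [[|i] ni|_ /=]; first by [].
  rewrite coefD mulrDr coefD coefMX coefMC coefCM /= (IH1 i) ?(IH1 i.+1) ?qn //.
    by rewrite mul0r mulr0 !addr0.
  by rewrite ltnW.
rewrite pE coefD mulrDr coefD coefMX coefMC coefCM (IH1 n) // mul0r addr0.
case: n {IH pn} qn IH1 IH2 => [|n] qn IH1 IH2; first by rewrite /= add0r mul1r.
by rewrite /= IH2 // -[in RHS]natr1; ring.
Qed.

(** The [n]-fold difference with step [h] of a polynomial of degree [n] is the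
    constant [n`! * h ^+ n] times the leading coefficient. *)
Lemma monic_max_on_grid h a B n p : 0 <= h -> (forall i, (n < i)%N -> p`_i = 0) ->
  (forall j, (j <= n)%N -> `|p.[a + h *+ j]| <= B) ->
  `|p`_n| * (n`!)%:R * h ^+ n <= 2 ^+ n * B.
Proof.
move=> h0; elim: n p B => [|n IH] p B pn H.
  have E : p = (p`_0)%:P by apply/polyP => -[|i]; rewrite coefC //= pn.
  have := H 0%N (leqnn _); rewrite {1}E hornerC fact0 !expr0 !mulr1 mul1r; exact.
have [d1 d2] := difference_coef h pn.
have := IH (p \Po ('X + h%:P) - p) (2 * B) d1 _.
rewrite d2 //= !normrM ger0_norm // (ger0_norm h0) => IH'.
rewrite factS natrM !exprS.
have -> : `|p`_n.+1| * (n.+1%:R * (n`!)%:R) * (h * h ^+ n) =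
  n.+1%:R * h * `|p`_n.+1| * (n`!)%:R * h ^+ n by ring.
rewrite (_ : 2 * 2 ^+ n * B = 2 ^+ n * (2 * B)); last by ring.
apply: IH' => j jn; rewrite hornerD hornerN horner_comp hornerD hornerX hornerC.
rewrite -addrA -mulrSr; apply: le_trans (ler_normB _ _) _.
have := H j (leqW jn); have := H j.+1 jn; lra.
Qed.

(** A weak form of Stirling's formula. *)
Lemma fact_lower n : n%:R ^+ n <= expR 1 ^+ n * (n`!)%:R :> R.
Proof.
elim: n => [|n IH]; first by rewrite !expr0 fact0 mulr1.
rewrite factS natrM exprS [expR 1 ^+ _]exprS mulrCA mulrA (mulrC (expR 1)) -!mulrA.
rewrite ler_wpM2l // mulrA.
have [->|n0] := posnP n; first by rewrite !expr0 fact0 mulr1 mul1r ltW // expR_gt1.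
have n0' : (0 : R) < n%:R by rewrite ltr0n.
apply: (@le_trans _ _ (expR 1 * n%:R ^+ n)); last first.
  by rewrite (mulrC (expR 1 ^+ n)) -mulrA ler_wpM2l // expR_ge0.
have -> : (n.+1%:R : R) = (1 + n%:R^-1) * n%:R by rewrite mulrDl mul1r mulVf ?gt_eqF // natr1.
rewrite exprMn ler_wpM2r ?exprn_ge0 //.
apply: (@le_trans _ _ (expR (n%:R^-1) ^+ n)).
  by rewrite lerXn2r ?nnegrE ?expR_ge0 ?addr_ge0 ?invr_ge0 // expR_ge1Dx.
by rewrite -expRM_natl mulr_natl -mulr_natl divff ?gt_eqF.
Qed.

(** A monic polynomial of degree [n] cannot be small at all of the [n + 1] points that
    divide [[r, 2 r]] into [n] equal parts. *)
Lemma far_from_roots (l : seq R) (r : R) : 0 < r ->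
  exists2 x, r <= x <= 2 * r &
    (r / (2 * expR 1)) ^+ size l <= \prod_(b <- l) `|x - b|.
Proof.
move=> r0; set n := size l; have [n0|n0] := posnP n.
  exists r; first by rewrite lexx ler_peMl ?(ltW r0) // ler1n.
  by rewrite n0 (size0nil n0) expr0 big_nil.
have n0' : (0 : R) < n%:R by rewrite ltr0n.
pose p : {poly R} := \prod_(b <- l) ('X - b%:P).
have psz : size p = n.+1 by rewrite size_prod_XsubC.
have pn : p`_n = 1.
  by have /monicP := monic_prod_XsubC l predT id; rewrite lead_coefE psz.
apply: contrapT => nE.
set c := (r / (2 * expR 1)) ^+ n; set h := r / n%:R.
have h0 : 0 < h by rewrite divr_gt0.
have c0 : 0 < c by rewrite exprn_gt0 // divr_gt0 // mulr_gt0 // expR_gt0.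
have small j : (j <= n)%N -> `|p.[r + h *+ j]| < c.
  move=> jn; rewrite ltNge; apply/negP => H; apply: nE; exists (r + h *+ j).
    have h1 : 0 <= h *+ j by rewrite mulrn_wge0 // ltW.
    have h2 : h *+ j <= r.
      rewrite -mulr_natr /h -mulrA ger_pMr // ler_pdivrMl // mulr1.
      by rewrite ler_nat.
    lra.
  apply: le_trans H _; rewrite horner_prod normr_prod.
  by under eq_bigr do rewrite hornerXsubC.
pose B := \big[Num.max/0]_(j < n.+1) `|p.[r + h *+ j]|.
have Bc : B < c by rewrite /B; elim/big_ind: _ => // [x y xc yc|i _]; [rewrite gt_max xc|apply: small; rewrite -ltnS].
have := @monic_max_on_grid h r B n p (ltW h0).
rewrite pn normr1 mul1r => /(_ _ _) H.
have {}H : (n`!)%:R * h ^+ n <= 2 ^+ n * B.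
  apply: H => [i ni|j jn]; first by rewrite nth_default // psz.
  by rewrite /B (bigmax_sup (Ordinal (jn : (j < n.+1)%N))).
have : 2 ^+ n * B < 2 ^+ n * c by rewrite ltr_pM2l // exprn_gt0.
have : 2 ^+ n * c <= (n`!)%:R * h ^+ n.
  rewrite /c /h !exprMn !exprVn exprMn invfM.
  have e0 : 0 < expR 1 ^+ n :> R by rewrite exprn_gt0 // expR_gt0.
  have nn0 : 0 < n%:R ^+ n :> R by rewrite exprn_gt0.
  rewrite (_ : 2 ^+ n * _ = r ^+ n * (expR 1 ^+ n)^-1); last first.
    by field; rewrite !gt_eqF // exprn_gt0.
  rewrite mulrCA ler_wpM2l ?exprn_ge0 ?(ltW r0) //.
  rewrite -[X in X <= _]mul1r ler_pdivrMr // mulrAC ler_pdivlMr // mul1r mulrC.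
  exact: fact_lower.
lra.
Qed.

End FiniteDifferences.

Section ZeroProducts.
Context {R : realType}.
Local Notation C := R[i].
Implicit Types (l : seq C) (r x y : R).

(** The zeros of modulus at most [4 r] are avoided by [far_from_roots]; the other
    factors are close to [1]. Both losses are charged to the same weights. *)
Lemma zeros_product_lower l r : 0 < r -> {in l, forall a, a != 0} ->
  exists2 rho, r <= rho <= 2 * r & forall z, md z = rho ->
    \prod_(a <- l) (1 + r / md a) * expR (- (50 * \sum_(a <- l) r / (r + md a)))
    <= md (\prod_(a <- l) (1 - z / a)).
Proof.
move=> r0 l0; pose near (a : C) := md a <= 4 * r.
have [rho rr H] := far_from_roots [seq md a | a <- [seq a <- l | near a]] r0.
exists rho => // z zr; rewrite big_map size_map in H.
have al0 a : a \in l -> 0 < md a by move=> /l0; rewrite md_gt0.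
have -> : \prod_(a <- l) (1 + r / md a) * expR (- (50 * \sum_(a <- l) r / (r + md a))) =
    \prod_(a <- l) ((1 + r / md a) * expR (- (50 * (r / (r + md a))))).
  rewrite big_split /=; congr (_ * _).
  by rewrite mulr_sumr -sumrN expR_sum.
rewrite md_prod (bigID near) [X in _ <= X](bigID near) /=.
have facge0 a : a \in l -> 0 <= (1 + r / md a) * expR (- (50 * (r / (r + md a)))).
  by move=> /al0 a0; rewrite mulr_ge0 ?expR_ge0 // addr_ge0 // divr_ge0 // ltW.
rewrite ler_pM //.
- by rewrite big_seq_cond prodr_ge0 // => a /andP[/facge0].
- by rewrite big_seq_cond prodr_ge0 // => a /andP[/facge0].
- apply: (@le_trans _ _ (\prod_(a <- l | near a) ((r / (2 * expR 1)) / md a))).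
    rewrite big_seq_cond [X in _ <= X]big_seq_cond ler_prod // => a /andP[al na].
    rewrite facge0 //=; have a0 := al0 a al.
    have -> : 1 + r / md a = (md a + r) / md a by rewrite mulrDl divff ?gt_eqF.
    rewrite mulrAC ler_pM2r ?invr_gt0 //.
    apply: (@le_trans _ _ (5 * r * expR (- 10))).
      rewrite ler_pM ?expR_ge0 ?addr_ge0 ?(ltW a0) ?(ltW r0) //.
        by move: na; rewrite /near; lra.
      rewrite ler_expR lerN2.
      have : 1 / 5 <= r / (r + md a).
        by rewrite ler_pdivlMr ?addr_gt0 //; move: na; rewrite /near; lra.
      lra.
    rewrite expRN ler_pdivrMr ?expR_gt0 // mulrAC ler_pdivlMr ?mulr_gt0 ?expR_gt0 //.
    rewrite (_ : 10 = 9 + 1 :> R) ?(expRD 9 1); last by ring.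
    have e9 : 1 + 9 <= expR (9 : R) by exact: expR_ge1Dx.
    have e1 : 0 < expR (1 : R) by exact: expR_gt0.
    have : 10 * (r * expR 1) <= expR 9 * (r * expR 1).
      have h0 : 0 <= r * expR 1 by rewrite mulr_ge0 // ltW.
      by rewrite (ler_wpM2r h0) //; lra.
    lra.
  rewrite big_split /= -big_filter big_const_seq count_predT.
  rewrite (_ : iter _ _ _ = (r / (2 * expR 1)) ^+ size ([seq a <- l | near a])); last first.
    by elim: (size _) => [|n IH]; rewrite ?expr0 //= IH exprS.
  apply: (@le_trans _ _ (\prod_(a <- [seq a <- l | near a]) `|rho - md a| * \prod_(a <- l | near a) (md a)^-1)).
    by rewrite ler_wpM2r // prodr_ge0 // => a _; rewrite invr_ge0 md_ge0.
  rewrite big_filter -big_split /= big_seq_cond [X in _ <= X]big_seq_cond.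
  apply: ler_prod => a /andP[al na].
  rewrite mulr_ge0 ?invr_ge0 ?md_ge0 //=.
  have -> : 1 - z / a = (a - z) / a by rewrite mulrBl divff // l0.
  by rewrite mdM mdV ler_wpM2r ?invr_ge0 ?md_ge0 // -zr (le_trans (ler_md_dist _ _)) // mdC.
- rewrite big_seq_cond [X in _ <= X]big_seq_cond; apply: ler_prod => a /andP[al na].
  rewrite facge0 //=; have a0 := al0 a al.
  set y := r / md a; have y0 : 0 <= y by rewrite divr_ge0 // ltW.
  have y4 : y <= 1 / 4.
    by rewrite ler_pdivrMr //; move: na; rewrite /near -ltNge; lra.
  apply: (@le_trans _ _ (1 - 2 * y)).
    apply: (@le_trans _ _ ((1 + y) * expR (- (40 * y)))).
      rewrite ler_wpM2l ?addr_ge0 // ler_expR lerN2.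
      have -> : r / (r + md a) = y / (1 + y).
        by rewrite /y; field; rewrite !gt_eqF ?addr_gt0.
      have : (4 / 5) * y <= y / (1 + y).
        rewrite ler_pdivlMr ?ltr_wpDr //; nra.
      lra.
    rewrite expRN ler_pdivrMr ?expR_gt0 //.
    have e40 : 1 + 40 * y <= expR (40 * y) by exact: expR_ge1Dx.
    apply: (@le_trans _ _ ((1 - 2 * y) * (1 + 40 * y))); first by nra.
    by rewrite ler_wpM2l //; lra.
  have := md_dist 1 (z / a); rewrite md1 mdM mdV zr.
  have : rho / md a <= 2 * y.
    by rewrite /y mulrA ler_pM2r ?invr_gt0 //; case/andP: rr.
  lra.
Qed.

(** When all zeros of [z ^+ m * \prod_(a <- l) (1 - z / a)] are rotated to the negative
    axis, the modulus becomes largest on the positive axis; [psi m l x] is the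
    logarithm of this maximum for the radius [expR x]. *)
Definition psi (m : nat) l x := m%:R * x + \sum_(a <- l) ln (1 + expR x / md a).

Definition dpsi (m : nat) l x := m%:R + \sum_(a <- l) expR x / (expR x + md a).

Lemma is_derive_psi m l x : {in l, forall a, a != 0} -> is_derive x 1 (psi m l) (dpsi m l x).
Proof.
have dln a : a != 0 -> is_derive x 1 (fun x : R => ln (1 + expR x / md a)) (expR x / (expR x + md a)).
  rewrite -md_gt0 => a0.
  have p0 : 0 < 1 + expR x / md a by rewrite ltr_wpDr // divr_ge0 ?expR_ge0 // ltW.
  have d1 : is_derive x 1 (fun x : R => 1 + expR x / md a) (expR x / md a).
    have := is_deriveD (is_derive_cst (1 : R) x 1) (is_deriveM (is_derive_expR x) (is_derive_cst (md a)^-1 x 1)).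
    by rewrite scaler0 !add0r (_ : _ *: _ = expR x / md a) //; exact: mulrC.
  have := @is_derive1_comp _ (@ln R) (fun x : R => 1 + expR x / md a) x _ _ (is_derive1_ln p0) d1.
  rewrite (_ : _ * _ = expR x / (expR x + md a)) //.
  by field; rewrite !gt_eqF // addr_gt0 // expR_gt0.
elim: l => [|a l IH] l0.
  rewrite /dpsi big_nil addr0.
  have := is_deriveM (is_derive_cst (m%:R : R) x 1) (is_derive_id x 1).
  rewrite scaler0 addr0 (_ : _ *: _ = m%:R); last exact: mulr1.
  by congr is_derive; apply/funext => y; rewrite /psi big_nil addr0.
have a0 : a != 0 by apply: l0; rewrite mem_head.
have {}IH : is_derive x 1 (psi m l) (dpsi m l x).
  by apply: IH => b bl; apply: l0; rewrite in_cons bl orbT.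
have := is_deriveD (dln a a0) IH.
rewrite (_ : _ + dpsi m l x = dpsi m (a :: l) x); last by rewrite /dpsi big_cons; ring.
by congr is_derive; apply/funext => y; rewrite /psi big_cons; exact: addrCA.
Qed.

(** The mean value theorem for [ln psi]. *)
Lemma psi_slow_point m l (x1 x0 b : R) : {in l, forall a, a != 0} -> x1 < x0 ->
  (forall x, x1 <= x <= x0 -> 0 < psi m l x) ->
  ln (psi m l x0) - ln (psi m l x1) <= b * (x0 - x1) ->
  exists2 x, x1 <= x <= x0 & dpsi m l x <= b * psi m l x.
Proof.
move=> l0 x10 pos H.
have d x : x1 <= x <= x0 -> is_derive x 1 (fun x : R => ln (psi m l x)) ((psi m l x)^-1 * dpsi m l x).
  by move=> /pos p0; apply: is_derive1_comp; [exact: is_derive1_ln|exact: is_derive_psi].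
have [||x xin E] := @MVT_segment _ (fun x : R => ln (psi m l x))
  (fun x => (psi m l x)^-1 * dpsi m l x) x1 x0 (ltW x10).
- by move=> x; rewrite in_itv /= => /andP[h1 h2]; apply: d; rewrite !ltW.
- apply: continuous_in_subspaceT => x; rewrite inE /= in_itv /= => xi.
  exact: is_derive_continuous (d x xi).
have {}xin : x1 <= x <= x0 by move: xin; rewrite in_itv.
exists x => //; have p0 := pos x xin.
rewrite -ler_pdivrMr // mulrC; move: H; rewrite E.
by rewrite ler_pM2r // subr_gt0.
Qed.

End ZeroProducts.

(** * Minimum modulus *)

Section MinimumModulus.
Context {R : realType}.
Local Notation C := R[i].
Implicit Types (f F : C -> C) (s x k e : R).

Lemma big_cons_lower (l : seq C) (G : C -> R) (q : R) : 0 <= q ->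
  {in l, forall a, q <= G a} -> q ^+ size l <= \prod_(a <- l) G a.
Proof.
move=> q0; elim: l => [|a l IH] H; first by rewrite big_nil expr0.
rewrite big_cons /= exprS ler_pM ?exprn_ge0 //; first by apply: H; rewrite mem_head.
by apply: IH => x xl; apply: H; rewrite in_cons xl orbT.
Qed.

(** Dividing out the zeros up to a much larger radius leaves a zero free factor,
    which Harnack's inequality shows to be almost constant on a small disc. *)
Lemma local_product F s B : (forall z, hol F z) -> F 0 != 0 -> 2 <= s ->
  maxmod (F : Cplx R -> Cplx R) (expR (5 * s)) <= expR B ->
  16 * (B + 1 - ln (md (F 0))) <= expR (2 * s) ->
  exists l : seq C, [/\ {in l, forall a, a != 0 /\ F a = 0},
    (size l)%:R <= B - ln (md (F 0)) &
    forall z, md z <= expR (2 * s) ->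
      expR (- 1) * md (F 0) * md (\prod_(a <- l) (1 - z / a)) <= md (F z) /\
      md (F z) <= expR 1 * md (F 0) * md (\prod_(a <- l) (1 - z / a))].
Proof.
move=> hF F0 s2 MB sB.
have [l [g [hg FE lS g0]]] := factor_zeros hF F0 (expR_ge0 (4 * s)).
have l0 a : a \in l -> a != 0.
  move=> al; apply: contra F0 => /eqP a0; rewrite FE mulf_eq0; apply/orP; left.
  by rewrite prodf_seq_eq0; apply/hasP; exists a => //; rewrite a0 subr0 eqxx.
pose P z := \prod_(a <- l) (1 - z / a).
pose G z := \prod_(a <- l) (- a) * g z.
have FPG z : F z = P z * G z.
  rewrite FE /P /G mulrA -big_split /=; congr (_ * _).
  apply: eq_big_seq => a al; field; exact: l0.
have hG z : hol G z by apply: holM => //; exact: hol_cst.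
have G0 : G 0 = F 0.
  rewrite FPG /P (eq_bigr (fun=> 1)) ?big1 ?mul1r // => a _.
  by rewrite mul0r subr0.
have mF0 : 0 < md (F 0) by rewrite md_gt0.
have e2 : 2 <= expR (1 : R) by have := expR_ge1Dx (1 : R); lra.
have es : expR 1 + 1 <= expR s.
  apply: (@le_trans _ _ (expR (1 + 1))); last by rewrite ler_expR; lra.
  rewrite expRD; have : 2 * expR 1 <= expR 1 * expR (1 : R) by rewrite ler_wpM2r ?expR_ge0.
  lra.
have far z : md z = expR (5 * s) -> expR 1 ^+ size l <= md (P z).
  move=> zT; rewrite md_prod; apply: big_cons_lower; first exact: expR_ge0.
  move=> a al; rewrite mdC; have a0 : 0 < md a by rewrite md_gt0 l0.
  have := md_dist (z / a) 1; rewrite md1 mdM mdV zT.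
  have : expR s <= expR (5 * s) / md a.
    rewrite ler_pdivlMr //; apply: (@le_trans _ _ (expR s * expR (4 * s))).
      by rewrite ler_wpM2l ?expR_ge0 // lS.
    by rewrite -expRD ler_expR; lra.
  lra.
have T0 : 0 <= expR (5 * s) by exact: expR_ge0.
have GT z : md z = expR (5 * s) -> md (G z) <= expR B / expR 1 ^+ size l.
  move=> zT; rewrite ler_pdivlMr ?exprn_gt0 ?expR_gt0 //.
  apply: (@le_trans _ _ (md (G z) * md (P z))); first by rewrite ler_wpM2l ?md_ge0 ?far.
  rewrite mulrC -mdM -FPG; apply: le_trans MB.
  by apply: le_maxmod_disc; rewrite ?zT.
have Gdisc z : md z <= expR (5 * s) -> md (G z) <= expR B / expR 1 ^+ size l.
  by move=> zT; apply: (@max_disc_le _ G 0 (expR (5 * s))) => [w _|w|];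
    rewrite ?subr0 //; exact: GT.
have en : 1 <= expR 1 ^+ size l :> R by rewrite exprn_ege1 //; lra.
have en0 : 0 < expR 1 ^+ size l :> R by lra.
have GB z : md z <= expR (5 * s) -> md (G z) <= expR B.
  move=> zT; apply: le_trans (Gdisc z zT) _.
  by rewrite ler_pdivrMr // ler_peMr ?expR_ge0.
have zn : (size l)%:R <= B - ln (md (F 0)).
  have : md (F 0) <= expR B / expR 1 ^+ size l by rewrite -G0; apply: Gdisc; rewrite md0.
  rewrite -[X in X <= _ -> _](lnK (mF0 : md (F 0) \is Num.pos)).
  rewrite -expRM_natl mulr_natl -expRN -expRD ler_expR; lra.
exists l; split=> // [a al|z zs].
  split; first exact: l0.
  rewrite FE; apply/eqP; rewrite mulf_eq0; apply/orP; left.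
  by rewrite prodf_seq_eq0; apply/hasP; exists a => //; rewrite subrr eqxx.
have r4 : 16 * expR (2 * s) <= expR (4 * s).
  rewrite (_ : 4 * s = 2 * s + 2 * s) ?expRD; last by ring.
  rewrite ler_wpM2r ?expR_ge0 //.
  rewrite (_ : 2 * s = s + s) ?expRD; last by ring.
  have : 4 <= expR s.
    apply: (@le_trans _ _ (expR (1 + 1))); last by rewrite ler_expR; lra.
    by rewrite expRD; nra.
  by nra.
have E2 : 0 < expR (2 * s) by exact: expR_gt0.
have zr : md (z - 0) < expR (4 * s) / 4 by rewrite subr0; lra.
have hH w : md (w - 0) < expR (4 * s) -> [/\ hol G w, G w != 0 & md (G w) < expR (B + 1)].
  rewrite subr0 => wr; split=> //.
    rewrite /G mulf_neq0 //; last by apply: g0; exact: ltW.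
    by rewrite prodf_seq_neq0; apply/allP => a al; rewrite /= oppr_eq0 l0.
  apply: (@le_lt_trans _ _ (expR B)).
    by apply: GB; apply: ltW; apply: lt_trans wr _; rewrite ltr_expR; lra.
  by rewrite ltr_expR ltrDl.
have := zero_free_harnack hH zr.
rewrite subr0 G0; set u := 4 * md z / expR (4 * s); set D := ln _ - _; set A := B + 1 - _.
have A0 : 0 <= A by rewrite /A; have := ler0n R (size l); lra.
have uE : u * expR (2 * s) <= 4 * 1.
  rewrite /u mulrAC ler_pdivrMr ?expR_gt0 //.
  rewrite (_ : 4 * s = 2 * s + 2 * s) ?expRD; last by ring.
  by have := ler_wpM2r (ltW E2) zs; lra.
have u0 : 0 <= u by rewrite divr_ge0 ?mulr_ge0 ?md_ge0 ?expR_ge0.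
have u2 : u <= 1 / 2.
  rewrite /u ler_pdivrMr ?expR_gt0 //; lra.
have Au : 16 * A * u <= 4.
  by apply: le_trans (_ : expR (2 * s) * u <= 4); [rewrite ler_wpM2r|rewrite mulrC; lra].
move=> H; have D1 : `|D| <= 1.
  have : `|D| * (1 / 2) <= `|D| * (1 - u) by rewrite ler_wpM2l //; lra.
  lra.
have Gz : G z != 0 by have [|_ ->] := hH z => //; lra.
have mG : 0 < md (G z) by rewrite md_gt0.
have EG : md (G z) = md (F 0) * expR D.
  by rewrite /D expRB !lnK ?posrE // mulrCA divff ?mulr1 ?gt_eqF.
move: D1; rewrite ler_norml => /andP[D1 D2].
rewrite (FPG z) mdM -/(P z) EG (mulrC (md (P z))) (mulrC (expR (-1))) (mulrC (expR 1)).
split; rewrite ler_wpM2r ?md_ge0 // ler_wpM2l ?(ltW mF0) // ler_expR //.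
Qed.

Lemma md_prod_le_psi m (l : seq C) z x : {in l, forall a, a != 0} -> md z = expR x ->
  md z ^+ m * md (\prod_(a <- l) (1 - z / a)) <= expR (psi m l x).
Proof.
move=> l0 zx; rewrite /psi expRD zx expRM_natl ler_wpM2l ?exprn_ge0 ?expR_ge0 //.
rewrite expR_sum md_prod big_seq [X in _ <= X]big_seq; apply: ler_prod => a al.
have a0 : 0 < md a by rewrite md_gt0 l0.
rewrite md_ge0 /= lnK ?posrE ?ltr_wpDr ?divr_ge0 ?expR_ge0 ?(ltW a0) //.
by apply: le_trans (mdB _ _) _; rewrite md1 mdM mdV zx.
Qed.

Lemma sum_le_size (l : seq C) (G : C -> R) (q : R) : {in l, forall a, G a <= q} ->
  \sum_(a <- l) G a <= (size l)%:R * q.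
Proof.
elim: l => [|a l IH] H; first by rewrite big_nil mul0r.
rewrite big_cons /= -natr1 mulrDl mul1r addrC lerD //; last by apply: H; rewrite mem_head.
by apply: IH => x xl; apply: H; rewrite in_cons xl orbT.
Qed.

Lemma psi_upper m (l : seq C) (t s x : R) : 0 < t -> {in l, forall a, t <= md a} ->
  0 <= s -> x <= s -> psi m l x <= m%:R * s + (size l)%:R * (s + ln (1 + t^-1)).
Proof.
move=> t0 tl s0 xs; rewrite /psi lerD ?ler_wpM2l //; apply: sum_le_size => a /tl ta.
have ma : 0 < md a by exact: lt_le_trans ta.
have -> : s + ln (1 + t^-1) = ln (expR s * (1 + t^-1)).
  by rewrite lnM ?posrE ?expR_gt0 ?addr_gt0 ?invr_gt0 // expRK.
rewrite ler_ln ?posrE; last by rewrite mulr_gt0 ?expR_gt0 ?addr_gt0 ?invr_gt0.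
  rewrite mulrDr mulr1 lerD //; first by rewrite -[X in X <= _]expR0 ler_expR.
  by rewrite ler_pM ?expR_ge0 ?invr_ge0 ?md_ge0 ?ler_expR // lef_pV2 ?posrE.
by rewrite ltr_wpDr // divr_ge0 ?expR_ge0 ?md_ge0.
Qed.

Lemma psi_upper_arith (mm n B s c1 c2 : R) : 0 <= mm -> n <= B + c1 -> 1 <= B ->
  1 <= s -> 0 <= c1 -> 0 <= c2 ->
  mm * (2 * s) + n * (2 * s + c2) <= B * (s * (2 * mm + (1 + c1) * (2 + c2))).
Proof.
move=> m0 nB B1 s1 c10 c20.
have h1 : n * (2 * s + c2) <= (B + c1) * (2 * s + c2) by rewrite ler_wpM2r //; lra.
have h2 : (B + c1) * (2 * s + c2) <= B * (1 + c1) * (s * (2 + c2)).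
  have h3 : c1 * 1 <= c1 * B by rewrite ler_wpM2l.
  have h4 : c2 * 1 <= c2 * s by rewrite ler_wpM2l.
  by rewrite ler_pM //; lra.
have h5 : mm * (2 * s) * 1 <= mm * (2 * s) * B by rewrite ler_wpM2l // mulr_ge0 //; lra.
lra.
Qed.

(** Collects the losses in the exponent: [d] from the choice of the radius, [350 d] from
    the zeros, and [d] from the constants [c1] and [c4], which are small compared with
    [d * s]. *)
Lemma exponent_loss (k d L s c1 c4 P : R) : 0 < d -> d <= 1 / 1000 -> 3 / 2 <= k ->
  k <= 2 -> 0 <= c1 -> 0 <= c4 -> 0 <= s -> s <= L -> c4 + 2 * c1 <= d * s ->
  k * (1 - d) * L - c4 - c1 <= P -> k * (1 - 352 * d) * L <= (1 - 350 * d) * P - c1.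
Proof.
move=> d0 de k1 k2 c10 c40 s0 sL dsA kP.
have q0 : 0 <= 1 - 350 * d by clear -de; lra.
have q1 : (1 - 350 * d) * (k * (1 - d) * L - (c4 + c1)) <= (1 - 350 * d) * P.
  by rewrite ler_wpM2l //; clear -kP; lra.
have q2 : (1 - 350 * d) * (c4 + c1) <= 1 * (c4 + c1).
  by apply: ler_wpM2r; [exact: addr_ge0|clear -d0; lra].
have kL : 0 <= k * L by apply: mulr_ge0; [clear -k1; lra|exact: le_trans sL].
have q3 : k * L * (1 - 351 * d) <= k * L * ((1 - 350 * d) * (1 - d)).
  by rewrite ler_wpM2l //; clear -d0; nra.
have q4 : d * s <= d * (k * L).
  rewrite ler_wpM2l ?(ltW d0) //.
  have h1 : 1 * L <= k * L.
    by apply: ler_wpM2r; [exact: le_trans sL|clear -k1; lra].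
  by clear -h1 sL; lra.
have q5 : (1 - 350 * d) * (k * (1 - d) * L - (c4 + c1)) =
   k * L * ((1 - 350 * d) * (1 - d)) - (1 - 350 * d) * (c4 + c1) by ring.
have q6 : k * (1 - 352 * d) * L = k * L * (1 - 351 * d) - d * (k * L) by ring.
lra.
Qed.

(** With [delta = sqrt e], the mean growth rate of [ln psi] over
    [[k s (1 - delta), k s - 1]] is at most [7 e / delta = 7 delta]. Where this rate is
    attained, the weights of the zeros in [zeros_product_lower] have a sum that is small
    compared with [psi], so the minimum modulus is close to the maximum modulus. *)
Theorem min_modulus f : (forall z, hol f z) ->
  ~ (exists p : {poly C}, forall z, f z = p.[z]) ->
  exists s0 : R, forall s e k, s0 <= s -> 0 < e -> Num.sqrt e <= 1 / 1000 ->
    ln s <= e * s ->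
    maxmod (f : Cplx R -> Cplx R) (expR (5 * s)) <= expR (expR (5 * (e * s))) ->
    3 / 2 <= k <= 2 ->
    exists2 rho, expR s <= rho <= expR (k * s) & forall z, md z = rho ->
      expR (k * (1 - 352 * Num.sqrt e) * ln (maxmod (f : Cplx R -> Cplx R) (expR s)))
        <= md (f z).
Proof.
move=> hf nf; set M := maxmod _.
have [b fb] : exists b, f b != 0.
  apply: contrapT => H; apply: nf; exists 0 => z; rewrite horner0; apply/eqP.
  by apply/negPn/negP => fz; apply: H; exists z.
have [m [F [hF F0 fE]]] := split_zero_at_origin hf fb.
have [t t0 Ht] := zero_free_near0 (hF 0) F0.
have [X X1 HX] := transcendental_growth 1 hf nf.
have mF0 : 0 < md (F 0) by rewrite md_gt0.
set c1 := 1 + `|ln (md (F 0))|.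
have c11 : 1 <= c1 by rewrite lerDl.
have c1l : - ln (md (F 0)) <= c1 - 1 by rewrite /c1 addrAC subrr add0r -normrN ler_norm.
have c1u : ln (md (F 0)) <= c1 - 1 by rewrite /c1 addrAC subrr add0r ler_norm.
set c2 := ln (1 + t^-1).
have c20 : 0 <= c2 by rewrite ln_ge0 // lerDl invr_ge0 ltW.
set c3 := 2 * m%:R + (1 + c1) * (2 + c2).
have c31 : 1 <= c3.
  have h0 : (0 : R) <= 2 * m%:R by rewrite mulr_ge0.
  have : 0 <= c1 * c2 by rewrite mulr_ge0 //; exact: le_trans c11.
  by rewrite /c3; clear -h0 c11 c20; nra.
set c4 := `|ln (M 1)|.
have c40 : 0 <= c4 by exact: normr_ge0.
set A := 2 + c4 + 2 * c1.
set s0 := Num.max (expR 1) (Num.max X (Num.max c3 (Num.max (16 * (1 + c1)) (A ^+ 2)))).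
exists s0 => s e k; rewrite /s0 !ge_max => /andP[s1 /andP[sX /andP[sc3 /andP[sc1 sA]]]].
move=> e0 de lns MB /andP[k1 k2].
set d := Num.sqrt e in de *.
have d0 : 0 < d by rewrite sqrtr_gt0.
have dd : d * d = e by rewrite -expr2 sqr_sqrtr // ltW.
have s32 : 32 <= s by clear -sc1 c11; lra.
have sp : 0 < s by clear -s32; lra.
have ln1 : 1 <= ln s by rewrite -[1]expRK ler_ln ?posrE ?expR_gt0.
have es1 : 1 <= e * s by exact: le_trans lns.
have dsA : A <= d * s.
  have A0 : 0 <= A by rewrite /A; clear -c40 c11; lra.
  have ds0 : 0 <= d * s by rewrite mulr_ge0 // ltW.
  rewrite -(@ler_pXn2r _ 2) ?nnegrE //; apply: le_trans sA _.
  have -> : (d * s) ^+ 2 = e * s * s by rewrite -dd; ring.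
  by rewrite ler_peMl // ltW.
have ss : s <= expR s by have := expR_ge1Dx s; clear; lra.
have s0' : 0 <= expR s by exact: expR_ge0.
have MsX : expR s < M (expR s) by rewrite -[X in X < _]expr1; apply: HX; exact: le_trans ss.
have mono x y : x <= y -> M (expR x) <= M (expR y).
  by move=> xy; apply: maxmod_mono => //; rewrite ?expR_ge0 ?ler_expR.
have M1 : 0 < M 1.
  set u := Num.min 1 t / 2; have u0 : 0 < u by rewrite divr_gt0 // lt_min ltr01.
  have u1 : u <= 1 by rewrite ler_pdivrMr // ge_min; apply/orP; left; clear; lra.
  have ut : u < t.
    by rewrite ltr_pdivrMr // gt_min; apply/orP; right; clear -t0; lra.
  apply: (@lt_le_trans _ _ (md (f u%:C))).
    rewrite md_gt0 fE mulf_neq0 ?expf_neq0 //; first by rewrite -md_gt0 md_real_ge0 // ltW.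
    by apply/eqP => /Ht; rewrite (md_real_ge0 (ltW u0)); clear -ut; lra.
  by apply: le_maxmod_disc => //; rewrite md_real_ge0 // ltW.
have Mx x : 0 <= x -> 0 < M (expR x).
  by move=> x0; apply: lt_le_trans M1 _; rewrite -expR0; exact: mono.
set B := expR (5 * (e * s)).
have B1 : 1 <= B by rewrite -[X in X <= _]expR0 ler_expR; clear -es1; lra.
have e5 : 5 * (e * s) <= s.
  have : 5 * e <= 1 by rewrite -dd; clear -d0 de; nra.
  by move=> h; rewrite mulrA ler_piMl // ltW.
have Bs : B <= expR s by rewrite ler_expR.
have MF : maxmod (F : Cplx R -> Cplx R) (expR (5 * s)) <= expR B.
  apply: maxmod_le => // z zT.
  apply: le_trans MB; apply: (@le_trans _ _ (md (f z))).
    rewrite fE mdM mdX ler_peMl ?md_ge0 // exprn_ege1 // zT ltW // expR_gt1; clear -sp; lra.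
  by apply: le_maxmod_disc; rewrite ?zT.
have sB : 16 * (B + 1 - ln (md (F 0))) <= expR (2 * s).
  rewrite (_ : 2 * s = s + s) ?expRD; last by ring.
  have h1 : 16 * (1 + c1) * expR s <= expR s * expR s.
    by rewrite ler_wpM2r //; apply: le_trans sc1 ss.
  have h2 : c1 * 1 <= c1 * expR s.
    by rewrite ler_wpM2l //; [clear -c11; lra|clear -ss s32; lra].
  by clear -h1 h2 Bs c1l; lra.
have s2 : 2 <= s by clear -s32; lra.
have [l [lz lN lP]] := local_product hF F0 s2 MF sB.
have l0 : {in l, forall a, a != 0} by move=> a /lz[].
have eF : expR 1 * md (F 0) <= expR c1.
  by rewrite -[md (F 0)]lnK ?posrE // -expRD ler_expR; clear -c1u; lra.
have eF' : expR (- c1) <= expR (- 1) * md (F 0).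
  by rewrite -[md (F 0)]lnK ?posrE // -expRD ler_expR; clear -c1l; lra.
have U x : x <= 2 * s -> M (expR x) <= expR (psi m l x + c1).
  move=> xs; apply: maxmod_le => // z zx.
  have [|_ h] := lP z; first by rewrite zx ler_expR.
  have h2 := md_prod_le_psi m l0 zx.
  rewrite fE mdM mdX expRD.
  apply: (@le_trans _ _ (md z ^+ m * (expR 1 * md (F 0) * md (\prod_(a <- l) (1 - z / a))))).
    by rewrite ler_wpM2l ?exprn_ge0 ?md_ge0.
  rewrite mulrCA [X in _ <= X]mulrC ler_pM ?mulr_ge0 ?exprn_ge0 ?md_ge0 ?expR_ge0 //.
(* The [1] leaves room for the factor [2] in the choice of [rho]. *)
set x1 := k * (1 - d) * s; set x0 := k * s - 1.
have kd1 : 1 <= k * (1 - d) by clear -k1 d0 de; nra.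
have kd2 : k * (1 - d) <= 2 by clear -k1 k2 d0; nra.
have sx1 : s <= x1 by rewrite ler_peMl // ltW.
have ks2 : k * s <= 2 * s by rewrite ler_wpM2r // ltW.
have A4 : 4 <= A by rewrite /A; clear -c11 c40; lra.
have dx : d * s <= x0 - x1.
  have -> : x0 - x1 = k * (d * s) - 1 by rewrite /x0 /x1; ring.
  have ds0 : 0 <= d * s by clear -dsA A4; lra.
  have h : 3 / 2 * (d * s) <= k * (d * s) by rewrite ler_wpM2r.
  by clear -h dsA A4; lra.
have x10 : x1 < x0 by clear -dx dsA A4; lra.
have psi_lo x : s <= x -> x <= 2 * s -> s - c1 < psi m l x.
  move=> sx xs; have : expR s < expR (psi m l x + c1).
    by apply: lt_le_trans MsX _; apply: le_trans (mono _ _ sx) (U x xs).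
  by rewrite ltr_expR; clear; lra.
have psi1 x : x1 <= x <= x0 -> 1 <= psi m l x.
  move=> /andP[h1 h2]; have sx : s <= x by exact: le_trans h1.
  have xs : x <= 2 * s by rewrite /x0 in h2; clear -h2 ks2; lra.
  by have h := psi_lo x sx xs; clear -h sc1 c11; lra.
have psi_hi : psi m l x0 <= B * (s * c3).
  have tl : {in l, forall a, t <= md a} by move=> a /lz[_ /Ht].
  have x02 : x0 <= 2 * s by rewrite /x0; clear -ks2; lra.
  apply: le_trans (psi_upper m t0 tl _ x02) _; first by clear -sp; lra.
  apply: psi_upper_arith => //; [|clear -s32; lra|clear -c11; lra].
  by apply: le_trans lN _; clear -c1l; lra.
have [||x xin slow] := @psi_slow_point _ m l x1 x0 (7 * d) l0 x10.
- by move=> x /psi1; exact: lt_le_trans.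
- have x11 : x1 <= x1 <= x0 by rewrite lexx ltW.
  have x00 : x1 <= x0 <= x0 by rewrite lexx ltW.
  have h1 : 0 <= ln (psi m l x1) by rewrite ln_ge0 // psi1.
  have h2 : ln (psi m l x0) <= 5 * (e * s) + ln s + ln s.
    have p0 : 0 < psi m l x0 by exact: lt_le_trans (psi1 x0 x00).
    have B0 : 0 < B by exact: lt_le_trans B1.
    have c30 : 0 < c3 by exact: lt_le_trans c31.
    apply: (@le_trans _ _ (ln (B * (s * c3)))); first by rewrite ler_ln ?posrE ?mulr_gt0.
    rewrite !lnM ?posrE ?mulr_gt0 // /B expRK.
    have h : ln c3 <= ln s by rewrite ler_ln ?posrE.
    by clear -h; lra.
  have h3 : 7 * d * (d * s) <= 7 * d * (x0 - x1).
    by rewrite ler_wpM2l //; clear -d0; lra.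
  have h4 : 7 * d * (d * s) = 7 * (e * s) by rewrite -dd; ring.
  by clear -h1 h2 h3 h4 lns; lra.
have [rho /andP[r1 r2] Hrho] := zeros_product_lower (expR_gt0 x) l0.
case/andP: (xin) => x1x xx0.
have rk : rho <= expR (k * s).
  apply: le_trans r2 _; apply: (@le_trans _ _ (expR (x + 1))); last first.
    by rewrite ler_expR; rewrite /x0 in xx0; clear -xx0; lra.
  rewrite expRD mulrC ler_wpM2l ?expR_ge0 //.
  by have := expR_ge1Dx (1 : R); clear; lra.
exists rho; first by rewrite rk andbT; apply: le_trans r1; rewrite ler_expR (le_trans sx1).
move=> z zr; have [|Hlow _] := lP z.
  by rewrite zr; apply: le_trans rk _; rewrite ler_expR.
have HP := Hrho z zr.
have psix := psi1 x xin.
have main : expR ((1 - 350 * d) * psi m l x - c1) <= md (f z).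
  rewrite fE mdM mdX.
  apply: (@le_trans _ _ (expR x ^+ m * (expR (- 1) * md (F 0) *
     (\prod_(a <- l) (1 + expR x / md a) * expR (- (50 * \sum_(a <- l) expR x / (expR x + md a))))))).
    have -> : \prod_(a <- l) (1 + expR x / md a) = expR (\sum_(a <- l) ln (1 + expR x / md a)).
      rewrite expR_sum; apply: eq_big_seq => a al; rewrite lnK // posrE.
      by rewrite ltr_wpDr // divr_ge0 ?expR_ge0 ?md_ge0.
    set S := \sum_(a <- l) expR x / (expR x + md a).
    have Sd : S <= dpsi m l x by rewrite /dpsi lerDr.
    apply: (@le_trans _ _ (expR (m%:R * x) * (expR (- c1) *
      (expR (\sum_(a <- l) ln (1 + expR x / md a)) * expR (- (50 * S)))))).
      by rewrite -!expRD ler_expR; rewrite /psi in slow *; clear -slow Sd; lra.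
    rewrite expRM_natl ler_wpM2l ?exprn_ge0 ?expR_ge0 // ler_wpM2r //.
  apply: ler_pM.
  - by rewrite exprn_ge0 ?expR_ge0.
  - by rewrite !mulr_ge0 ?md_ge0 ?expR_ge0 // prodr_ge0 // => a _; rewrite addr_ge0 // divr_ge0 ?expR_ge0 ?md_ge0.
  - by rewrite zr lerXn2r ?nnegrE ?expR_ge0 // (le_trans _ r1) ?expR_ge0.
  - by apply: le_trans Hlow; rewrite ler_wpM2l // mulr_ge0 ?expR_ge0 ?md_ge0.
apply: le_trans main; rewrite ler_expR.
set L := ln (M (expR s)).
have Ls : s <= L by rewrite -[s]expRK ler_ln ?posrE ?expR_gt0 ?Mx ?ltW.
have Lx1 : k * (1 - d) * L - c4 <= ln (M (expR x1)).
  apply: le_trans (hadamard hf M1 sp kd1); rewrite -/L -/M lerD2l lerN2.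
  apply: le_trans (ler_norm _) _; rewrite normrM -/c4 ler_piMl //.
  have h0 : 0 <= k * (1 - d) - 1 by rewrite subr_ge0.
  by rewrite ger0_norm //; clear -kd2; lra.
have px : ln (M (expR x1)) - c1 <= psi m l x.
  have x2s : x <= 2 * s by rewrite /x0 in xx0; clear -xx0 ks2; lra.
  rewrite lerBlDr -[X in _ <= X]expRK ler_ln ?posrE ?expR_gt0 //.
    exact: le_trans (mono _ _ x1x) (U x x2s).
  by apply: Mx; apply: le_trans sx1; exact: ltW.
apply: (@exponent_loss k d L s c1 c4) => //.
- by clear -c11; lra.
- exact: ltW.
- by apply: le_trans dsA; rewrite /A; clear; lra.
- by apply: le_trans px; rewrite lerD2r.
Qed.

End MinimumModulus.

(** * The sequence of maximum moduli *)

Section GrowthSequence.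
Context {R : realType}.
Local Notation C := R[i].

Lemma tail_small (u : nat -> R) (a : R) : (forall n, 0 <= u n) -> 0 < a ->
  (\sum_(0 <= n <oo) (u n)%:E < +oo)%E ->
  exists N, forall n, (N <= n)%N -> \sum_(N <= j < n) u j <= a.
Proof.
move=> u0 a0 fin; set S := fun n => \sum_(0 <= j < n) u j.
have [T HT] : exists T : R, forall n, S n <= T.
  exists (fine (\sum_(0 <= n <oo) (u n)%:E)%E) => n.
  have h : ((S n)%:E <= \sum_(0 <= n <oo) (u n)%:E)%E.
    by rewrite /S -sumEFin; apply: nneseries_lim_ge => i _ _; rewrite lee_fin.
  rewrite -lee_fin fineK // fin_numE; apply/andP; split; last by rewrite lt_eqF.
  by rewrite gt_eqF // (lt_le_trans _ h) // ltNyr.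
have has : has_sup (range S).
  by split; [exists (S 0%N); exists 0%N|exists T => _ [n _ <-]].
have [_ [N _ <-] HN] := sup_adherent a0 has.
exists N => n Nn; have : S n <= sup (range S) by apply: (ub_le_sup has.2); exists n.
rewrite /S (big_cat_nat _ Nn) //= in HN *; lra.
Qed.

Variables (f : C -> C) (R1 : R).
Hypotheses (hf : forall z, hol f z)
  (nf : ~ (exists p : {poly C}, forall z, f z = p.[z]))
  (Rinf : max_iter (f : Cplx R -> Cplx R) R1 n @[n --> \oo] --> +oo)
  (rpos : forall n, 0 < max_ratio (f : Cplx R -> Cplx R) R1 n)
  (summable : (\sum_(0 <= n <oo) (Num.sqrt (max_ratio (f : Cplx R -> Cplx R) R1 n))%:E < +oo)%E).

Local Notation M := (maxmod (f : Cplx R -> Cplx R)).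
Local Notation Rn := (max_iter (f : Cplx R -> Cplx R) R1).
Local Notation eps := (max_ratio (f : Cplx R -> Cplx R) R1).

Lemma max_iterS n : Rn n.+1 = M (Rn n).
Proof. by []. Qed.

Lemma max_iter_ge (A : R) : exists N, forall n, (N <= n)%N -> A <= Rn n.
Proof.
have /cvgryPge/(_ A)[N _ H] := Rinf.
by exists N => n Nn; exact: H.
Qed.

Lemma maxmod_growth_bound n r : expR 1 <= Rn n -> Rn n <= r -> r <= Rn n.+1 ->
  (forall r, Rn n <= r -> expR 1 <= M r) ->
  M r <= expR (expR (eps n * ln r)).
Proof.
move=> Rn1 nr rn big.
have e1 : 1 < expR (1 : R) by rewrite expR_gt1.
have pos t : Rn n <= t -> 1 < t by move=> h; lra.
have lnpos t : Rn n <= t -> 0 < ln t by move=> /pos; exact: ln_gt0.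
have lnM t : Rn n <= t -> 1 <= ln (M t).
  by move=> /big h; rewrite -[X in X <= _]expRK ler_ln ?posrE ?expR_gt0 //; lra.
have ub : has_ubound [set loglog_ratio (f : Cplx R -> Cplx R) t | t in [set t | Rn n <= t <= Rn n.+1]].
  exists (ln (ln (M (Rn n.+1))) / ln (Rn n)) => _ [t /= /andP[t1 t2] <-].
  rewrite /loglog_ratio.
  have h1 : ln (ln (M t)) <= ln (ln (M (Rn n.+1))).
    have t2' : Rn n <= Rn n.+1 by exact: le_trans t2.
    rewrite ler_ln ?posrE; last by have := lnM _ t2'; lra.
      by rewrite ler_ln ?posrE ?maxmod_mono //; have := big _ t1; have := big _ t2'; have := pos _ t1; lra.
    by have := lnM _ t1; lra.
  have h2 : 0 <= ln (ln (M t)) by rewrite ln_ge0 // lnM.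
  apply: ler_pM => //; first by rewrite invr_ge0 ltW // lnpos.
  rewrite lef_pV2 ?posrE ?lnpos // ler_ln ?posrE //; have := pos _ t1; lra.
have h : loglog_ratio (f : Cplx R -> Cplx R) r <= eps n.
  by apply: ub_le_sup => //; exists r => //=; rewrite nr.
rewrite /loglog_ratio ler_pdivrMr ?lnpos // in h.
have M0 : 0 < M r by have := big _ nr; lra.
have L0 : 0 < ln (M r) by have := lnM _ nr; lra.
rewrite -[X in X <= _](lnK (M0 : M r \is Num.pos)) ler_expR.
by rewrite -[X in X <= _](lnK (L0 : ln (M r) \is Num.pos)) ler_expR.
Qed.

(** Each step costs the exponent at most [704 * sqrt (eps n)], which is summable;
    [k n] is what is left of the initial exponent [2]. *)
Lemma growth_sequence : exists (N : nat) (k : nat -> R),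
  (forall n, (N <= n)%N -> 3 / 2 <= k n <= 2) /\
  (forall n, (N <= n)%N -> expR 1 <= Rn n /\ Rn n ^+ 5 <= Rn n.+1) /\
  (forall n, (N <= n)%N -> exists2 rho, Rn n <= rho <= expR (k n * ln (Rn n)) &
     forall z, md z = rho -> expR (k n.+1 * ln (Rn n.+1)) <= md (f z)).
Proof.
have [s0 Hs0] := min_modulus hf nf.
have [X X1 HX] := transcendental_growth 5 hf nf.
have [N1 HN1] := max_iter_ge (Num.max (expR 1) (Num.max X (expR s0))).
have sq0 n : 0 <= Num.sqrt (eps n) by exact: sqrtr_ge0.
have a0 : (0 : R) < 1 / 2000 by lra.
have [N2 HN2] := tail_small sq0 a0 summable.
set N := maxn N1 N2.
have tail n : (N <= n)%N -> \sum_(N <= j < n) Num.sqrt (eps j) <= 1 / 2000.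
  move=> Nn; have N2n : (N2 <= n)%N by exact: leq_trans (leq_maxr N1 N2) Nn.
  apply: le_trans (HN2 n N2n); rewrite (big_cat_nat (leq_maxr N1 N2) Nn) /=.
  by rewrite lerDr sumr_ge0.
pose k n := 2 - 704 * \sum_(N <= j < n) Num.sqrt (eps j).
have k2 n : (N <= n)%N -> 3 / 2 <= k n <= 2.
  move=> /tail h; have h0 : 0 <= \sum_(N <= j < n) Num.sqrt (eps j) by rewrite sumr_ge0.
  by rewrite /k; lra.
have kS n : (N <= n)%N -> k n.+1 = k n - 704 * Num.sqrt (eps n).
  by move=> Nn; rewrite /k big_nat_recr //=; ring.
have sq n : (N <= n)%N -> Num.sqrt (eps n) <= 1 / 1000.
  move=> Nn; have := tail n.+1 (leqW Nn); rewrite big_nat_recr //=.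
  have : 0 <= \sum_(N <= j < n) Num.sqrt (eps j) by rewrite sumr_ge0.
  lra.
have big n : (N <= n)%N -> [/\ expR 1 <= Rn n, X <= Rn n & expR s0 <= Rn n].
  move=> Nn; have := HN1 n (leq_trans (leq_maxl _ _) Nn).
  by rewrite !ge_max => /andP[h1 /andP[h2 h3]].
have e1 : 1 < expR (1 : R) by rewrite expR_gt1.
have R5 n : (N <= n)%N -> Rn n ^+ 5 <= Rn n.+1.
  by move=> /big[_ h _]; rewrite max_iterS ltW // HX.
exists N, k; split=> //; split=> [n Nn|n Nn]; first by have [] := big n Nn; split => //; exact: R5.
have [b1 b2 b3] := big n Nn.
set s := ln (Rn n).
have R0 : 0 < Rn n := lt_le_trans (expR_gt0 1) b1.
have [b1' _ _] := big n.+1 (leqW Nn).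
have R0' : 0 < Rn n.+1 := lt_le_trans (expR_gt0 1) b1'.
have Es : expR s = Rn n by rewrite lnK.
have E5 : expR (5 * s) = Rn n ^+ 5 by rewrite -Es -expRM_natl.
have R1n : 1 <= Rn n := le_trans (ltW e1) b1.
have exp5 (r : R) : 1 <= r -> r <= r ^+ 5 by move=> r1; rewrite ler_eXnr.
have RR : Rn n <= Rn n.+1.
  by apply: le_trans (exp5 _ R1n) _; exact: R5.
have bigM r : Rn n <= r -> expR 1 <= M r.
  move=> h; have Xr : X <= r by exact: le_trans h.
  apply: le_trans (ltW (HX r Xr)); apply: le_trans b1 _; apply: le_trans (h) _.
  by apply: exp5; exact: le_trans h.
have s1 : 1 <= s by rewrite -[X in X <= _]expRK ler_ln ?posrE ?expR_gt0.
have h1 : s0 <= s by rewrite -ler_expR Es.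
have h2 : ln s <= eps n * s.
  have := maxmod_growth_bound b1 (lexx _) RR bigM; rewrite -max_iterS => h.
  have ls : s <= ln (Rn n.+1) by rewrite ler_ln ?posrE.
  have s_gt0 : 0 < s := lt_le_trans ltr01 s1.
  have l1 : 0 < ln (Rn n.+1) := lt_le_trans s_gt0 ls.
  apply: (@le_trans _ _ (ln (ln (Rn n.+1)))); first by rewrite ler_ln ?posrE.
  rewrite -[X in _ <= X]expRK ler_ln ?posrE ?expR_gt0 //.
  by rewrite -[X in _ <= X]expRK ler_ln ?posrE ?expR_gt0.
have h3 : M (expR (5 * s)) <= expR (expR (5 * (eps n * s))).
  rewrite (_ : 5 * (eps n * s) = eps n * ln (expR (5 * s))); last by rewrite expRK; ring.
  rewrite E5; apply: maxmod_growth_bound => //; last exact: R5.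
  exact: exp5.
have [rho rhoP H] := Hs0 s (eps n) (k n) h1 (rpos n) (sq n Nn) h2 h3 (k2 n Nn).
exists rho; first by rewrite -Es.
move=> z /H; apply: le_trans; rewrite Es -max_iterS ler_expR.
rewrite kS //; apply: ler_wpM2r; first exact: ln_ge0 (le_trans (ltW e1) b1').
have /andP[_ k22] := k2 n Nn; set q := Num.sqrt (eps n).
rewrite mulrBr mulr1 lerD2l lerN2 (_ : 704 = 2 * 352); last by rewrite -natrM.
rewrite -(mulrA 2).
have q0 : 0 <= 352 * q by apply: mulr_ge0; [exact: ler0n|exact: sqrtr_ge0].
exact: ler_wpM2r q0 _ _ k22.
Qed.

End GrowthSequence.

(** * Connected sets *)

Section Connectedness.
Context {R : realType}.
Local Notation C := R[i].
Implicit Types (A B X : set (Cplx R)) (z w x y : C) (r : R).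

Definition mball x r : set (Cplx R) := [set w | md (w - x) < r].

Lemma mball_center x r : 0 < r -> mball x r x.
Proof. by move=> r0; rewrite /mball /= subrr md0. Qed.

Lemma open_mball x r : open (mball x r : set (Cplx R)).
Proof.
rewrite openE => w wx; apply/nbhs_md.
by apply: (ball_nbh (P := mball x r)) wx _.
Qed.

Lemma not_bounded_far A : ~ bounded_set A -> forall r, exists2 z, A z & r < md z.
Proof.
move=> nb r; apply: contrapT => H; apply: nb.
exists (r%:C); split; first by apply/complex_realP; exists r.
move=> m rm z Az; have zr : md z <= r.
  by rewrite leNgt; apply/negP => h; apply: H; exists z.
rewrite /= normE; apply: le_trans (ltW rm); by rewrite lecR.
Qed.

(** The points linked to [x] by a good set form an open and closed part of [X]. *)
Lemma connected_chain X (Q : set (Cplx R) -> Prop) : connected X ->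
  (forall x, X x -> exists2 r, 0 < r & Q (mball x r)) ->
  (forall A B, Q A -> Q B -> A `&` B !=set0 -> Q (A `|` B)) ->
  forall x y, X x -> X y -> exists A, [/\ Q A, A y & exists2 r, 0 < r & mball x r `<=` A].
Proof.
move=> cX loc QU x y Xx Xy.
pose ok y := exists A, [/\ Q A, A y & exists2 r, 0 < r & mball x r `<=` A].
have step a b r : 0 < r -> Q (mball a r) -> X a -> mball a r b -> (ok a <-> ok b).
  move=> r0 Qr Xa ab; split=> -[A [QA Aa [s s0 sA]]]; exists (A `|` mball a r).
    split; first by apply: QU => //; exists a; split => //; exact: mball_center.
      by right.
    by exists s => //; apply: subset_trans sA _; exact: subsetUl.
  split; first by apply: QU => //; exists b.
    by right; exact: mball_center.
  by exists s => //; apply: subset_trans sA _; exact: subsetUl.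
pose rad a := xget 1 [set r | 0 < r /\ Q (mball a r)].
have radP a : X a -> 0 < rad a /\ Q (mball a (rad a)).
  by move=> /loc[r r0 Qr]; rewrite /rad; case: xgetP => [s _ //|/(_ r)/= []].
pose Y : set (Cplx R) := [set a | X a /\ ok a].
suff E : Y = X by move: Xy; rewrite -E => -[].
apply: cX.
- exists x; split=> //; have [r0 Qr] := radP x Xx.
  by exists (mball x (rad x)); split=> //; [exact: mball_center|exists (rad x)].
- exists (\bigcup_(a in Y) mball a (rad a)).
    by apply: bigcup_open => a _; exact: open_mball.
  rewrite eqEsubset; split=> [a Ya|b [Xb [a [Xa oka] ab]]].
    split; first by case: Ya.
    by exists a => //; apply: mball_center; apply: (radP a _).1; case: Ya.
  split=> //; have [r0 Qr] := radP a Xa; exact: (step a b _ r0 Qr Xa ab).1.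
- exists (~` \bigcup_(a in X `\` Y) mball a (rad a)).
    by apply: open_closedC; apply: bigcup_open => a _; exact: open_mball.
  rewrite eqEsubset; split=> [b [Xb okb]|a [Xa nU]].
    split=> // -[a [Xa nYa] ab]; apply: nYa; split=> //.
    by have [r0 Qr] := radP a Xa; exact: (step a b _ r0 Qr Xa ab).2.
  apply: contrapT => nY; apply: nU; exists a => //.
  by apply: mball_center; exact: (radP a Xa).1.
Qed.

(** The good sets linking a base point to the members of a finite cover overlap. *)
Lemma connected_chain_compact X (Q : set (Cplx R) -> Prop) x : connected X -> compact X ->
  X x ->
  (forall x, X x -> exists2 r, 0 < r & Q (mball x r)) ->
  (forall A B, Q A -> Q B -> A `&` B !=set0 -> Q (A `|` B)) ->
  exists2 A, Q A & X `<=` A.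
Proof.
move=> cX kX Xx loc QU.
have H y : X y -> exists A, [/\ Q A, A x & exists2 r, 0 < r & mball y r `<=` A].
  by move=> Xy; exact: connected_chain loc QU _ _ Xy Xx.
pose T y := xget set0 [set A | [/\ Q A, A x & exists2 r, 0 < r & mball y r `<=` A]].
have TP y : X y -> [/\ Q (T y), T y x & exists2 r, 0 < r & mball y r `<=` T y].
  by move=> /H[A HA]; rewrite /T; case: xgetP => [? ? //|/(_ A)].
pose U y := xget set0 [set B | exists2 r, 0 < r & B = mball y r /\ B `<=` T y].
have UP y : X y -> exists2 r, 0 < r & U y = mball y r /\ U y `<=` T y.
  move=> /TP[_ _ [r r0 rT]]; rewrite /U; case: xgetP => [? ? //|/(_ (mball y r))].
  by case; exists r.
move: kX; rewrite compact_cover => /(_ (Cplx R) X U) [|y Xy|D DX XD].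
- by move=> y /UP[r _ [-> _]]; exact: open_mball.
- by exists y => //; have [r r0 [-> _]] := UP y Xy; exact: mball_center.
have key (s : seq (Cplx R)) : {subset s <= X} -> exists2 A, Q A & A x /\ forall y, y \in s -> U y `<=` A.
  elim: s => [|a s IH] sX.
    by have [Qx xx _] := TP x Xx; exists (T x).
  have [|A QA [Ax AU]] := IH; first by move=> b bs; apply: sX; rewrite in_cons bs orbT.
  have Xa : X a by have := sX a (mem_head _ _); rewrite inE.
  have [Qa ax _] := TP a Xa; exists (T a `|` A); first by apply: QU => //; exists x.
  split; first by left.
  move=> y; rewrite in_cons => /orP[/eqP ->|ys].
    by have [r _ [_ h]] := UP a Xa; apply: subset_trans h _; exact: subsetUl.
  by apply: subset_trans (AU y ys) _; exact: subsetUr.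
have [|A QA [_ AU]] := key (finmap.enum_fset D); first by move=> y /DX.
exists A => // y /XD[a aD ay]; exact: (AU a aD).
Qed.

Lemma connected_segment_image (g : R -> C) a b : (forall t, rcont g t) ->
  connected [set (g t : Cplx R) | t in [set t : R | a <= t <= b]].
Proof.
move=> cg; apply: connected_continuous_connected.
  by apply/connected_intervalP => x y /andP[ax _] /andP[_ yb] z /andP[xz zy];
    rewrite /= (le_trans ax xz) (le_trans zy yb).
apply: continuous_subspaceT => t A /nbhs_md[e e0 H].
have [d d0 Hd] := cg t e e0; apply/nbhs_ballP; exists d => //= s.
by rewrite /ball /= distrC => st; apply: H; apply: Hd; rewrite rdistE.
Qed.

Lemma connected_mball x r : 0 < r -> connected (mball x r : set (Cplx R)).
Proof.
move=> r0; pose S (w : Cplx R) : set (Cplx R) := [set (x + t%:C * (w - x) : Cplx R) | t in [set t : R | 0 <= t <= 1]].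
have -> : mball x r = \bigcup_(w in mball x r) S w.
  rewrite eqEsubset; split=> [w wr|_ [w wr [t /= t01 <-]]].
    exists w => //; exists 1; first by rewrite /= ler01 lexx.
    by rewrite mul1r addrC subrK.
  apply: le_lt_trans wr; exact: segment_md.
apply: bigcup_connected.
  exists x => w wr; exists 0; first by rewrite /= lexx ler01.
  by rewrite mul0r addr0.
move=> w wr; apply: connected_segment_image => t.
apply: ccontD; first exact: ccont_cst.
by apply: ccontM; [exact: ccont_id|exact: ccont_cst].
Qed.

Lemma connected_circle r : 0 <= r -> connected ([set w | md w = r] : set (Cplx R)).
Proof.
move=> r0; rewrite (_ : [set w | _] = [set (circle 0 r t : Cplx R) | t in [set t : R | - pi <= t <= pi]]).
  apply: connected_segment_image => t; exact: cder_cont (rder_circle 0 r t).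
rewrite eqEsubset; split=> [w /= wr|_ [t _ <-]].
  have [w0|w0] := eqVneq w 0.
    exists 0; first by rewrite /= oppr_le0 pi_ge0.
    by move: wr; rewrite w0 md0 => <-; rewrite /circle mul0r addr0.
  have [z zw zpi] := cexp_surj w0; exists (Im z).
    by rewrite /= -ler_norml.
  have rE : r = expR (Re z) by rewrite -wr -zw md_cexp.
  rewrite /circle add0r -zw rE /cexp /cis /cexp ReM ImM /=.
  apply/eqP; rewrite eq_complex /= !mul0r !mulr0 !subr0 !mul1r add0r expR0 !mul1r addr0.
  by rewrite !eqxx.
by rewrite /= -[circle 0 r t]subr0 md_circle.
Qed.

Lemma connected_ivt X (g : C -> C) x y (c : R) : connected X -> (forall z, hol g z) ->
  X x -> X y -> md (g x) <= c -> c <= md (g y) -> exists2 z, X z & md (g z) = c.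
Proof.
move=> cX hg Xx Xy gx gy.
have /connected_intervalP H : connected [set (md (g z) : R) | z in X].
  apply: connected_continuous_connected => //.
  by apply: continuous_subspaceT => z; apply: continuous_md_comp; exact: hol_cont.
have [] := H (md (g x)) (md (g y)) _ _ c; first by exists x.
- by exists y.
- by rewrite gx gy.
by move=> z Xz zc; exists z.
Qed.

End Connectedness.

(** * Escaping to infinity *)

Section Escape.
Context {R : realType}.
Local Notation C := R[i].
Variable f : C -> C.
Hypothesis hf : forall z, hol f z.
Implicit Types (A B X : set (Cplx R)) (z w x y : C) (r : R).

Lemma hol_iter k z : hol (iter k f) z.
Proof.
elim: k z => [|k IH] z; first exact: hol_id.
exact: (hol_comp (IH z) (hf _)).
Qed.

Definition escapes A := forall B : R, exists k0, forall k, (k0 <= k)%N ->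
  forall w, A w -> B < md (iter k f w).

(** A form of normality that survives unions of overlapping sets. *)
Definition dichotomy A := forall s : nat -> nat, {homo s : m n / (m < n)%N} ->
  exists2 t : nat -> nat, {homo t : m n / (m < n)%N} &
    (exists B : R, forall k w, A w -> md (iter (s (t k)) f w) <= B) \/
    (forall B : R, exists k0, forall k, (k0 <= k)%N -> forall w, A w ->
       B < md (iter (s (t k)) f w)).

Lemma homo_ltn_ge (s : nat -> nat) k : {homo s : m n / (m < n)%N} -> (k <= s k)%N.
Proof.
move=> hs; elim: k => [//|k IH]; exact: leq_ltn_trans IH (hs _ _ (ltnSn k)).
Qed.

(** Uniform convergence on a small closed disc bounds the convergent subsequences. *)
Lemma fatou_dichotomy z : fatou_set (f : Cplx R -> Cplx R) z ->
  exists2 r, 0 < r & dichotomy (mball z r).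
Proof.
case=> U [oU Uz] nU.
have /nbhs_md[e e0 eU] : nbhs (z : Cplx R) U by exact: open_nbhs_nbhs.
have e2 : 0 < e / 2 by rewrite divr_gt0.
exists (e / 2) => // s hs.
have s_gt0 k : (0 < s k.+1)%N by apply: leq_ltn_trans (hs k k.+1 (ltnSn k)).
pose K : set (Cplx R) := [set w | md (w - z) <= e / 2].
have kK : compact K by exact: compact_closed_ball.
have KU : K `<=` U.
  move=> w /= wz; apply: eU; apply: le_lt_trans wz _.
  by rewrite ltr_pdivrMr // ltr_pMr // ltr1n.
have [|t ht H] := nU (fun k => iter (s k.+1) f); first by move=> k; exists (s k.+1); [exact: s_gt0|].
have htS : {homo (fun k => (t k).+1) : m n / (m < n)%N} by move=> m n /ht; rewrite ltnS.
case: H => [[h /(_ K kK KU) cv]|/(_ K kK KU) inf]; last first.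
  exists (fun k => (t k).+1) => //; right=> B.
  have [k0 _ Hk] := inf B; exists k0 => k kk w wz.
  by have := Hk k kk w (ltW wz); rewrite modulusE.
(* The iterates of a convergent subsequence are eventually within [1] of the limit,
   hence within [2] of each other. *)
pose E : set (Cplx R * Cplx R) := [set p | ball p.1 (1 : R[i]) p.2].
have EE : entourage E by exact: entourage_ball (1 : R[i])%:pos.
have [k1 _ Hk] : \forall k \near \oo, forall w : Cplx R, K w -> E (h w, iter (s (t k).+1) f w).
  have nh : nbhs (h : {uniform` K -> Cplx R})
      [set g : {uniform` K -> Cplx R} | forall w, K w -> E (h w, g w)].
    by apply: (iffRL (uniform_nbhs _ _)); exists E; split=> // g Hg w Kw; exact: Hg.
  exact: cv _ nh.
have near1 k w : (k1 <= k)%N -> K w -> md (iter (s (t k).+1) f w - h w) < 1.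
  move=> kk Kw; have := Hk k kk w Kw; rewrite /E /= -ball_normE /= normE ltcR.
  by rewrite mdC.
have K0 : K !=set0 by exists z; rewrite /K /= subrr md0 ltW.
have [c Kc maxc] := compact_md_max (f := iter (s (t k1).+1) f) K0 kK
  (fun w _ => hol_cont (hol_iter _ w)).
exists (fun k => (t (k1 + k)%N).+1).
  by move=> m n mn; apply: htS; rewrite ltn_add2l.
left; exists (md (iter (s (t k1).+1) f c) + 2) => k w /ltW Kw.
have n1 := near1 k1 w (leqnn _) Kw; have n2 := near1 (k1 + k)%N w (leq_addr _ _) Kw.
have mw := maxc w Kw.
set a := iter _ f w in n1 mw; set b := iter _ f w in n2 *.
have -> : b = (b - h w) + (h w - a) + a by rewrite addrA !subrK.
apply: le_trans (mdD _ _) _; have := mdD (b - h w) (h w - a).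
rewrite (mdC (h w)) => D.
clear -n1 n2 mw D; lra.
Qed.

Lemma dichotomyU A B : dichotomy A -> dichotomy B -> A `&` B !=set0 -> dichotomy (A `|` B).
Proof.
move=> dA dB [p [Ap Bp]] s hs.
have [t ht HA] := dA s hs.
have [u hu HB] := dB (s \o t) (fun m n mn => hs _ _ (ht _ _ mn)).
exists (t \o u); first by move=> m n mn; exact: ht _ _ (hu _ _ mn).
case: HA HB => [[a Ha]|Ha] [[b Hb]|Hb].
- left; exists (Num.max a b) => k w [/(Ha (u k)) h|/(Hb k) h]; rewrite le_max h ?orbT //.
- have [k0 /(_ k0 (leqnn _) p Bp)] := Hb a.
  by rewrite ltNge Ha.
- have [k0 H] := Ha b; have := H (u k0) (homo_ltn_ge _ hu) p Ap.
  by rewrite ltNge Hb.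
right=> B0; have [k1 H1] := Ha B0; have [k2 H2] := Hb B0.
exists (maxn k1 k2) => k; rewrite geq_max => /andP[h1 h2] w [Aw|Bw]; last exact: H2.
by apply: H1 => //; exact: leq_trans h1 (homo_ltn_ge _ hu).
Qed.

(** If the iterates did not tend to infinity uniformly on [A], a subsequence
    staying bounded at some points would contradict the dichotomy. *)
Lemma dichotomy_escapes A : dichotomy A ->
  (forall B : R, exists k0, forall k, (k0 <= k)%N -> exists2 w, A w & B < md (iter k f w)) ->
  escapes A.
Proof.
move=> dA far B; apply: contrapT => nB.
have bad k0 : exists k, (k0 <= k)%N /\ exists2 w, A w & md (iter k f w) <= B.
  apply: contrapT => H; apply: nB; exists k0 => k kk w Aw.
  by rewrite ltNge; apply/negP => h; apply: H; exists k; split=> //; exists w.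
pose c k0 := xget 0%N [set k | (k0 <= k)%N /\ exists2 w, A w & md (iter k f w) <= B].
have cP k0 : (k0 <= c k0)%N /\ exists2 w, A w & md (iter (c k0) f w) <= B.
  by have [k Hk] := bad k0; rewrite /c; case: xgetP => [_ _ //|/(_ k)].
pose s k := iter k (fun n => c n.+1) (c 0%N).
have hs : {homo s : m n / (m < n)%N}.
  by apply: homo_ltn => [? ? ?|k]; [exact: ltn_trans|exact: (cP _).1].
have sP k : exists2 w, A w & md (iter (s k) f w) <= B.
  by case: k => [|k]; exact: (cP _).2.
have [t ht [[b Hb]|H]] := dA s hs; last first.
  have [k0 Hk] := H B; have [w Aw] := sP (t k0).
  by rewrite leNgt (Hk k0).
have [k0 Hk] := far b; have [|w Aw] := Hk (s (t k0)) _.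
  apply: leq_trans (homo_ltn_ge _ hs); exact: homo_ltn_ge.
by rewrite ltNge Hb.
Qed.

Definition escaping_domain : set (Cplx R) :=
  [set z | exists2 r, 0 < r & escapes (mball z r)].

Lemma escaping_domain_open z : escaping_domain z ->
  exists2 r, 0 < r & escapes (mball z r) /\ mball z r `<=` escaping_domain.
Proof.
move=> [r r0 er]; exists r => //; split=> // w wz.
have [e e0 He] := ball_nbh (P := mball z r) wz (fun _ => id).
by exists e => // B; have [k0 H] := er B; exists k0 => k kk x /He; exact: H.
Qed.

(** By the open mapping theorem the image of a disc of uniform escape contains a disc. *)
Lemma escaping_domain_fwd z : (exists b, f b != f z) -> escaping_domain z ->
  escaping_domain (f z).
Proof.
move=> [b fb] [r r0 er]; have [m m0 Hm] := open_mapping hf fb r0.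
exists m => // B; have [k0 H] := er B; exists k0 => k kk w /Hm[x xz <-].
rewrite -iterSr; exact: H (leqW kk) _ xz.
Qed.

Lemma iter_escaping_domain (nc : forall z, exists b, f b != f z) j z :
  escaping_domain z -> escaping_domain (iter j f z).
Proof. by move=> Vz; elim: j => [//|j IH]; exact: (escaping_domain_fwd (nc _) IH). Qed.

(** * Distortion of the iterates *)

(** Used with [u j] the modulus of [iter j f] and its logarithm. *)
Definition comparable (u : nat -> C -> R) A := exists c j0, 0 <= c /\
  forall j, (j0 <= j)%N -> forall x y, A x -> A y -> 0 < u j y /\ u j x <= c * u j y.

Lemma comparableS u A B : A `<=` B -> comparable u B -> comparable u A.
Proof.
move=> AB [c [j0 [c0 H]]]; exists c, j0; split=> // j jj x y /AB Bx /AB By.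
exact: H.
Qed.

Lemma comparableU u A B : comparable u A -> comparable u B -> A `&` B !=set0 ->
  comparable u (A `|` B).
Proof.
move=> [a [j1 [a0 Ha]]] [b [j2 [b0 Hb]]] [p [Ap Bp]].
exists (a + b + a * b), (maxn j1 j2); split; first by rewrite !addr_ge0 ?mulr_ge0.
move=> j; rewrite geq_max => /andP[/Ha {}Ha /Hb {}Hb] x y ABx ABy.
have y0 : 0 < u j y by case: ABy => h; [exact: (Ha y y h h).1|exact: (Hb y y h h).1].
have ab0 : 0 <= a * b by exact: mulr_ge0.
have D (c v : R) : c <= a + b + a * b -> v <= c * u j y -> v <= (a + b + a * b) * u j y.
  by move=> cc h; apply: le_trans h _; apply: ler_wpM2r => //; exact: ltW.
split=> //; case: ABx ABy => [Ax|Bx] [Ay|By].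
- by apply: (D a); [lra|exact: (Ha x y Ax Ay).2].
- apply: (D (a * b)); first lra.
  by apply: le_trans (Ha x p Ax Ap).2 _; rewrite -mulrA ler_wpM2l //; exact: (Hb p y Bp By).2.
- apply: (D (a * b)); first lra.
  apply: le_trans (Hb x p Bx Bp).2 _; rewrite (mulrC a) -mulrA ler_wpM2l //.
  exact: (Ha p y Ap Ay).2.
- by apply: (D b); [lra|exact: (Hb x y Bx By).2].
Qed.

Lemma comparable_link u X x y : connected X ->
  (forall x, X x -> exists2 r, 0 < r & comparable u (mball x r)) -> X x -> X y ->
  exists A, [/\ comparable u A, A x & A y].
Proof.
move=> cX loc Xx Xy.
have [A [cA Ay [r r0 rA]]] := connected_chain cX loc (@comparableU u) Xx Xy.
by exists A; split=> //; apply: rA; exact: mball_center.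
Qed.

(** A logarithm of a large iterate omits, within distance 4 of each of its
    values, a logarithm of a point outside the escaping domain; the theorem of
    Bloch then bounds its derivative. *)
Lemma comparable_ball (nc : forall z, exists b, f b != f z) (r0 : R) z :
  (forall r, r0 <= r -> exists2 w, md w = r & ~ escaping_domain w) ->
  escaping_domain z -> exists2 r, 0 < r & comparable (fun j w => md (iter j f w)) (mball z r).
Proof.
move=> bad Vz; have [e e0 [esc eV]] := escaping_domain_open Vz.
have [j0 Hj] := esc (Num.max r0 0).
have e8 : 0 < e / 8 by rewrite divr_gt0.
exists (e / 32); first by rewrite divr_gt0.
exists (expR (96 * 2)), j0; split; first exact: expR_ge0.
move=> j jj x y zx zy; split.
  rewrite md_gt0 -md_gt0; apply: le_lt_trans (Hj j jj y _); first by rewrite le_max lexx orbT.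
  by apply: lt_trans zy _; lra.
have big w : md (w - z) < e -> r0 < md (iter j f w) /\ iter j f w != 0.
  by move=> wz; have := Hj j jj w wz; rewrite gt_max -md_gt0 => /andP[].
have [h Hh] := log_exists e0 (fun w wz => conj (hol_iter j w) (big w wz).2).
have dh w : md (w - z) < e / 8 -> md (dv h w) <= 96 * 4 / (e / 8).
  move=> wz; have sub u : md (u - w) < e / 8 -> md (u - z) < e / 4.
    move=> uw; have := mdD (u - w) (w - z); rewrite addrA subrK.
    by move: wz uw; lra.
  rewrite ler_pdivlMr //; apply: (@bloch R h w (e / 8) 4 e8 (fun u uw => (Hh u (sub u uw)).1)) => u uw.
  have [hu Eu] := Hh u (sub u uw).
  have ue : md (u - z) < e by apply: lt_trans (sub u uw) _; move: e0; lra.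
  have [r0u _] := big u ue.
  have [v vr nV] := bad _ (ltW r0u).
  have v0 : v != 0 by rewrite -md_gt0 vr md_gt0; exact: (big u ue).2.
  have [q qv qpi] : exists2 q, cexp q = v / iter j f u & `|Im q| <= pi.
    by apply: cexp_surj; rewrite mulf_neq0 ?invr_eq0 //; exact: (big u ue).2.
  exists (h u + q).
    rewrite addrC addKr.
    have Rq : Re q = 0.
      apply: expR_inj; rewrite expR0 -md_cexp qv mdM mdV vr divff //.
      by rewrite md_eq0; exact: (big u ue).2.
    have -> : md q = `|Im q| by rewrite /md Rq expr0n add0r sqrtr_sqr.
    by apply: le_lt_trans qpi _; have := pihalf_lt2 R; lra.
  move=> u' u'w; apply/eqP => Eq.
  have [_ E'] := Hh u' (sub u' u'w).
  apply: nV; rewrite (_ : v = iter j f u'); last first.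
    by rewrite -E' Eq cexpD Eu qv mulrC divfK //; exact: (big u ue).2.
  apply: iter_escaping_domain => //; apply: eV.
  by apply: lt_trans (sub u' u'w) _; move: e0; lra.
have xy : md (x - y) < e / 16.
  have := mdD (x - z) (z - y); rewrite addrA subrK (mdC z y).
  by move: zx zy; rewrite /mball /=; lra.
have near w : md (w - y) <= md (x - y) -> md (w - z) < e / 8.
  move=> wxy; have := mdD (w - y) (y - z); rewrite addrA subrK.
  by move: zy; rewrite /mball /=; lra.
have near4 w : md (w - z) < e / 8 -> md (w - z) < e / 4 by move=> wz; lra.
have lip : md (h x - h y) <= 96 * 4 / (e / 8) * md (x - y).
  apply: (lipschitz_of_cd (g := dv h)) => w /near wz; last exact: dh.
  by apply: dvP; apply: (Hh w _).1; exact: near4.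
have [_ Ex] := Hh x (near4 x (near x (lexx _))).
have [|_ Ey] := Hh y; first by apply/near4/near; rewrite subrr md0 md_ge0.
rewrite -Ex -Ey !md_cexp -expRD ler_expR -lerBlDr -ReB.
apply: le_trans (ler_norm _) _; apply: le_trans (md_Re _) _; apply: le_trans lip _.
rewrite (_ : 96 * 2 = 96 * 4 / (e / 8) * (e / 16)); last by field; rewrite gt_eqF.
apply: ler_wpM2l (ltW xy).
by apply: divr_ge0 (ltW e8); rewrite mulr_ge0 ?ler0n.
Qed.

(** Harnack's inequality for [1 / f^j], which is bounded by [1]. *)
Lemma log_comparable_ball z : escaping_domain z ->
  exists2 r, 0 < r & comparable (fun j w => ln (md (iter j f w))) (mball z r).
Proof.
move=> [e e0 esc]; have [j0 Hj] := esc 1.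
exists (e / 20); first by rewrite divr_gt0.
exists 3, j0; split=> // j jj.
have nz w : md (w - z) < e -> iter j f w != 0.
  by move=> wz; rewrite -md_gt0; apply: lt_trans (Hj j jj w wz).
have H x : mball z (e / 20) x ->
    `|ln (md (iter j f x)) - ln (md (iter j f z))| * (4 / 5) <=
      2 * ln (md (iter j f z)) * (1 / 5).
  move=> xz; have xz4 : md (x - z) < e / 4 by apply: lt_trans xz _; lra.
  have := @zero_free_harnack R (fun w => (iter j f w)^-1) z e 0 x _ xz4.
  rewrite !mdV !lnV ?posrE ?md_gt0; try by apply: nz; rewrite ?subrr ?md0 //; lra.
  rewrite !opprK add0r [_ + ln _]addrC distrC => Hz.
  set t := 4 * md (x - z) / e in Hz.
  have t5 : t <= 1 / 5 by rewrite /t ler_pdivrMr //; move: xz; rewrite /mball /=; lra.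
  have lz : 0 <= ln (md (iter j f z)).
    by apply/ln_ge0/ltW/(Hj j jj); exact: mball_center.
  apply: le_trans (_ : _ <= `|ln (md (iter j f x)) - ln (md (iter j f z))| * (1 - t)) _.
    by apply: ler_wpM2l => //; lra.
  apply: le_trans (Hz _) _; last by apply: ler_wpM2l => //; lra.
  move=> w wz; rewrite invr_eq0 expR0; split; [|exact: nz|].
    by apply: holV; [exact: nz|exact: hol_iter].
  by rewrite mdV invf_lt1 ?md_gt0 ?nz // (Hj j jj).
move=> x y /H Hx yz; have Hy := H y yz; split.
  by apply/ln_gt0/(Hj j jj); apply: lt_le_trans yz _; lra.
move: Hx Hy; have := ler_norm (ln (md (iter j f x)) - ln (md (iter j f z))).
have := ler_norm (ln (md (iter j f z)) - ln (md (iter j f y))).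
rewrite (distrC (ln (md (iter j f z)))); lra.
Qed.

Lemma log_comparable_circle r : 0 <= r -> (forall w, md w = r -> escaping_domain w) ->
  comparable (fun j w => ln (md (iter j f w))) [set w | md w = r].
Proof.
move=> r0 H; pose K : set (Cplx R) := [set w | md w = r].
have kK : compact K.
  have := @compact_circle R 0 r; congr compact.
  by apply/seteqP; split=> w /=; rewrite subr0.
have Kr : K r%:C by rewrite /K /= md_real ger0_norm.
have [A QA KA] := connected_chain_compact (connected_circle r0) kK Kr
  (fun x Kx => log_comparable_ball (H x Kx)) (@comparableU _).
exact: comparableS KA QA.
Qed.

(** Because of the fixed point, the image of the disc under [iter j f] covers a disc of
    radius about [s / 4]; there [f] is bounded by [s ^+ d], which only polynomials
    allow. *)
Lemma iterate_covering_contra p r d : ~ (exists p : {poly R[i]}, forall z, f z = p.[z]) ->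
  f p = p -> md p <= r ->
  (forall S, exists s j, S <= s /\ forall x, md x = r ->
     s <= md (iter j f x) /\ md (iter j.+1 f x) <= s ^+ d) -> False.
Proof.
move=> nf fp pr H; have [B B1 HB] := transcendental_growth d.+1 hf nf.
pose T := B + md p + 5 ^+ d.
have [s [j [Ts Hs]]] := H (4 * T + md p).
have p0 := md_ge0 p; have d0 : 0 <= (5 : R) ^+ d by exact: exprn_ge0.
pose t := (s - md p) / 4; have tT : T <= t by rewrite /t ler_pdivlMr //; lra.
have t0 : 0 < t by apply: lt_le_trans tT; rewrite /T; lra.
have Bt : B <= t by apply: le_trans tT; rewrite /T; lra.
have s5 : s <= 5 * t.
  have : md p <= t by apply: le_trans tT; rewrite /T; lra.
  by rewrite (_ : 5 * t = 4 * t + t); [rewrite [4 * t]mulrC divfK //; lra|lra].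
have ip : iter j f p = p by elim: (j) => [//|i IH]; rewrite /= IH.
have := HB t Bt; rewrite ltNge => /negP; apply.
apply: le_trans (_ : (5 * t) ^+ d <= _); last first.
  rewrite exprMn exprSr mulrC ler_wpM2l ?exprn_ge0 ?(ltW t0) //.
  by apply: le_trans tT; rewrite /T; lra.
apply: maxmod_le => //; first exact: ltW.
have tE : 4 * t = s - md p by rewrite /t mulrC divfK.
move=> w wt; have [||||z zr zw] := @value_taken R (iter j f) 0 r p w (s - t).
- by move=> z _; exact: hol_iter.
- by rewrite subr0.
- move=> z; rewrite subr0 => zr; have [h _] := Hs z zr.
  have := mdD (iter j f z - w) w; rewrite subrK wt; lra.
- have := mdB p w; rewrite ip wt => h; apply: le_lt_trans h _; lra.
rewrite subr0 in zr.
apply: le_trans (_ : s ^+ d <= _); last first.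
  by apply: lerXn2r => //; rewrite nnegrE; lra.
rewrite -zw -[f _]/(iter j.+1 f z).
apply: (@max_disc_le R (iter j.+1 f) 0 r); last by rewrite subr0.
- by move=> u _; exact: hol_iter.
by move=> u; rewrite subr0 => ur; exact: (Hs u ur).2.
Qed.

End Escape.

(** * Unbounded connected sets *)

(** [rad n] and [top n] stand for [R_n] and [R_n ^ k_n], from some index on. *)
Section FastGrowth.
Context {R : realType}.
Local Notation C := R[i].
Variable f : C -> C.
Hypothesis hf : forall z, hol f z.
Variables rad k : nat -> R.
Let top n := expR (k n * ln (rad n)).
Hypothesis k_ge : forall n, 3 / 2 <= k n.
Hypothesis k_le : forall n, k n <= 2.
Hypothesis rad_ge : forall n, expR 1 <= rad n.
Hypothesis rad_exp : forall n, rad n ^+ 5 <= rad n.+1.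
Hypothesis rad_disc : forall n (w : C), md w <= rad n -> md (f w) <= rad n.+1.
Hypothesis rad_circle : forall n, exists2 rho, rad n <= rho <= top n &
  forall z, md z = rho -> top n.+1 <= md (f z).
Implicit Types (A B X : set (Cplx R)) (z w x y : C).

Lemma rad_ge2 n : 2 <= rad n.
Proof.
by apply: le_trans (rad_ge n); apply: le_trans (expR_ge1Dx 1).
Qed.

Lemma rad_ge_nat n : n%:R <= rad n.
Proof.
elim: n => [|n IH]; first by apply: le_trans (rad_ge2 0).
apply: le_trans (rad_exp n); have r2 := rad_ge2 n.
have : rad n * 2 <= rad n ^+ 5.
  rewrite exprS ler_wpM2l ?(le_trans _ r2) //.
  have -> : (2 : R) = 2 ^+ 1 by [].
  apply: le_trans (_ : rad n ^+ 1 <= _); first by rewrite !expr1.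
  by rewrite ler_weXn2l // (le_trans _ r2) // ler1n.
rewrite -natr1; lra.
Qed.

Lemma rad_infty (B : R) : exists n0, forall n, (n0 <= n)%N -> B < rad n.
Proof.
exists (Num.truncn B).+1 => n nn; apply: lt_le_trans (rad_ge_nat n).
apply: lt_le_trans (_ : ((Num.truncn B).+1%:R : R) <= _); last by rewrite ler_nat.
exact: truncnS_gt.
Qed.

Lemma ln_rad_ge1 n : 1 <= ln (rad n).
Proof.
rewrite -[X in X <= _](expRK 1) ler_ln ?posrE ?expR_gt0 //.
by apply: lt_le_trans (rad_ge2 n).
Qed.

Lemma rad_expR n : rad n = expR (ln (rad n)).
Proof. by rewrite lnK // posrE; apply: lt_le_trans (rad_ge2 n). Qed.

Lemma rad_le_top n : rad n <= top n.
Proof.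
rewrite [leLHS]rad_expR ler_expR; have := ln_rad_ge1 n; have := k_ge n.
set a := ln _; set b := k n => kb la; have : 0 <= (b - 1) * a by apply: mulr_ge0; lra.
lra.
Qed.

Lemma top_le n : top n <= rad n ^+ 2.
Proof.
rewrite [X in X ^+ 2]rad_expR -expRM_natl ler_expR ler_wpM2r //.
by apply: le_trans (ln_rad_ge1 n).
Qed.

Lemma top_sq_ge n : rad n ^+ 3 <= top n ^+ 2.
Proof.
rewrite [X in X ^+ 3]rad_expR -!expRM_natl ler_expR mulrA.
apply: ler_wpM2r; first by apply: le_trans (ln_rad_ge1 n).
by have := k_ge n; lra.
Qed.

Lemma iter_rad_le n j z : md z <= rad n -> md (iter j f z) <= rad (n + j).
Proof.
by move=> zn; elim: j => [|j IH]; rewrite ?addn0 //= addnS; exact: rad_disc.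
Qed.

(** A connected set joining the disc of radius [rad n] to the outside of the
    disc of radius [top n] meets the circle of radius [rho] in between, which
    is mapped outside the disc of radius [top n.+1]; so the image of the set
    has the same property with [n.+1]. *)
Lemma connected_iter_far A n x y j : connected A -> A x -> A y ->
  md x <= rad n -> top n <= md y -> exists2 y', A y' & top (n + j) <= md (iter j f y').
Proof.
move=> cA Ax Ay xn ny; elim: j => [|j [y' Ay' IH]]; first by exists y; rewrite ?addn0.
have [rho /andP[r1 r2] H] := rad_circle (n + j).
have [] := @connected_ivt R A (iter j f) x y' rho cA (hol_iter hf j) Ax Ay'.
- by apply: le_trans r1; exact: iter_rad_le.
- exact: le_trans IH.
by move=> z Az zr; exists z => //; rewrite addnS; exact: H.
Qed.

Lemma unbounded_reach X z : ~ bounded_set X ->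
  exists n, md z <= rad n /\ exists2 y, X y & top n <= md y.
Proof.
move=> uX; have [n Hn] := rad_infty (md z); exists n; split; first by rewrite ltW ?Hn.
by have [y Xy ty] := not_bounded_far uX (top n); exists y => //; exact: ltW.
Qed.

(** The far points given by [connected_iter_far] rule out the bounded alternative of the
    dichotomy. *)
Lemma unbounded_fatou_escapes X : connected X -> ~ bounded_set X ->
  X `<=` fatou_set (f : Cplx R -> Cplx R) -> X `<=` escaping_domain f.
Proof.
move=> cX uX XF z Xz.
have [n [zn [y Xy yn]]] := unbounded_reach z uX.
have [|A B [cA dA] [cB dB] AB|A [[cA dA] Ay [r r0 rA]]] := @connected_chain R X
  (fun A => connected A /\ dichotomy f A) cX _ _ z y Xz Xy.
- move=> x /XF Fx; have [r r0 dr] := fatou_dichotomy hf Fx.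
  by exists r => //; split=> //; exact: connected_mball.
- by split; [exact: connectedU|exact: dichotomyU].
exists r => // B; have Az : A z by apply: rA; exact: mball_center.
have [|k0 H] := dichotomy_escapes dA _ B; last by exists k0 => j jk w /rA; exact: H.
move=> B'; have [n0 H0] := rad_infty B'; exists n0 => j jn.
have [w Aw wt] := connected_iter_far j cA Az Ay zn yn; exists w => //.
apply: lt_le_trans wt; apply: lt_le_trans (rad_le_top _); apply: H0.
exact: leq_trans jn (leq_addl _ _).
Qed.

(** A bound [|f^j w| <= c |f^j z|] along a connected set is incompatible with
    [|f^j z| <= R] and [|f^j w| >= R ^ (3/2)] for arbitrarily large [R]. *)
Lemma comparable_contra X : connected X -> ~ bounded_set X -> X !=set0 ->
  (forall z, X z -> exists2 r, 0 < r & comparable (fun j w => md (iter j f w)) (mball z r)) ->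
  False.
Proof.
move=> cX uX [z Xz] loc.
have [n [zn [y Xy yn]]] := unbounded_reach z uX.
pose u j w := md (iter j f w).
have [|A B [cA dA] [cB dB] AB|A [[cA [c [j0 [c0 Hc]]]] Ay [r r0 rA]]] := @connected_chain R X
  (fun A => connected A /\ comparable u A) cX _ _ z y Xz Xy.
- by move=> x /loc[r r0 dr]; exists r => //; split=> //; exact: connected_mball.
- by split; [exact: connectedU|exact: comparableU].
have Az : A z by apply: rA; exact: mball_center.
have [n0 H0] := rad_infty (c ^+ 2); pose j := maxn j0 n0.
have [w Aw wt] := connected_iter_far j cA Az Ay zn yn.
have le1 : top (n + j) <= c * rad (n + j).
  apply: le_trans wt _; apply: le_trans (Hc j (leq_maxl _ _) w z Aw Az).2 _.
  by apply: ler_wpM2l => //; exact: iter_rad_le.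
have r2 := rad_ge2 (n + j); have t3 := top_sq_ge (n + j).
have := H0 (n + j)%N (leq_trans (leq_maxr _ _) (leq_addl n j)).
rewrite ltNge => /negP; apply.
have r_gt0 : 0 < rad (n + j) by apply: lt_le_trans r2.
rewrite -(ler_pM2r (exprn_gt0 2 r_gt0)) -exprS -exprMn.
apply: le_trans t3 _; rewrite lerXn2r ?nnegrE ?expR_ge0 //.
by apply: mulr_ge0 => //; exact: ltW.
Qed.

(** Fixed points exist because [f z - z] cannot be zero-free: its reciprocal
    would be small on large circles. *)
Lemma fixed_point_exists : exists p, f p = p.
Proof.
apply: contrapT => nfix.
have nz z : f z - z != 0 by rewrite subr_eq0; apply/eqP => E; apply: nfix; exists z.
have hg z : hol (fun w => (f w - w)^-1) z.
  by apply: holV => //; apply: holB; [exact: hf|exact: hol_id].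
suff /(_ 0)/eqP : forall z, (f z - z)^-1 = 0 by rewrite invr_eq0 (negPf (nz 0)).
apply: small_on_circles_eq0 => // e B e0.
have [n0 H0] := rad_infty (Num.max B e^-1).
have [rho /andP[r1 r2] H] := rad_circle n0.
have := H0 n0 (leqnn _); rewrite gt_max => /andP[hB he].
exists rho; first by apply: le_trans r1; exact: ltW.
move=> z zr; rewrite mdV -(invrK e) lef_pV2 ?posrE ?invr_gt0 ?md_gt0 //.
have lo := le_trans (rad_le_top n0.+1) (H z zr).
have : md (f z) <= md (f z - z) + md z by rewrite -{1}(subrK z (f z)) mdD.
rewrite zr => lo2; have t2 := le_trans r2 (top_le n0).
have r5 := rad_exp n0; have rr := rad_ge2 n0.
have : rad n0 ^+ 2 * 8 <= rad n0 ^+ 5.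
  rewrite (_ : 5%N = 2 + 3)%N // exprD ler_wpM2l ?sqr_ge0 //.
  rewrite (_ : (8 : R) = 2 ^+ 3); last by rewrite !exprS expr0; lra.
  by rewrite lerXn2r ?nnegrE //; lra.
have : rad n0 * 2 <= rad n0 ^+ 2 by rewrite expr2 ler_wpM2l //; lra.
move: he lo2 lo r5 t2 rr; set a := rad n0; set b := rad _; set x := _ ^+ 2; set y := _ ^+ 5.
by move=> *; lra.
Qed.

(** With [z1], [z2], [z3] in [X] such that [|z1| = r] and [|f z2| = |z3| = r'], points of
    the circle of radius [r] are compared after [j + 1] steps with [z1] and [z2], and
    [f z2] is compared after [j] steps with [z3] and then [z1] again. *)
Lemma log_comparable_contra X : ~ (exists p : {poly R[i]}, forall z, f z = p.[z]) ->
  connected X -> ~ bounded_set X -> X !=set0 -> X `<=` escaping_domain f ->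
  (forall r0 : R, exists2 r, r0 <= r & forall w, md w = r -> escaping_domain f w) -> False.
Proof.
move=> nf cX uX [x0 Xx0] XV good.
have [p fp] := fixed_point_exists.
(* One step of [connected_iter_far] shows that the image of [X] is unbounded. *)
have fX_far (r : R) : exists2 z, X z & r <= md (f z).
  have [n [rn [y Xy yn]]] := unbounded_reach (Num.max r (md x0))%:C uX.
  have {}rn : Num.max r (md x0) <= rad n by apply: le_trans rn; rewrite md_real ler_norm.
  move: rn; rewrite ge_max => /andP[rn xn].
  have [w Xw wn] := connected_iter_far 1 cX Xx0 Xy xn yn; exists w => //.
  apply: le_trans wn; apply: le_trans (rad_le_top _); rewrite addn1.
  apply: le_trans rn _; apply: le_trans (rad_exp n).
  by rewrite ler_eXnr // (le_trans _ (rad_ge2 n)) // ler1n.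
have meets (g : C -> C) r : (forall z, hol g z) -> md (g x0) <= r ->
    (exists2 y, X y & r <= md (g y)) -> exists2 z, X z & md (g z) = r.
  by move=> hg g0 [y Xy gy]; exact: connected_ivt cX hg Xx0 Xy g0 gy.
have [r r_ge Vr] := good (md x0 + md p).
have [r' r'_ge Vr'] := good (md x0 + md (f x0)).
have := md_ge0 x0; have := md_ge0 p; have := md_ge0 (f x0) => fx0 p0 x00.
have far (s : R) : exists2 y, X y & s <= md y.
  by have [y Xy /ltW sy] := not_bounded_far uX s; exists y.
have [|z1 Xz1 z1r] := meets id r (@hol_id R) _ (far r); first by rewrite /=; lra.
have [|z2 Xz2 z2r] := meets f r' hf _ (fX_far r'); first by lra.
have [|z3 Xz3 z3r] := meets id r' (@hol_id R) _ (far r'); first by rewrite /=; lra.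
pose u j w := ln (md (iter j f w)).
have [|c1 [j1 [c1_ge0 H1]]] := log_comparable_circle hf _ Vr; first by lra.
have link x y : X x -> X y -> exists A, [/\ comparable u A, A x & A y].
  by apply: comparable_link => // w /XV; exact: log_comparable_ball.
have [A [[c2 [j2 [c2_ge0 H2]]] Az1 Az2]] := link z1 z2 Xz1 Xz2.
have [|c3 [j3 [c3_ge0 H3]]] := log_comparable_circle hf _ Vr'; first by lra.
have [B [[c4 [j4 [c4_ge0 H4]]] Bz3 Bz1]] := link z3 z1 Xz3 Xz1.
pose c := c1 * c2 * c3 * c4.
have up j : (maxn (maxn j1 j2) (maxn j3 j4) <= j)%N -> forall x, md x = r ->
    u j.+1 x <= c * u j z1.
  rewrite !geq_max => /andP[/andP[h1 h2] /andP[h3 h4]] x xr.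
  apply: le_trans (H1 j.+1 (leqW h1) x z1 xr z1r).2 _.
  rewrite /c -!mulrA; apply: ler_wpM2l => //.
  apply: le_trans (H2 j.+1 (leqW h2) z1 z2 Az1 Az2).2 _; apply: ler_wpM2l => //.
  rewrite [u _ z2]/u iterSr; apply: le_trans (H3 j h3 (f z2) z3 z2r z3r).2 _; apply: ler_wpM2l => //.
  exact: (H4 j h4 z3 z1 Bz3 Bz1).2.
have c1_gt0 : 0 < c1.
  have [z1_1 z1_c] := H1 j1 (leqnn _) z1 z1 z1r z1r.
  by rewrite lt0r c1_ge0 andbT; apply: contraTneq z1_c => ->; rewrite mul0r -ltNge.
have cc_ge0 : 0 <= c * c1 by rewrite !mulr_ge0.
apply: (iterate_covering_contra hf (p := p) (r := r) (d := (Num.truncn (c * c1)).+1) nf fp).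
  by lra.
move=> S; have [e e0 esc] := XV z1 Xz1.
have [j5 H5] := esc (expR (c1 * ln (Num.max S 1))).
pose j := maxn (maxn (maxn j1 j2) (maxn j3 j4)) j5.
have z1_big := H5 j (leq_maxr _ _) z1 (mball_center _ e0).
have j1j : (j1 <= j)%N by rewrite /j !leq_max leqnn.
have z1_1 : 0 < u j z1 := (H1 j j1j z1 z1 z1r z1r).1.
have S1 : 0 < Num.max S 1 by rewrite lt_max ltr01 orbT.
have uK i x : 0 < u i x -> expR (u i x) = md (iter i f x).
  by move=> ux; apply: lnK; rewrite posrE ltNge; apply: contraL ux => /ln0 h; rewrite /u h ltxx.
exists (expR (u j z1 / c1)), j; split.
  apply: le_trans (_ : Num.max S 1 <= _); first by rewrite le_max lexx.
  rewrite -[leLHS]lnK ?posrE // ler_expR ler_pdivlMr // mulrC.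
  by rewrite -ler_expR uK // ltW.
move=> x xr; have [x1 xc] := H1 j j1j z1 x z1r xr; split.
  by rewrite -uK // ler_expR ler_pdivrMr // mulrC.
rewrite -uK ?(H1 j.+1 (leqW j1j) x x xr xr).1 // -expRM_natl ler_expR.
apply: le_trans (up j (leq_maxl _ _) x xr) _.
have -> : c * u j z1 = c * c1 * (u j z1 / c1) by field; rewrite gt_eqF.
apply: ler_wpM2r; last by rewrite ltW // truncnS_gt.
by rewrite divr_ge0 // ltW.
Qed.

Lemma no_unbounded_fatou_subset X : ~ (exists p : {poly R[i]}, forall z, f z = p.[z]) ->
  connected X -> ~ bounded_set X -> X `<=` fatou_set (f : Cplx R -> Cplx R) -> False.
Proof.
move=> nf cX uX XF; have XV := unbounded_fatou_escapes cX uX XF.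
have X0 : X !=set0 by have [z Xz _] := not_bounded_far uX 0; exists z.
have nc z : exists b, f b != f z.
  apply: contrapT => H; apply: nf; exists (f z)%:P => w; rewrite hornerC.
  by apply: contrapT => E; apply: H; exists w; apply/eqP.
have [bad|good] := pselect (exists r0 : R, forall r, r0 <= r ->
    exists2 w, md w = r & ~ escaping_domain f w).
  have [r0 Hr0] := bad; apply: (comparable_contra cX uX X0) => z Xz.
  exact: (comparable_ball hf nc Hr0 (XV z Xz)).
apply: (log_comparable_contra nf cX uX X0 XV) => r0.
apply: contrapT => H; apply: good; exists r0 => r r0r.
apply: contrapT => H'; apply: H; exists r => // w wr.
by apply: contrapT => nV; apply: H'; exists w.
Qed.

End FastGrowth.

Theorem theorem3 (R : realType) (f : Cplx R -> Cplx R) (R1 : R)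
  (f_transcendental : transcendental_entire f)
  (f_order0 : order_of_growth f = 0%E)
  (R1_gt0 : 0 < R1)
  (max_iter_infty : max_iter f R1 n @[n --> \oo] --> +oo)
  (max_ratio_gt0 : forall n, 0 < max_ratio f R1 n)
  (summable : (\sum_(0 <= n <oo) (Num.sqrt (max_ratio f R1 n))%:E < +oo)%E) :
  ~ exists2 D : set (Cplx R), is_component_of (fatou_set f) D & ~ bounded_set D.
Proof.
case=> D [z Fz ->] uD; have [ef nf] := f_transcendental.
have hf w : hol f w by exact: hol_of_derivable (ef w).
have [N [k [k_in [rad_in rho_in]]]] :=
  @growth_sequence R f R1 hf nf max_iter_infty max_ratio_gt0 summable.
apply: (@no_unbounded_fatou_subset R f hf (fun n => max_iter f R1 (N + n))
  (fun n => k (N + n)%N) _ _ _ _ _ _ (connected_component (fatou_set f) z)).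
- by move=> n; have /andP[] := k_in (N + n)%N (leq_addr _ _).
- by move=> n; have /andP[] := k_in (N + n)%N (leq_addr _ _).
- by move=> n; have [] := rad_in (N + n)%N (leq_addr _ _).
- by move=> n; rewrite addnS; have [] := rad_in (N + n)%N (leq_addr _ _).
- by move=> n w wn; rewrite addnS max_iterS; exact: le_maxmod_disc.
- by move=> n; rewrite addnS; exact: rho_in (leq_addr _ _).
- exact: nf.
- exact: component_connected.
- exact: uD.
- exact: connected_component_sub.
Qed.
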